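(* Let $p$ be odd, let $F$ have characteristic $2$, and write $\chi=\chi_{v_n}$. Suppose the following identities hold in the Steinberg module $I$: $$c_n e_\chi=e_1+\sum_{\alpha\in\mathcal{T}_q}(\lambda(-2\alpha)+\lambda(2\alpha))\,e_{\chi_{\alpha v_n}},$$ $$c_{n-1}e_\chi=\sum_{\alpha\in F_q}w_{n-1}\,x_{n-1,n}(-\alpha)\,w_{n-1}\,e_\chi.$$ Then the subspace $\widetilde{L}=(L\oplus S)/S$ of $I/S$ is $\mathrm{Sp}$-stable and $\widetilde{L}\cong Y^+$ as $F\mathrm{Sp}$-modules.
   Context: Groups. Let $F_q$ be a field with $q$ elements, of characteristic $p$, $V$ a $2n$-dimensional $F_q$-space with a non-degenerate alternating form $\langle\ ,\ \rangle$; $\mathrm{Sp}=\mathrm{Sp}_{2n}(q)$ is the group of all $g\in\mathrm{GL}(V)$ preserving the form. Fix a symplectic basis $u_1,\dots,u_n,v_1,\dots,v_n$: $\langle u_i,v_j\rangle=\delta_{ij}$, $\langle u_i,u_j\rangle=\langle v_i,v_j\rangle=0$. Put $M=\mathrm{span}\{u_i\}$, $N=\mathrm{span}\{v_i\}$. $\mathrm{Sp}^M$ is the pointwise stabilizer of $M$, $\mathrm{Sp}_{M,N}$ the subgroup preserving both $M$ and $N$, $\mathrm{Sp}_M=\mathrm{Sp}^M\rtimes\mathrm{Sp}_{M,N}$ the global stabilizer of $M$. $T$ is the group of $g\in\mathrm{Sp}_{M,N}$ whose matrix on $M$ relative to $u_1,\dots,u_n$ is upper triangular with 1's on the diagonal;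 $U=T\,\mathrm{Sp}^M$; $H$ is the group of $g\in\mathrm{Sp}_{M,N}$ having all $u_i,v_j$ as eigenvectors; $B=UH$. $x_{n-1,n}(\alpha)\in T$ is the element with $u_n\mapsto u_n+\alpha u_{n-1}$, $v_{n-1}\mapsto v_{n-1}-\alpha v_n$, fixing the other basis vectors. Steinberg module. $w_i$ ($1\le i<n$) is the element of $\mathrm{Sp}$ permuting the basis as $(u_i,u_{i+1})(v_i,v_{i+1})$; $c_j$ ($1\le j\le n$) satisfies $c_ju_j=v_j$, $c_jv_j=-u_j$ and fixes all other basis vectors. $W_2=\langle w_1,\dots,w_{n-1},c_1,\dots,c_n\rangle$ normalizes $H$; $W=W_2H/H$ is the Weyl group with length function $\ell$ relative to $w_1H,\dots,w_{n-1}H,c_nH$. For $w\in W$ choose $n_w\in W_2$ with $n_wH=w$. Put $e=\big(\sum_{w\in W}(-1)^{\ell(w)}n_w\big)\sum_{b\in B}b$ and $I=F\,\mathrm{Sp}\cdot e$, where $F$ is a field of characteristic 2 containing a primitive $p$-th root of unity. The elements $ue$, $u\in U$, form an $F$-basis of $I$. Let $e_1=\sum_{u\in U}ue$; $S=Fe_1$ is the socle of the $F\mathrm{Sp}$-module $I$ and affords the trivial representation. Let $\lambda:F_q^+\to F^*$ be a non-trivial linear character. For $v\in V$, $\chi_v(g)=\lambda(\langle gv,v\rangle)$; for $\alpha\in F_q$, $\chi_{\alpha v_n}$ is a linear character of $U$. For a linear character $\sigma:U\to F^*$, $e_\sigma=\sum_{u\in U}\sigma(u)^{-1}ue\in I$.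 $\mathcal{T}_q$ is a transversal for the action of $\{\pm1\}$ on $F_q^*$. For $1\le i\le n$ let $w(i)\in\mathrm{Sp}$ permute the basis by the cycles $(u_n,u_i,u_{i+1},\dots,u_{n-1})(v_n,v_i,v_{i+1},\dots,v_{n-1})$; for $\alpha\in F_q^*$ let $I_{\alpha,i}$ be the $FU$-submodule of $I$ generated by $w(i)e_{\chi_{\alpha v_n}}$; $I_i=\bigoplus_{\alpha\in\mathcal{T}_q}I_{\alpha,i}$, and $L=L_\lambda$ is the (direct) sum of $I_1,\dots,I_n$ in $I$. Weil module. Let $Y=Y_\lambda$ be an $F$-space with basis $(\epsilon_v)_{v\in N}$. The Weil representation $P:\mathrm{Sp}\to\mathrm{GL}(Y)$ of type $\lambda$ (in characteristic 2) is the representation determined by $P(sa)\epsilon_v=\lambda(\langle sav,av\rangle)\epsilon_{av}$ ($s\in\mathrm{Sp}^M$, $a\in\mathrm{Sp}_{M,N}$) and $P(\rho)\epsilon_v=\sum_{\alpha\in F_q}\lambda(\alpha^2)\epsilon_{v+\alpha v_n}$, where $\rho\in\mathrm{Sp}$ is given by $\rho(x)=x-\langle v_n,x\rangle v_n$ for $x\in V$. $Y^+$ is the $\mathrm{Sp}$-submodule spanned by all $\epsilon_v+\epsilon_{-v}$, $0\neq v\in N$ (dimension $(q^n-1)/2$). *)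

(* Defs.v *)
From HB Require Import structures.
From mathcomp Require Import all_boot all_order all_algebra all_fingroup.
From mathcomp Require Import all_solvable all_field all_character.
From mathcomp Require Import generic_quotient ring_quotient ring.

Set Implicit Arguments.
Unset Strict Implicit.
Unset Printing Implicit Defensive.

Import GRing.Theory.
Local Open Scope ring_scope.
Local Open Scope quotient_scope.

(* [vquot W] is the type of cosets of W. It is finite dimensional because it
   is linearly isomorphic to the complement W^C. *)
Section VQuot.
Variables (F : fieldType) (vT : vectType F) (W : {vspace vT}).

Definition vquot : Type := Quotient.quot W.
HB.instance Definition _ := GRing.Zmodule.on vquot.

Definition vpi (x : vT) : vquot := \pi_(Quotient.quot W) x.
Definition vrepr (y : vquot) : vT := repr (y : Quotient.quot W).

Lemma vpi_eq x y : (vpi x == vpi y) = (x - y \in W).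
Proof. by rewrite /vpi -Quotient.idealrBE. Qed.

Lemma vreprK : cancel vrepr vpi. Proof. exact: reprK. Qed.

Lemma vpiD x y : vpi (x + y) = vpi x + vpi y.
Proof. exact: (raddfD (\pi_(Quotient.quot W))). Qed.

Definition vquot_scale (a : F) (y : vquot) : vquot := vpi (a *: vrepr y).

Lemma vpiZ a x : vpi (a *: x) = vquot_scale a (vpi x).
Proof.
by apply/eqP; rewrite vpi_eq -scalerBr rpredZ // -vpi_eq vreprK.
Qed.

Lemma vquot_scaleA a b y :
  vquot_scale a (vquot_scale b y) = vquot_scale (a * b) y.
Proof. by rewrite -(vreprK y) -!vpiZ scalerA. Qed.
Lemma vquot_scale1 : left_id 1 vquot_scale.
Proof. by move=> y; rewrite -(vreprK y) -!vpiZ scale1r. Qed.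
Lemma vquot_scaleDr : right_distributive vquot_scale +%R.
Proof.
by move=> a y z; rewrite -(vreprK y) -(vreprK z) -!(vpiZ, vpiD) scalerDr.
Qed.
Lemma vquot_scaleDl y : {morph vquot_scale^~ y : a b / a + b}.
Proof. by move=> a b; rewrite -(vreprK y) -!(vpiZ, vpiD) scalerDl. Qed.

HB.instance Definition _ := GRing.Zmodule_isLmodule.Build F vquot
  vquot_scaleA vquot_scale1 vquot_scaleDr vquot_scaleDl.

Lemma vpi_is_linear : linear vpi.
Proof. by move=> a x y; rewrite vpiD vpiZ. Qed.
HB.instance Definition _ := GRing.isSemilinear.Build F vT vquot _ vpi
  (GRing.semilinear_linear vpi_is_linear).

Lemma vquot_vect_iso : Vector.axiom (\dim W^C) vquot.
Proof.
have cap0 : (W^C :&: W = 0)%VS by rewrite capvC capv_compl.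
have full x : x \in (W^C + W)%VS by rewrite addvC addv_complf memvf.
have hE x : x - daddv_pi W^C W x \in W.
  by rewrite -{1}(daddv_pi_add cap0 (full x)) addrAC subrr add0r memv_pi.
have hW x : x \in W -> daddv_pi W^C W x = 0.
  move=> Wx; apply/eqP; rewrite -memv0 -cap0 memv_cap memv_pi /=.
  by rewrite -[_ _ x]opprK rpredN -(rpredDl _ Wx) hE.
have hrepr x : daddv_pi W^C W (vrepr (vpi x)) = daddv_pi W^C W x.
  apply/eqP; rewrite -subr_eq0; apply/eqP.
  by rewrite -[LHS]linearB; apply: hW; rewrite -vpi_eq vreprK.
have [c c_lin c_bij] := subvs_vect_iso W^C.
exists (fun y => c (vsproj W^C (daddv_pi W^C W (vrepr y)))).
  move=> a y z; rewrite -(vreprK y) -(vreprK z) -vpi_is_linear !hrepr.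
  by rewrite -c_lin -!linearP.
have [c' cK c'K] := c_bij.
exists (fun r => vpi (vsval (c' r))) => [y | r] /=.
  rewrite cK vsprojK ?memv_pi // -{2}(vreprK y).
  by apply/eqP; rewrite vpi_eq -opprB rpredN hE.
by rewrite hrepr daddv_pi_id ?subvsP // vsvalK c'K.
Qed.
HB.instance Definition _ := Lmodule_hasFinDim.Build F vquot vquot_vect_iso.

End VQuot.

Section VQuotAct.
Variables (F : fieldType) (vT : vectType F).

(* The map induced on vT/W by an endomorphism phi preserving W (the value at a
   coset is computed on a representative, see [vquot_mapE]). *)
Definition vquot_map (W : {vspace vT}) (phi : vT -> vT) (y : vquot W) : vquot W :=
  vpi W (phi (vrepr y)).

Lemma vquot_mapE (W : {vspace vT}) (phi : {linear vT -> vT}) x :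
  {in W, forall w, phi w \in W} -> vquot_map phi (vpi W x) = vpi W (phi x).
Proof.
move=> phiW; apply/eqP; rewrite vpi_eq -linearB phiW //.
by rewrite -vpi_eq vreprK.
Qed.

(* The image of a subspace U in vT/W, i.e., (U + W)/W. *)
Definition vquot_img (W U : {vspace vT}) : {vspace vquot W} :=
  (linfun (vpi W) @: U)%VS.
End VQuotAct.

Section Modules.
Variables (F : fieldType) (gT : finGroupType) (G : {set gT}).

Definition gstable (V : vectType F) (act : gT -> V -> V) (U : {vspace V}) :=
  forall g, g \in G -> {in U, forall x, act g x \in U}.

(* U and U' are isomorphic as G-modules. A linear map on the subspace U is
   presented as the restriction to U of a linear map on V. *)
Definition gisom (V : vectType F) (act : gT -> V -> V) (U : {vspace V})
    (V' : vectType F) (act' : gT -> V' -> V') (U' : {vspace V'}) :=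
  exists f : 'Hom(V, V'),
    [/\ (f @: U)%VS = U', (lker f :&: U)%VS = 0%VS
      & forall g, g \in G -> {in U, forall x, f (act g x) = act' g (f x)}].
End Modules.

Section WordLength.
Variable gT : finGroupType.

(* A ^+ k is the set of products of k elements of A; the range of k searched
   is sufficient by [word_lengthP]. *)
Definition word_length (A : {set gT}) (x : gT) : nat :=
  find (fun k => x \in (A ^+ k)%g) (iota 0 (sval (gen_expgs A)).+1).

Lemma word_lengthP (A : {set gT}) x : x \in <<A>>%g ->
  x \in (A ^+ word_length A x)%g
  /\ (forall k, x \in (A ^+ k)%g -> (word_length A x <= k)%N).
Proof.
rewrite /word_length; case: gen_expgs => n /= -> xAn.
have subX k y : y \in ((1%g |: A) ^+ k)%g ->
    exists2 j, (j <= k)%N & y \in (A ^+ j)%g.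
  elim: k y => [|k IHk] y; first by exists 0%N.
  rewrite expgS => /mulsgP[a b /setU1P[-> | Aa] /IHk[j le_jk Ab] ->].
    by exists j; rewrite ?mul1g // (leq_trans le_jk).
  by exists j.+1 => //; rewrite expgS mem_mulg.
set s := iota 0 n.+1; set P := fun k => _.
have hasP : has P s.
  have [j le_jn xAj] := subX _ _ xAn.
  by apply/hasP; exists j; rewrite // mem_iota.
have lt_n : (find P s < n.+1)%N by rewrite -[n.+1](size_iota 0) -has_find.
split=> [|k xAk]; first by have:= nth_find 0%N hasP; rewrite nth_iota.
rewrite leqNgt; apply/negP=> lt_k.
by have:= @before_find _ 0%N P s k lt_k; rewrite nth_iota ?(ltn_trans lt_k) // /P xAk.
Qed.
End WordLength.

Section Symplectic.
Variables (K : finFieldType) (m : nat).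
(* The rank n is positive, n = m.+1. Indices of basis vectors range over 'I_n,
   so they are shifted by one: the last index n is [ord_max]. *)
Let n := m.+1.
Let V := 'cV[K]_(n + n).
Let gT := {'GL_(n + n)[K]}.

Definition Jmx : 'M[K]_(n + n) := block_mx 0 1%:M (- 1%:M) 0.
Definition form (x y : V) : K := (x^T *m Jmx *m y) 0 0.

Definition u_ (i : 'I_n) : V := col_mx (delta_mx i 0) 0.
Definition v_ (i : 'I_n) : V := col_mx 0 (delta_mx i 0).

Definition gact (g : gT) (x : V) : V := GLval g *m x.

Definition Sp : {set gT} :=
  [set g | [forall x, forall y, form (gact g x) (gact g y) == form x y]].

Lemma SpP g : reflect (forall x y, form (gact g x) (gact g y) = form x y)
                      (g \in Sp).
Proof.
rewrite inE; apply: (iffP forallP) => [h x y | h x].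
  by apply/eqP; have /forallP := h x; apply.
by apply/forallP=> y; rewrite h.
Qed.

Lemma gact1 x : gact 1%g x = x. Proof. exact: mul1mx. Qed.
Lemma gactM g h x : gact (g * h)%g x = gact g (gact h x).
Proof. by rewrite /gact GL_MxE mulmxA. Qed.

Lemma Sp_group_set : group_set Sp.
Proof.
apply/group_setP; split=> [|g h /SpP Sg /SpP Sh].
  by apply/SpP=> x y; rewrite !gact1.
by apply/SpP=> x y; rewrite !gactM Sg Sh.
Qed.
Canonical Sp_group := Group Sp_group_set.

(* The element of GL(V) with u_i |-> a i and v_j |-> b j, for a basis (a, b)
   of V (and 1 otherwise). *)
Definition gl_of (a b : 'I_n -> V) : gT :=
  let A : 'M[K]_(n + n) :=
    row_mx (\matrix_(i, j) a j i 0) (\matrix_(i, j) b j i 0) in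
  insubd (1%g : gT) A.

Lemma form_col (a b c d : 'cV[K]_n) :
  form (col_mx a b) (col_mx c d) = (a^T *m d) 0 0 - (b^T *m c) 0 0.
Proof.
rewrite /form /Jmx tr_col_mx mul_row_block mul_row_col !mulmx0 add0r addr0.
by rewrite mulmx1 mulmxN mulmx1 mulNmx addrC !mxE.
Qed.

Lemma form_sym x y : form x y = - form y x.
Proof.
rewrite -[x]vsubmxK -[y]vsubmxK !form_col opprB.
by congr (_ - _); rewrite !mxE; apply: eq_bigr => i _; rewrite !mxE mulrC.
Qed.

Let deltaE (i j : 'I_n) :
  ((delta_mx i 0 : 'cV[K]_n)^T *m (delta_mx j 0 : 'cV[K]_n)) 0 0 = (i == j)%:R.
Proof. by rewrite trmx_delta mul_delta_mx_cond; case: eqP; rewrite !mxE. Qed.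

Lemma form_uv i j : form (u_ i) (v_ j) = (i == j)%:R.
Proof. by rewrite form_col deltaE trmx0 mul0mx !mxE subr0. Qed.
Lemma form_uu i j : form (u_ i) (u_ j) = 0.
Proof. by rewrite form_col mulmx0 trmx0 mul0mx !mxE subr0. Qed.
Lemma form_vv i j : form (v_ i) (v_ j) = 0.
Proof. by rewrite form_col mulmx0 trmx0 mul0mx !mxE subr0. Qed.

Lemma formDr x y z : form x (y + z) = form x y + form x z.
Proof. by rewrite /form mulmxDr mxE. Qed.
Lemma formZr c x y : form x (c *: y) = c * form x y.
Proof. by rewrite /form -scalemxAr mxE. Qed.
Lemma formNr x y : form x (- y) = - form x y.
Proof. by rewrite -scaleN1r formZr mulN1r. Qed.
Lemma formDl x y z : form (x + y) z = form x z + form y z.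
Proof. by rewrite ![form _ z]form_sym formDr opprD. Qed.
Lemma formZl c x y : form (c *: x) y = c * form x y.
Proof. by rewrite ![form _ y]form_sym formZr mulrN. Qed.
Lemma formNl x y : form (- x) y = - form x y.
Proof. by rewrite -scaleN1r formZl mulN1r. Qed.

Lemma gl_ofP (a b : 'I_n -> V) :
    (forall i j, form (a i) (b j) = (i == j)%:R) ->
    (forall i j, form (a i) (a j) = 0) -> (forall i j, form (b i) (b j) = 0) ->
  [/\ gl_of a b \in Sp, forall i, gact (gl_of a b) (u_ i) = a i
    & forall i, gact (gl_of a b) (v_ i) = b i].
Proof.
move=> ab aa bb; pose A : 'M[K]_(n + n) :=
  row_mx (\matrix_(i, j) a j i 0) (\matrix_(i, j) b j i 0).
have Au i : A *m u_ i = a i.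
  rewrite mul_row_col mulmx0 addr0 -colE.
  by apply/matrixP=> k l; rewrite !mxE ord1.
have Av i : A *m v_ i = b i.
  rewrite mul_row_col mulmx0 add0r -colE.
  by apply/matrixP=> k l; rewrite !mxE ord1.
have Jform (C : 'M[K]_(n + n)) i j :
  C i j = ((delta_mx i 0 : V)^T *m C *m (delta_mx j 0 : V)) 0 0.
  by rewrite -colE trmx_delta -rowE !mxE.
have dl i : delta_mx (lshift n i) 0 = u_ i :> V by rewrite delta_mx_ushift.
have dr i : delta_mx (rshift n i) 0 = v_ i :> V by rewrite delta_mx_dshift.
have AJA : A^T *m Jmx *m A = Jmx.
  apply/matrixP=> i j; rewrite Jform [RHS]Jform.
  rewrite !mulmxA -trmx_mul -(mulmxA _ A) -!/(form _ _).
  by case: (split_ordP i) => i' ->; case: (split_ordP j) => j' ->;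
    rewrite !(dl, dr) !(Au, Av) ?(ab, aa, bb, form_uv, form_uu, form_vv) //
      form_sym ab -form_uv -form_sym.
have JJ : Jmx *m (- Jmx) = 1%:M.
  rewrite opp_block_mx !opprK !oppr0 mulmx_block.
  rewrite !(mul0mx, mulmx0, mul1mx, mulmx1, mulNmx, mulmxN).
  by rewrite !(add0r, addr0) ?opprK -scalar_mx_block.
have A_unit : A \in unitmx.
  have [] := @mulmx1_unit _ _ (- Jmx *m A^T *m Jmx) A.
    by rewrite -!mulmxA mulNmx mulmxA AJA -mulmxN JJ.
  by [].
have E : GLval (gl_of a b) = A by apply: (@insubdK _ _ _ (1%g : gT)).
split=> [|i|i]; rewrite /gact ?E //.
by apply/SpP=> x y; rewrite /form /gact E trmx_mul -[in RHS]AJA !mulmxA.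
Qed.

Lemma basis_ext (f g : V -> V) : linear f -> linear g ->
  (forall i, f (u_ i) = g (u_ i)) -> (forall i, f (v_ i) = g (v_ i)) -> f =1 g.
Proof.
move=> flin glin fgu fgv x.
pose fL := GRing.isLinear.Build K V V _ f flin.
pose gL := GRing.isLinear.Build K V V _ g glin.
pose f' : {linear V -> V} := HB.pack f fL.
pose g' : {linear V -> V} := HB.pack g gL.
rewrite -[f]/(f' : V -> V) -[g]/(g' : V -> V) (matrix_sum_delta x).
rewrite exchange_big big_ord1 !linear_sum; apply: eq_bigr => i _; rewrite !linearZ.
congr (_ *: _); case: (split_ordP i) => k ->; last first.
  by rewrite delta_mx_dshift; apply: fgv.
by rewrite delta_mx_ushift; apply: fgu.
Qed.

Definition M : {vspace V} := <<[seq u_ i | i : 'I_n]>>%VS.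
Definition N : {vspace V} := <<[seq v_ i | i : 'I_n]>>%VS.

(* SpM is the pointwise stabilizer of M, usually written with a superscript. *)
Definition SpM : {set gT} :=
  [set g in Sp | [forall x, (x \in M) ==> (gact g x == x)]].
Definition SpMN : {set gT} :=
  [set g in Sp | [forall x, (x \in M) ==> (gact g x \in M)]
              && [forall x, (x \in N) ==> (gact g x \in N)]].

(* The (lshift i, lshift j) entry of g is the coefficient of u_i in g u_j. *)
Definition T : {set gT} :=
  [set g in SpMN | [forall i : 'I_n, forall j : 'I_n, (j <= i)%N ==>
     ((GLval g : 'M_(n + n)) (lshift n i) (lshift n j) == (i == j)%:R)]].
Definition U : {set gT} := (T * SpM)%g.
Definition H : {set gT} :=
  [set g in SpMN | [forall i, exists c : K, gact g (u_ i) == c *: u_ i]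
                && [forall i, exists c : K, gact g (v_ i) == c *: v_ i]].
Definition B : {set gT} := (U * H)%g.

Definition perm_gl (s : 'S_n) : gT := gl_of (u_ \o s) (v_ \o s).
(* w_ i is used for i < m only *)
Definition w_ (i : nat) : gT := perm_gl (tperm (inord i) (inord i.+1)).
Definition c_ (j : 'I_n) : gT :=
  gl_of (fun i => if i == j then v_ j else u_ i)
        (fun i => if i == j then - u_ j else v_ i).
(* w' i is w(i): the permutation is the cycle (n, i, i+1, ..., n-1). *)
Definition w' (i : 'I_n) : gT := perm_gl (lift_perm ord_max i 1%g).
(* The index n - 1; it is used for n > 1 only. *)
Definition ord_pen : 'I_n := inord m.-1.
(* x_ a is x_{n-1,n}(a) *)
Definition x_ (a : K) : gT :=
  gl_of (fun i => if i == ord_max then u_ i + a *: u_ ord_pen else u_ i)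
        (fun i => if i == ord_pen then v_ i - a *: v_ ord_max else v_ i).
Definition rho : gT :=
  let t x := x - form (v_ ord_max) x *: v_ ord_max in gl_of (t \o u_) (t \o v_).

Lemma perm_glP (s : 'S_n) :
  [/\ perm_gl s \in Sp, forall i, gact (perm_gl s) (u_ i) = u_ (s i)
    & forall i, gact (perm_gl s) (v_ i) = v_ (s i)].
Proof.
by apply: gl_ofP => i j /=; rewrite ?form_uu ?form_vv // form_uv (inj_eq perm_inj).
Qed.

Lemma c_P (j : 'I_n) :
  [/\ c_ j \in Sp, gact (c_ j) (u_ j) = v_ j, gact (c_ j) (v_ j) = - u_ j
    & forall i, i != j ->
      gact (c_ j) (u_ i) = u_ i /\ gact (c_ j) (v_ i) = v_ i].
Proof.
have [|||Sc cu cv] := @gl_ofP (fun i => if i == j then v_ j else u_ i)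
        (fun i => if i == j then - u_ j else v_ i).
- move=> i k; case: (eqVneq i j) => [ei | nij];
    case: (eqVneq k j) => [ek | nkj]; rewrite ?ei ?ek.
  + by rewrite formNr form_sym opprK form_uv eqxx.
  + by rewrite form_vv eq_sym (negPf nkj).
  + by rewrite formNr form_uu oppr0 (negPf nij).
  by rewrite form_uv.
- move=> i k; case: (eqVneq i j) => [ei | nij];
    case: (eqVneq k j) => [ek | nkj]; rewrite ?ei ?ek.
  + by rewrite form_vv.
  + by rewrite form_sym form_uv (negPf nkj) oppr0.
  + by rewrite form_uv (negPf nij).
  by rewrite form_uu.
- move=> i k; case: (eqVneq i j) => [ei | nij];
    case: (eqVneq k j) => [ek | nkj]; rewrite ?ei ?ek.
  + by rewrite formNr form_sym formNr form_uu !oppr0.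
  + by rewrite form_sym formNr form_sym form_uv eq_sym (negPf nkj) !oppr0.
  + by rewrite formNr form_sym form_uv eq_sym (negPf nij) !oppr0.
  by rewrite form_vv.
split=> // [||i /negPf nij]; rewrite -/(c_ j) in cu cv *.
- by rewrite cu eqxx.
- by rewrite cv eqxx.
by rewrite cu cv nij.
Qed.

Lemma x_P (a : K) : (0 < m)%N ->
  [/\ x_ a \in Sp,
      gact (x_ a) (u_ ord_max) = u_ ord_max + a *: u_ ord_pen,
      gact (x_ a) (v_ ord_pen) = v_ ord_pen - a *: v_ ord_max,
      forall i, i != ord_max -> gact (x_ a) (u_ i) = u_ i
    & forall i, i != ord_pen -> gact (x_ a) (v_ i) = v_ i].
Proof.
move=> m_gt0; have pm : ord_pen == ord_max = false.
  by rewrite -val_eqE /= inordK ?ltnS ?leq_pred // ltn_eqF // ltn_predL.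
have [|||Sx xu xv] := @gl_ofP
   (fun i => if i == ord_max then u_ i + a *: u_ ord_pen else u_ i)
   (fun i => if i == ord_pen then v_ i - a *: v_ ord_max else v_ i).
- move=> i k; case: (eqVneq i ord_max) => [-> | nim].
    case: (eqVneq k ord_pen) => [-> | nkp].
      rewrite !(formDl, formDr, formNr, formZl, formZr, form_uv) !eqxx pm.
      by rewrite [_ == ord_pen]eq_sym pm !(mulr0, mulr1, oppr0, addr0, add0r) addNr.
    rewrite formDl formZl !form_uv [ord_pen == k]eq_sym (negPf nkp).
    by rewrite mulr0 addr0.
  case: (eqVneq k ord_pen) => [-> | nkp]; rewrite ?formDr ?formNr ?formZr !form_uv //.
  by rewrite (negPf nim) mulr0 subr0.
- by move=> i k; case: ifP => _; case: ifP => _;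
    rewrite ?(formDl, formDr, formNl, formNr, formZl, formZr, form_uu, mulr0, addr0).
- by move=> i k; case: ifP => _; case: ifP => _;
    rewrite ?(formDl, formDr, formNl, formNr, formZl, formZr, form_vv, mulr0, addr0, oppr0).
split=> // [||i /negPf ni|i /negPf ni]; rewrite -/(x_ a) in xu xv *.
- by rewrite xu eqxx.
- by rewrite xv eqxx.
- by rewrite xu ni.
by rewrite xv ni.
Qed.

Lemma rhoP : rho \in Sp /\
  forall x, gact rho x = x - form (v_ ord_max) x *: v_ ord_max.
Proof.
pose t x := x - form (v_ ord_max) x *: v_ ord_max.
have t_form x y : form (t x) (t y) = form x y.
  rewrite /t !(formDl, formDr, formNl, formNr, formZl, formZr) form_vv.
  by rewrite [form x (v_ _)]form_sym; ring.
have [|||Sr ru rv] := @gl_ofP (t \o u_) (t \o v_).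
- by move=> i j; rewrite t_form form_uv.
- by move=> i j; rewrite t_form form_uu.
- by move=> i j; rewrite t_form form_vv.
split=> // x; change (gl_of _ _) with rho in Sr, ru, rv.
have glin a y z : gact rho (a *: y + z) = a *: gact rho y + gact rho z.
  by rewrite /gact mulmxDr -scalemxAr.
have tlin a y z : t (a *: y + z) = a *: t y + t z.
  rewrite /t formDr formZr scalerDl -scalerA scalerBr opprD.
  by rewrite addrACA.
by apply: (@basis_ext (gact rho) t).
Qed.

Definition W2 : {group gT} :=
  <<[set w_ i | i : 'I_m] :|: [set c_ j | j : 'I_n]>>%G.
(* W2 normalizes H, so W2 / H is the group W2 H/H. *)
Definition W : {set coset_of H} := (W2 / H)%g.
Definition W_gens : {set coset_of H} :=
  [set coset H (w_ i) | i : 'I_m] :|: [set coset H (c_ ord_max)].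
Definition ell (w : coset_of H) : nat := word_length W_gens w.

Definition weyl_lift (nw : coset_of H -> gT) :=
  forall w, w \in W -> nw w \in W2 /\ (nw w *: H)%g = w :> {set gT}.

Definition pm_transversal (Tq : {set K}) :=
  is_transversal Tq [set [set a; - a] | a in [set~ 0]] [set~ 0].
End Symplectic.

Arguments u_ {K m} i.
Arguments v_ {K m} i.
Arguments M K m : clear implicits.
Arguments N K m : clear implicits.
Arguments Sp K m : clear implicits.
Arguments Sp_group K m : clear implicits.
Arguments SpM K m : clear implicits.
Arguments SpMN K m : clear implicits.
Arguments T K m : clear implicits.
Arguments U K m : clear implicits.
Arguments H K m : clear implicits.
Arguments B K m : clear implicits.
Arguments W2 K m : clear implicits.
Arguments W K m : clear implicits.
Arguments W_gens K m : clear implicits.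
Arguments w_ {K m} i.
Arguments c_ {K m} j.
Arguments w' {K m} i.
Arguments x_ {K m} a.
Arguments rho {K m}.
Arguments ord_pen {m}.

Section Steinberg.
Variables (K : finFieldType) (m : nat) (F : fieldType).
Let n := m.+1.
Let V := 'cV[K]_(n + n).
Let gT := {'GL_(n + n)[K]}.

(* Elements of the group algebra F Sp are given by their matrices in the
   regular representation; they act on the left by [*m]. *)
Notation FSp := 'M[F]_#|Sp K m|.
Definition rg (g : gT) : FSp := regular_repr F (Sp_group K m) g.

Definition left_span (A : {set gT}) (x : FSp) : {vspace FSp} :=
  <<[seq rg g *m x | g <- enum A]>>%VS.

Section Lambda.
Variables (nw : coset_of (H K m) -> gT) (lam : K -> F).

Definition st_e : FSp :=
  (\sum_(w in W K m) (-1) ^+ ell w *: rg (nw w)) *m (\sum_(b in B K m) rg b).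

Definition Imod : {vspace FSp} := left_span (Sp K m) st_e.

Definition e1 : FSp := \sum_(g in U K m) rg g *m st_e.
Definition Smod : {vspace FSp} := <[e1]>%VS.

Definition chi (v : V) (g : gT) : F := lam (form (gact g v) v).

Definition e_of (sigma : gT -> F) : FSp :=
  \sum_(g in U K m) (sigma g)^-1 *: (rg g *m st_e).

Definition I_ai (a : K) (i : 'I_n) : {vspace FSp} :=
  left_span (U K m) (rg (w' i) *m e_of (chi (a *: v_ ord_max))).
Definition I_i (Tq : {set K}) (i : 'I_n) : {vspace FSp} :=
  (\sum_(a in Tq) I_ai a i)%VS.
Definition Lmod (Tq : {set K}) : {vspace FSp} := (\sum_i I_i Tq i)%VS.

(* The action of Sp on the quotient by S; it does not depend on the choice of
   coset representatives because Sp acts trivially on S. *)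
Definition quot_act (g : gT) : vquot Smod -> vquot Smod :=
  vquot_map (mulmx (rg g)).
End Lambda.
End Steinberg.

Section Weil.
Variables (K : finFieldType) (m : nat) (F : fieldType).
Let n := m.+1.
Let V := 'cV[K]_(n + n).
Let gT := {'GL_(n + n)[K]}.

Definition Nelt := {x : V | x \in N K m}.
Definition Ymod := {ffun Nelt -> F^o}.

(* For v in N, eps v is the basis vector indexed by v (and 0 for other v). *)
Definition eps (v : V) : Ymod := [ffun w : Nelt => (val w == v)%:R].

Definition Yplus : {vspace Ymod} :=
  <<[seq (eps v + eps (- v))%R
     | v <- enum [pred v in N K m | v != 0%R]]>>%VS.

Definition weil_rep (lam : K -> F) (P : gT -> 'End(Ymod)) :=
  [/\ P 1%g = \1%VF,
      {in Sp K m &, forall g h, P (g * h)%g = (P g \o P h)%VF},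
      {in SpM K m & SpMN K m, forall s a, {in N K m, forall v,
         P (s * a)%g (eps v)
         = lam (form (gact (s * a)%g v) (gact a v)) *: eps (gact a v)}}
    & {in N K m, forall v,
         P rho (eps v) = \sum_(a : K) lam (a ^+ 2) *: eps (v + a *: v_ ord_max)}].
End Weil.

Definition additive_char (K : finFieldType) (F : fieldType) (lam : K -> F) :=
  lam 0 = 1 /\ {morph lam : a b / a + b >-> a * b}.

(* Main.v *)
From HB Require Import structures.
From mathcomp Require Import all_boot all_order all_algebra all_fingroup.
From mathcomp Require Import all_solvable all_field all_character.
From mathcomp Require Import ring zify.
Require Import Defs.

(** Both modules are described by vectors indexed by N on which generators of
    Sp act by the same formulas.

    In characteristic 2 the signs in e disappear, so that e is fixed by the
    monomial group W_2 as well as by the torus H.  A computation in SL_2 then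
    shows that the sum of the t e, for t in T, is fixed by the whole Levi
    subgroup Sp_{M,N} ([SpMN_T_sum]; this uses that q is odd).  Averaging it
    over Sp^M against the inverse of the character chi_v gives for each v in N
    a vector [weight_vec v] of I with
      - s (weight_vec v) = chi_v(s) weight_vec v for s in Sp^M,
      - a (weight_vec v) = weight_vec (a v) for a in Sp_{M,N},
      - weight_vec v = e_{chi_v} if v is a nonzero multiple of v_n, and
        weight_vec 0 = e_1.
    The two assumed identities give the image under c_n of weight_vec v_n and,
    after conjugation by a permutation, of weight_vec v_{n-1}.  Conjugating by
    elements of Sp_{M,N} and of Sp^M extends these to the single formula
      c_n (weight_vec v) = sum over b in F_q of
                           lambda(-2xb) weight_vec (v + (b - x) v_n),
    where x is the coordinate of v at v_n ([act_c_weight_vec]).  In the Weil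
    module c_n = s rho s with s in Sp^M, and the same formula holds for the
    eps_v ([weil_c]).  As Sp is generated by Sp^M, Sp_{M,N} and c_n ([Sp_ind]),
    the linear map taking eps_v to weight_vec v is a homomorphism from Y to I
    ([weil_to_st_P]).  Its image modulo S = F e_1 is the image of L, because
    the vectors spanning L are, up to scalars, the weight_vec v with v nonzero
    ([Lmod_img]).

    It remains to compare this homomorphism Y -> I/S with the symmetrization
    eps_v -> eps_v + eps_{-v}, whose image is Y^+.  Two homomorphisms with the
    same kernel have isomorphic images, so it suffices to see that their
    kernels agree ([weil_to_quot_Sym_ker]).  Since weight_vec v =
    weight_vec (-v) and F has characteristic 2, one inclusion is a pairing of
    terms.  For the other one, the characters chi_v of Sp^M separate the points
    of N up to sign, so that projections onto weight spaces read off the sum of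
    the coefficients at v and -v, provided that weight_vec v is nonzero.  By
    transitivity of Sp_{M,N} and the first identity, weight_vec v = 0 with v
    nonzero would force e_1 = 0; but the coefficient of e_1 at the identity is
    |U|, which is odd ([e1_neq0]). *)

Set Implicit Arguments.
Unset Strict Implicit.
Unset Printing Implicit Defensive.
Import GRing.Theory.
Local Open Scope ring_scope.

(** * Invertible matrices *)
Section Matrices.
Variables (K : fieldType) (n : nat).
Implicit Types (A C S : 'M[K]_n) (x : 'cV[K]_n) (y : 'rV[K]_n).

Lemma unitmx_inj A : (forall x, A *m x = 0 -> x = 0) -> A \in unitmx.
Proof.
move=> injA; rewrite -unitmx_tr -row_free_unit -kermx_eq0.
apply/eqP/row_matrixP=> i; rewrite row0; apply: trmx_inj; rewrite trmx0.
apply: injA; rewrite -{1}[A]trmxK -trmx_mul.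
by rewrite (sub_kermxP (row_sub _ _)) trmx0.
Qed.

Lemma invmx_mul A C : A \in unitmx -> C \in unitmx ->
  invmx (A *m C) = invmx C *m invmx A.
Proof.
move=> uA uC; have uAC : A *m C \in unitmx by rewrite unitmx_mul uA.
by rewrite -[RHS](mulKmx uAC) !mulmxA !mulmxK.
Qed.

Lemma unitmx_rank1 x y : 1 + (y *m x) 0 0 != 0 -> 1%:M + x *m y \in unitmx.
Proof.
move=> nz; apply: unitmx_inj => z; rewrite mulmxDl mul1mx -mulmxA.
rewrite [y *m z]mx11_scalar mul_mx_scalar; set c := (y *m z) 0 0 => hz.
have ez : z = - c *: x by apply/eqP; rewrite scaleNr -addr_eq0 hz.
suff c0 : c = 0 by rewrite ez c0 oppr0 scale0r.
have: c * (1 + (y *m x) 0 0) = 0.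
  by rewrite mulrDr mulr1 {1}/c {1}ez -scalemxAr mxE mulNr addNr.
by move/eqP; rewrite mulf_eq0 (negPf nz) orbF => /eqP.
Qed.

(** The columns of the block column (A, C) span a Lagrangian subspace; the
    lemma moves it by Sp^M until it is a complement of N.  Row and column
    operations turn C into an idempotent Q; then A^T Q is symmetric, which
    makes Q A Q = Q A, and S = Q - Q A works. *)
Lemma exists_sym_shift A C : (A^T *m C)^T = A^T *m C ->
    (forall x, A *m x = 0 -> C *m x = 0 -> x = 0) ->
  exists2 S, S^T = S & A + S *m C \in unitmx.
Proof.
move=> symAC injAC.
set L := col_ebase C; set R := row_ebase C; set Q : 'M[K]_n := pid_mx (\rank C).
have uL : L \in unitmx := col_ebase_unit C.
have uR : R \in unitmx := row_ebase_unit C.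
have EC : L *m Q *m R = C := mulmx_ebase C.
have QQ : Q *m Q = Q by rewrite pid_mx_id // rank_leq_row.
have Qt : Q^T = Q by rewrite tr_pid_mx.
pose A' := L^T *m A *m invmx R.
have EA : invmx L^T *m A' *m R = A.
  by rewrite /A' !mulmxA mulVmx ?unitmx_tr // mul1mx mulmxKV.
have symAQ : A'^T *m Q = Q *m A'.
  have E : A'^T *m Q = (invmx R)^T *m (A^T *m C) *m invmx R.
    by rewrite -EC /A' !trmx_mul trmxK !mulmxA mulmxK.
  have Es : (A'^T *m Q)^T = A'^T *m Q.
    by rewrite E trmx_mul [(_ *m (_ *m C))^T]trmx_mul symAC trmxK mulmxA.
  by rewrite -Es trmx_mul Qt trmxK.
have QAQ : Q *m A' *m Q = Q *m A' by rewrite -symAQ -mulmxA QQ.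
pose S' := Q - Q *m A'.
have symS' : S'^T = S' by rewrite /S' raddfB /= trmx_mul Qt symAQ.
have uD : A' + S' *m Q \in unitmx.
  apply: unitmx_inj => z; rewrite /S' mulmxBl QQ QAQ => hz.
  have Qz : Q *m z = 0.
    have <- : Q *m ((A' + (Q - Q *m A')) *m z) = Q *m z.
      by rewrite mulmxA mulmxDr mulmxBr [Q *m (Q *m _)]mulmxA QQ addrC subrK.
    by rewrite hz mulmx0.
  have A'z : A' *m z = 0.
    by move: hz; rewrite -symAQ mulmxDl mulmxBl -[_ *m Q *m z]mulmxA Qz mulmx0 subrr addr0.
  have Rz : R *m (invmx R *m z) = z by rewrite mulKVmx.
  have: invmx R *m z = 0.
    apply: injAC; first by rewrite -EA -[LHS]mulmxA Rz -[LHS]mulmxA A'z mulmx0.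
    by rewrite -EC -!mulmxA Rz Qz mulmx0.
  by move=> h; rewrite -Rz h mulmx0.
clearbody S' A' L R Q; exists (invmx L^T *m S' *m invmx L).
  by rewrite !trmx_mul symS' !trmx_inv trmxK mulmxA.
have -> : A + invmx L^T *m S' *m invmx L *m C
    = invmx L^T *m (A' + S' *m Q) *m R.
  by rewrite -EC mulmxDr mulmxDl EA !mulmxA mulmxKV.
by rewrite !unitmx_mul uD uR unitmx_inv unitmx_tr uL.
Qed.
End Matrices.

(** * Block form of symplectic matrices and generation of Sp *)
Section SymplecticBlocks.
Variables (K : finFieldType) (m : nat).
Notation n := m.+1.
Notation gT := {'GL_(n + n)[K]}.
Implicit Types (g h : gT) (A S D : 'M[K]_n) (x y : 'cV[K]_n)
  (z w : 'cV[K]_(n + n)).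

Definition gmx g : 'M[K]_(n + n) := GLval g.
Definition mkg (X : 'M[K]_(n + n)) : gT := insubd (1%g : gT) X.

Lemma gmx_inj : injective gmx. Proof. exact: val_inj. Qed.
Lemma gmx1 : gmx 1%g = 1%:M. Proof. by []. Qed.
Lemma gmxM g h : gmx (g * h)%g = gmx g *m gmx h.
Proof. by rewrite /gmx GL_MxE. Qed.
Lemma mkgK X : X \in unitmx -> gmx (mkg X) = X.
Proof. by move=> uX; apply: (@insubdK _ _ _ (1%g : gT)). Qed.

Lemma gactZ g c z : gact g (c *: z) = c *: gact g z.
Proof. by rewrite /gact -scalemxAr. Qed.
Lemma gactD g z w : gact g (z + w) = gact g z + gact g w.
Proof. by rewrite /gact mulmxDr. Qed.
Lemma gactN g z : gact g (- z) = - gact g z.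
Proof. by rewrite /gact mulmxN. Qed.
Lemma gact0 g : gact g 0 = 0. Proof. by rewrite /gact mulmx0. Qed.
Lemma gactE g z : gact g z = gmx g *m z. Proof. by []. Qed.
Lemma gact_sum g I (r : seq I) (P : pred I) f :
  gact g (\sum_(i <- r | P i) f i) = \sum_(i <- r | P i) gact g (f i).
Proof. by rewrite /gact mulmx_sumr. Qed.
Lemma gactKV g z : gact g (gact g^-1%g z) = z.
Proof. by rewrite -gactM mulgV gact1. Qed.
Lemma gactK g z : gact g^-1%g (gact g z) = z.
Proof. by rewrite -gactM mulVg gact1. Qed.

Lemma gl_ext g h : (forall i, gact g (u_ i) = gact h (u_ i)) ->
  (forall i, gact g (v_ i) = gact h (v_ i)) -> g = h.
Proof.
move=> eu ev; have e : gact g =1 gact h.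
  by apply: basis_ext => // a x y; rewrite gactD gactZ.
apply: gmx_inj; apply/matrixP=> i j.
have := e (delta_mx j 0); rewrite !gactE -!colE => /matrixP/(_ i 0).
by rewrite !mxE.
Qed.

Lemma Sp_mul g h : g \in Sp K m -> h \in Sp K m -> (g * h)%g \in Sp K m.
Proof. by move=> /SpP Sg /SpP Sh; apply/SpP=> x y; rewrite !gactM Sg Sh. Qed.
Lemma Sp_inv g : g \in Sp K m -> g^-1%g \in Sp K m.
Proof. by move=> /SpP Sg; apply/SpP=> x y; rewrite -Sg !gactKV. Qed.
Lemma Sp_one : 1%g \in Sp K m.
Proof. by apply/SpP=> x y; rewrite !gact1. Qed.

Lemma Sp_mxE g : (g \in Sp K m) = ((gmx g)^T *m Jmx K m *m gmx g == Jmx K m).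
Proof.
apply/idP/eqP => [/SpP Sg | E]; last first.
  by apply/SpP=> x y; rewrite /form !gactE trmx_mul -[in RHS]E !mulmxA.
apply/matrixP=> i j.
have Jform (C : 'M[K]_(n + n)) :
  C i j = ((delta_mx i 0 : 'cV[K]_(n + n))^T *m C *m (delta_mx j 0 : 'cV[K]_(n + n))) 0 0.
  by rewrite -colE trmx_delta -rowE !mxE.
rewrite [LHS]Jform [RHS]Jform -/(form _ _) -Sg /form !gactE trmx_mul.
by rewrite !mulmxA.
Qed.

Lemma Sp_blockE g A B C D : gmx g = block_mx A B C D ->
  (g \in Sp K m) = [&& A^T *m C == C^T *m A, B^T *m D == D^T *m B
                     & A^T *m D - C^T *m B == 1%:M].
Proof.
move=> E; rewrite Sp_mxE E tr_block_mx /Jmx !mulmx_block.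
rewrite !(mulmx0, mulmx1, mulmxN, addr0, add0r).
rewrite !mulNmx; apply/eqP/and3P => [/eq_block_mx[h1 h2 h3 h4] | [/eqP h1 /eqP h2 /eqP h3]].
  split.
  - by rewrite -subr_eq0 addrC h1.
  - by rewrite -subr_eq0 addrC h4.
  by rewrite addrC h2.
congr block_mx.
- by rewrite h1 addNr.
- by rewrite addrC h3.
- by rewrite -[in RHS]trmx1 -h3 raddfB /= !trmx_mul !trmxK opprB addrC.
- by rewrite h2 addNr.
Qed.

(** [levi A] runs over Sp_{M,N} and [unip S], for symmetric S, over Sp^M; see
    [SpMNP] and [SpMP]. *)
Definition levi_mx A : 'M[K]_(n + n) := block_mx A 0 0 (invmx A)^T.
Definition unip_mx S : 'M[K]_(n + n) := block_mx 1%:M S 0 1%:M.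
Definition levi A : gT := mkg (levi_mx A).
Definition unip S : gT := mkg (unip_mx S).

Lemma leviE A : A \in unitmx -> gmx (levi A) = levi_mx A.
Proof.
move=> uA; apply: mkgK; rewrite unitmxE det_ublock unitrM -!unitmxE.
by rewrite uA unitmx_tr unitmx_inv uA.
Qed.

Lemma unipE S : gmx (unip S) = unip_mx S.
Proof. by apply: mkgK; rewrite unitmxE det_ublock !det1 mulr1 unitr1. Qed.

Lemma leviM A D : A \in unitmx -> D \in unitmx -> levi (A *m D) = (levi A * levi D)%g.
Proof.
move=> uA uD; apply: gmx_inj; rewrite gmxM !leviE ?unitmx_mul ?uA //.
rewrite /levi_mx mulmx_block !(mulmx0, mul0mx, addr0, add0r) -trmx_mul.
by rewrite invmx_mul.
Qed.

Definition mv x : 'cV[K]_(n + n) := col_mx x 0.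
Definition nv x : 'cV[K]_(n + n) := col_mx 0 x.

Lemma mvE x : mv x = \sum_i x i 0 *: u_ i.
Proof.
rewrite /mv {1}(matrix_sum_delta x) exchange_big big_ord1.
apply/colP=> k; rewrite summxE -[k]splitK; case: (split k) => j /=.
  rewrite col_mxEu summxE; apply: eq_bigr => i _.
  by rewrite mxE [RHS]mxE /u_ col_mxEu.
by rewrite col_mxEd mxE big1 // => i _; rewrite mxE /u_ col_mxEd mxE mulr0.
Qed.

Lemma nvE x : nv x = \sum_i x i 0 *: v_ i.
Proof.
rewrite /nv {1}(matrix_sum_delta x) exchange_big big_ord1.
apply/colP=> k; rewrite summxE -[k]splitK; case: (split k) => j /=.
  by rewrite col_mxEu mxE big1 // => i _; rewrite mxE /v_ col_mxEu mxE mulr0.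
rewrite col_mxEd summxE; apply: eq_bigr => i _.
by rewrite mxE [RHS]mxE /v_ col_mxEd.
Qed.

Lemma memM z : (z \in M K m) = (dsubmx z == 0).
Proof.
apply/idP/eqP => [|z0].
  suff /subvP sub : (M K m <= lker (linfun (@dsubmx K n n 1)))%VS.
    by move=> /sub; rewrite memv_ker lfunE /= => /eqP.
  by apply/span_subvP => _ /mapP[i _ ->]; rewrite memv_ker lfunE /= col_mxKd.
rewrite -[z]vsubmxK z0 -/(mv _) mvE.
by apply: memv_suml => i _; rewrite memvZ // memv_span // map_f // mem_enum.
Qed.

Lemma memN z : (z \in N K m) = (usubmx z == 0).
Proof.
apply/idP/eqP => [|z0].
  suff /subvP sub : (N K m <= lker (linfun (@usubmx K n n 1)))%VS.
    by move=> /sub; rewrite memv_ker lfunE /= => /eqP.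
  by apply/span_subvP => _ /mapP[i _ ->]; rewrite memv_ker lfunE /= col_mxKu.
rewrite -[z]vsubmxK z0 -/(nv _) nvE.
by apply: memv_suml => i _; rewrite memvZ // memv_span // map_f // mem_enum.
Qed.

Lemma nvN x : nv x \in N K m. Proof. by rewrite memN col_mxKu. Qed.
Lemma nv_dsub z : z \in N K m -> nv (dsubmx z) = z.
Proof. by rewrite memN => /eqP z0; rewrite /nv -[RHS]vsubmxK z0. Qed.
Lemma nvD x y : nv (x + y) = nv x + nv y.
Proof. by rewrite /nv add_col_mx addr0. Qed.
Lemma nvZ c x : nv (c *: x) = c *: nv x.
Proof. by rewrite /nv scale_col_mx scaler0. Qed.

Lemma gact_levi_nv A x : A \in unitmx -> gact (levi A) (nv x) = nv ((invmx A)^T *m x).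
Proof.
by move=> uA; rewrite gactE leviE // mul_block_col !(mulmx0, mul0mx, addr0, add0r).
Qed.
Lemma gact_levi_mv A x : A \in unitmx -> gact (levi A) (mv x) = mv (A *m x).
Proof.
by move=> uA; rewrite gactE leviE // mul_block_col !(mulmx0, mul0mx, addr0, add0r).
Qed.
Lemma gact_unip_nv S x : gact (unip S) (nv x) = col_mx (S *m x) x.
Proof. by rewrite gactE unipE mul_block_col !(mulmx0, mul0mx, mul1mx, add0r). Qed.
Lemma gact_unip_mv S x : gact (unip S) (mv x) = mv x.
Proof. by rewrite gactE unipE mul_block_col !(mulmx0, mul0mx, mul1mx, addr0). Qed.

Lemma levi_Sp A : A \in unitmx -> levi A \in Sp K m.
Proof.
move=> uA; rewrite (Sp_blockE (leviE uA)) !(mulmx0, mul0mx, trmx0, subr0) !eqxx.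
by rewrite -trmx_mul mulVmx // trmx1 eqxx.
Qed.

Lemma levi_SpMN A : A \in unitmx -> levi A \in SpMN K m.
Proof.
move=> uA; rewrite inE levi_Sp //=; apply/andP; split; apply/forallP=> z; apply/implyP.
  by rewrite memM => /eqP z0; rewrite -[z]vsubmxK z0 gact_levi_mv // memM col_mxKd.
by move/nv_dsub <-; rewrite gact_levi_nv // nvN.
Qed.

Lemma gblock g : exists A B C D, gmx g = block_mx A B C D.
Proof.
by exists (ulsubmx (gmx g)), (ursubmx (gmx g)), (dlsubmx (gmx g)), (drsubmx (gmx g));
  rewrite submxK.
Qed.

Lemma gact_block g A B C D x y : gmx g = block_mx A B C D ->
  gact g (col_mx x y) = col_mx (A *m x + B *m y) (C *m x + D *m y).
Proof. by move=> E; rewrite gactE E mul_block_col. Qed.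

Lemma mulmx_ext A D : (forall x, A *m x = D *m x) -> A = D.
Proof.
move=> AD; apply/matrixP=> i j; have /colP/(_ i) := AD (delta_mx j 0).
by rewrite -!colE !mxE.
Qed.

Lemma SpMNP g : g \in SpMN K m -> exists2 A, A \in unitmx & g = levi A.
Proof.
rewrite inE => /and3P[Sg /forallP gM /forallP gN].
have [A [B [C [D E]]]] := gblock g.
have C0 : C = 0.
  apply: mulmx_ext => x; rewrite mul0mx; have /implyP := gM (mv x).
  by rewrite !memM (gact_block _ _ E) !col_mxKd eqxx mulmx0 addr0 => /(_ isT)/eqP.
have B0 : B = 0.
  apply: mulmx_ext => x; rewrite mul0mx; have /implyP := gN (nv x).
  by rewrite !memN (gact_block _ _ E) !col_mxKu eqxx mulmx0 add0r => /(_ isT)/eqP.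
move: Sg; rewrite (Sp_blockE E) C0 B0 !(mulmx0, trmx0, subr0).
case/and3P=> _ _ /eqP AD; have [uA uD] := mulmx1_unit AD.
rewrite unitmx_tr in uA; exists A => //; apply: gmx_inj; rewrite leviE // E C0 B0.
congr block_mx; rewrite trmx_inv -[RHS]mulmx1 -AD mulKmx //.
by rewrite unitmx_tr.
Qed.

Lemma unip_Sp S : S^T = S -> unip S \in Sp K m.
Proof.
move=> tS; rewrite (Sp_blockE (unipE S)) !(mulmx0, mul0mx, trmx0, subr0, trmx1).
by rewrite !mulmx1 mul1mx tS !eqxx.
Qed.

Lemma unip_SpM S : S^T = S -> unip S \in SpM K m.
Proof.
move=> tS; rewrite inE unip_Sp //=; apply/forallP=> z; apply/implyP.
by rewrite memM => /eqP z0; rewrite -[z]vsubmxK z0 gact_unip_mv.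
Qed.

Lemma SpMP g : g \in SpM K m -> exists2 S, S^T = S & g = unip S.
Proof.
rewrite inE => /andP[Sg /forallP gM].
have [A [B [C [D E]]]] := gblock g.
have AC x : A *m x = x /\ C *m x = 0.
  have /implyP := gM (mv x); rewrite memM col_mxKd eqxx => /(_ isT)/eqP.
  by rewrite (gact_block _ _ E) !mulmx0 !addr0 => /eq_col_mx.
have C0 : C = 0 by apply: mulmx_ext => x; rewrite mul0mx; case: (AC x).
have A1 : A = 1%:M by apply: mulmx_ext => x; rewrite mul1mx; case: (AC x).
move: Sg; rewrite (Sp_blockE E) C0 A1 !(mulmx0, trmx0, subr0, trmx1, mul1mx, mul0mx).
case/and3P=> _ /eqP symB /eqP D1; rewrite D1 mulmx1 trmx1 mul1mx in symB.
by exists B => //; apply: gmx_inj; rewrite unipE E C0 A1 D1.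
Qed.

Lemma unipD S S' : unip (S + S') = (unip S * unip S')%g.
Proof.
apply: gmx_inj; rewrite gmxM !unipE /unip_mx mulmx_block.
by rewrite !(mulmx0, mul0mx, mulmx1, mul1mx, addr0, add0r) addrC.
Qed.
Lemma unip0 : unip 0 = 1%g.
Proof. by apply: gmx_inj; rewrite unipE gmx1 scalar_mx_block. Qed.
Lemma levi1 : levi 1%:M = 1%g.
Proof.
by apply: gmx_inj; rewrite leviE ?unitmx1 // /levi_mx invmx1 trmx1 gmx1 scalar_mx_block.
Qed.
Lemma unipV S : (unip S)^-1%g = unip (- S).
Proof. by apply/eqP; rewrite eq_invg_mul -unipD subrr unip0. Qed.
Lemma leviV A : A \in unitmx -> (levi A)^-1%g = levi (invmx A).
Proof.
by move=> uA; apply/eqP; rewrite eq_invg_mul -leviM ?unitmx_inv // mulmxV // levi1.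
Qed.
Lemma unip_inj : injective unip.
Proof. by move=> S S' /(congr1 gmx); rewrite !unipE => /eq_block_mx[]. Qed.

Lemma levi_unip A S : A \in unitmx -> (levi A * unip S)%g = (unip (A *m S *m A^T) * levi A)%g.
Proof.
move=> uA; apply: gmx_inj; rewrite !gmxM !unipE !leviE // !mulmx_block.
rewrite !(mulmx0, mul0mx, mulmx1, mul1mx, addr0, add0r) trmx_inv -mulmxA mulmxV //.
  by rewrite mulmx1.
by rewrite unitmx_tr.
Qed.

Lemma SpM_Sp : {subset SpM K m <= Sp K m}.
Proof. by move=> g; rewrite inE => /andP[]. Qed.
Lemma SpMN_Sp : {subset SpMN K m <= Sp K m}.
Proof. by move=> g; rewrite inE => /andP[]. Qed.

Lemma SpM_group_set : group_set (SpM K m).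
Proof.
apply/group_setP; split; first by rewrite -unip0 unip_SpM ?trmx0.
move=> g h /SpMP[S tS ->] /SpMP[S' tS' ->].
by rewrite -unipD unip_SpM // raddfD /= tS tS'.
Qed.
Lemma SpMN_group_set : group_set (SpMN K m).
Proof.
apply/group_setP; split; first by rewrite -levi1 levi_SpMN ?unitmx1.
move=> g h /SpMNP[A uA ->] /SpMNP[D uD ->].
by rewrite -leviM // levi_SpMN // unitmx_mul uA.
Qed.

Lemma SpM_block g B D : g \in Sp K m -> gmx g = block_mx 1%:M B 0 D -> g \in SpM K m.
Proof.
move=> Sg E; rewrite inE Sg; apply/forallP=> z; apply/implyP.
rewrite memM => /eqP z0; rewrite -[z]vsubmxK z0 (gact_block _ _ E).
by rewrite !mulmx0 !mul0mx !addr0 mul1mx.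
Qed.

Lemma perm_levi (s : 'S_n) : perm_gl K s = levi (perm_mx s^-1).
Proof.
have [_ pu pv] := perm_glP K s.
have uP : perm_mx s^-1 \in unitmx := unitmx_perm K s^-1.
have E i : perm_mx s^-1 *m (delta_mx i 0 : 'cV[K]_n) = delta_mx (s i) 0.
  apply/colP=> k; rewrite -colE !mxE.
  by rewrite -(inj_eq (@perm_inj _ s)) permKV eqxx andbT.
apply: gl_ext => i; rewrite ?pu ?pv.
  by rewrite gact_levi_mv // E.
rewrite gact_levi_nv //; congr nv.
have -> : invmx (perm_mx s^-1) = perm_mx s :> 'M[K]_n.
  by rewrite -[s in RHS]invgK [RHS]perm_mxV.
by rewrite tr_perm_mx E.
Qed.

Lemma perm_SpMN (s : 'S_n) : perm_gl K s \in SpMN K m.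
Proof. by rewrite perm_levi levi_SpMN ?unitmx_perm. Qed.

Lemma c_conj (j : 'I_n) : c_ j
  = (perm_gl K (tperm j ord_max) * c_ ord_max * perm_gl K (tperm j ord_max))%g.
Proof.
have [Sc cu cv cf] := c_P K j; have [Scn cnu cnv cnf] := c_P K (ord_max : 'I_n).
have [_ pu pv] := perm_glP K (tperm j ord_max).
apply: gl_ext => i; rewrite !gactM ?pu ?pv; have [->|ni] := eqVneq i j.
- by rewrite tpermL cnu pv tpermR.
- rewrite (cf i ni).1; have h : tperm j ord_max i != ord_max.
    by apply: contraNneq ni => /(canRL (tpermK _ _)) ->; rewrite tpermR.
  by rewrite (cnf _ h).1 pu tpermK.
- by rewrite tpermL cnv gactN pu tpermR.
rewrite (cf i ni).2; have h : tperm j ord_max i != ord_max.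
  by apply: contraNneq ni => /(canRL (tpermK _ _)) ->; rewrite tpermR.
by rewrite (cnf _ h).2 pv tpermK.
Qed.

(** If the upper left block of g is invertible, g is a lower unipotent times an
    element of the stabilizer of M, and the lower unipotents are conjugate to
    Sp^M under the product of all c_j.  A left factor in Sp^M makes that block
    invertible by [exists_sym_shift]. *)
Lemma Sp_ind (Q : gT -> Prop) :
    {in SpM K m, forall g, Q g} -> {in SpMN K m, forall g, Q g} ->
    Q (c_ ord_max) ->
    {in Sp K m &, forall g h, Q g -> Q h -> Q (g * h)%g} ->
  {in Sp K m, forall g, Q g}.
Proof.
move=> QM QMN Qc QX.
pose Q' g := g \in Sp K m /\ Q g.
have Q'M g : g \in SpM K m -> Q' g by move=> h; split; [apply: SpM_Sp | apply: QM].
have Q'MN g : g \in SpMN K m -> Q' g.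
  by move=> h; split; [apply: SpMN_Sp | apply: QMN].
have Q'X g h : Q' g -> Q' h -> Q' (g * h)%g.
  move=> [Sg Qg] [Sh Qh]; split; last exact: QX.
  exact: Sp_mul.
have Q'p s : Q' (perm_gl K s) by apply/Q'MN/perm_SpMN.
have Q'c : Q' (c_ ord_max) by split=> //; case: (c_P K (ord_max : 'I_n)).
have Q'cj j : Q' (c_ j) by rewrite c_conj; exact: Q'X _ _ (Q'X _ _ (Q'p _) Q'c) (Q'p _).
(* w is the product of all c_j, built up one factor at a time. *)
have [w [Q'w wu wv]] : exists w : gT, [/\ Q' w, forall i, gact w (u_ i) = v_ i :> 'cV[K]_(n + n)
    & forall i, gact w (v_ i) = - u_ i :> 'cV[K]_(n + n)].
  have partial k : (k <= n)%N -> exists w : gT, [/\ Q' w,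
     forall i : 'I_n, gact w (u_ i) = if (i < k)%N then v_ i else u_ i
    & forall i : 'I_n, gact w (v_ i) = if (i < k)%N then - u_ i else v_ i].
    elim: k => [|k IHk] lek.
      exists 1%g; split=> [|i|i]; rewrite ?gact1 //.
      by apply: Q'M; rewrite -unip0 unip_SpM ?trmx0.
    have [w [Q'w wu wv]] := IHk (ltnW lek).
    have [_ cu cv cf] := c_P K (Ordinal lek : 'I_n).
    exists (w * c_ (Ordinal lek))%g; split=> [|i|i]; first exact: Q'X.
      rewrite gactM ltnS; have [->|ni] := eqVneq i (Ordinal lek).
        by rewrite cu wv /= ltnn leqnn.
      rewrite (cf i ni).1 wu [in RHS]leq_eqVlt; move: ni; rewrite -val_eqE /=.
      by move/negPf->.
    rewrite gactM ltnS; have [->|ni] := eqVneq i (Ordinal lek).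
      by rewrite cv gactN wu /= ltnn leqnn.
    rewrite (cf i ni).2 wv [in RHS]leq_eqVlt; move: ni; rewrite -val_eqE /=.
    by move/negPf->.
  have [w [Q'w wu wv]] := partial n (leqnn n).
  by exists w; split=> // i; rewrite ?wu ?wv ltn_ord.
have Ew : gmx w = block_mx 0 (- 1%:M) 1%:M 0.
  have [A [B [C [D E]]]] := gblock w; rewrite E.
  have wm x : gact w (mv x) = nv x.
    by rewrite mvE gact_sum nvE; apply: eq_bigr => i _; rewrite gactZ wu.
  have wn x : gact w (nv x) = - mv x.
    rewrite mvE nvE gact_sum -sumrN; apply: eq_bigr => i _.
    by rewrite gactZ wv scalerN.
  have wm' x : A *m x = 0 /\ C *m x = x.
    by have:= wm x; rewrite (gact_block _ _ E) !mulmx0 !addr0 => /eq_col_mx.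
  have wn' x : B *m x = - x /\ D *m x = 0.
    have:= wn x; rewrite (gact_block _ _ E) !mulmx0 !add0r /mv opp_col_mx oppr0.
    by move/eq_col_mx.
  congr block_mx; apply: mulmx_ext => x; rewrite ?mul0mx ?mulNmx ?mul1mx;
    by case: (wm' x) (wn' x) => ? ? [].
have Q'low R : R^T = R -> exists2 l, Q' l & gmx l = block_mx 1%:M 0 R 1%:M.
  move=> tR; have uN : ((-1)%:M : 'M[K]_n) \in unitmx.
    by rewrite unitmxE det_scalar unitrX // unitrN1.
  have Q's : Q' (unip (- R)) by apply/Q'M/unip_SpM; rewrite raddfN /= tR.
  exists (w * unip (- R) * w * levi (-1)%:M)%g.
    exact: Q'X _ _ (Q'X _ _ (Q'X _ _ Q'w Q's) Q'w) (Q'MN _ (levi_SpMN uN)).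
  (* The inverse of w is w times the scalar -1. *)
  rewrite !gmxM leviE // unipE Ew /levi_mx invmx_scalar invrN1 tr_scalar_mx !mulmx_block.
  rewrite !(mulmx0, mul0mx, mulmx1, mul1mx, addr0, add0r, mulNmx, mulmxN).
  by rewrite mul_mx_scalar scaleN1r !raddfN /= !opprK oppr0.
move=> g Sg; have [A [B [C [D E]]]] := gblock g.
have := Sg; rewrite (Sp_blockE E) => /and3P[/eqP symAC _ _].
have [] := @exists_sym_shift _ _ A C.
- by rewrite trmx_mul trmxK symAC.
- move=> x Ax Cx; have := gactK g (mv x); rewrite (gact_block _ _ E) !mulmx0 Ax Cx !addr0.
  by rewrite /mv col_mx0 gact0 -col_mx0 => /eq_col_mx[].
move=> S tS uA.
pose A1 := A + S *m C; pose R := C *m invmx A1.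
have E1 : gmx (unip S * g) = block_mx A1 (B + S *m D) C D.
  by rewrite gmxM unipE E mulmx_block !(mulmx0, mul0mx, mul1mx, addr0, add0r).
have Sg1 : (unip S * g)%g \in Sp K m.
  by apply: Sp_mul => //; apply: unip_Sp.
have := Sg1; rewrite (Sp_blockE E1) => /and3P[/eqP symA1C _ _].
have tR : R^T = R.
  rewrite /R trmx_mul trmx_inv; apply: (can_inj (mulKmx (_ : A1^T \in unitmx))).
    by rewrite unitmx_tr.
  by rewrite mulKVmx ?unitmx_tr // mulmxA symA1C mulmxK.
have [l [Sl Ql] El] := Q'low R tR.
pose s := ((l * levi A1)^-1 * (unip S * g))%g.
have Es : (l * levi A1 * s)%g = (unip S * g)%g by rewrite mulKVg.
have Ss : s \in SpM K m.
  have Ss : s \in Sp K m.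
    apply: Sp_mul => //; rewrite groupV.
    by apply: Sp_mul => //; apply: levi_Sp.
  have [A' [B' [C' [D' E']]]] := gblock s.
  clearbody s; move/(congr1 gmx): Es; rewrite E1 !gmxM El leviE // E' !mulmx_block.
  rewrite !(mulmx0, mul0mx, mul1mx, mulmx1, addr0, add0r).
  case/eq_block_mx=> hA _ hC _.
  have A'1 : A' = 1%:M by rewrite -(mulKmx uA A') hA mulVmx.
  move: hC; rewrite A'1 mulmx1 /R mulmxKV // => /(canRL (addKr _)).
  rewrite addNr => /(canRL (mulKmx _)); rewrite mulmx0 unitmx_tr unitmx_inv => /(_ uA) C'0.
  by apply: (SpM_block Ss); rewrite E' A'1 C'0.
have -> : g = ((unip S)^-1 * (l * levi A1 * s))%g by rewrite Es mulKg.
apply: (proj2 (_ : Q' _)).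
apply: (Q'X); first by rewrite unipV; apply/Q'M/unip_SpM; rewrite raddfN /= tS.
exact: Q'X _ _ (Q'X _ _ (conj Sl Ql) (Q'MN _ (levi_SpMN uA))) (Q'M _ Ss).
Qed.
End SymplecticBlocks.

(** * The groups T, H, U, B and the monomial group *)
Section Borel.
Variables (K : finFieldType) (m : nat).
Notation n := m.+1.
Notation gT := {'GL_(n + n)[K]}.
Implicit Types (g h : gT) (A S D : 'M[K]_n) (x y : 'cV[K]_n)
  (z : 'cV[K]_(n + n)).

Canonical SpM_group := Group (SpM_group_set K m).
Canonical SpMN_group := Group (SpMN_group_set K m).

Definition unitri A := forall i j : 'I_n, (j <= i)%N -> A i j = (i == j)%:R.

Lemma TP g : g \in T K m <-> exists A, [/\ A \in unitmx, unitri A & g = levi A].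
Proof.
split=> [|[A [uA tA ->]]].
  rewrite inE => /andP[/SpMNP[A uA ->] /forallP tA]; exists A; split=> // i j ji.
  have /forallP/(_ j)/implyP/(_ ji)/eqP := tA i.
  by rewrite -/(gmx _) leviE // block_mxEul.
rewrite inE levi_SpMN //; apply/forallP=> i; apply/forallP=> j; apply/implyP=> ji.
by rewrite -/(gmx _) leviE // block_mxEul tA.
Qed.

Lemma unitri_mul A D : unitri A -> unitri D -> unitri (A *m D).
Proof.
move=> tA tD i j ji; rewrite mxE (bigD1 i) //= tA // eqxx mul1r tD //.
rewrite big1 ?addr0 // => k nki; have [ki|ik] := leqP k i.
  by rewrite tA // eq_sym (negPf nki) mul0r.
rewrite tD ?(leq_trans ji) 1?ltnW //.
have /negPf-> : k != j by rewrite -val_eqE neq_ltn orbC (leq_ltn_trans ji ik).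
by rewrite mulr0.
Qed.

Lemma unitri1 : unitri 1%:M. Proof. by move=> i j _; rewrite mxE. Qed.

Lemma T_group_set : group_set (T K m).
Proof.
apply/group_setP; split.
  by rewrite -(levi1 K m); apply/TP; exists 1%:M; split; rewrite ?unitmx1 //; apply: unitri1.
move=> g h /TP[A [uA tA ->]] /TP[D [uD tD ->]]; rewrite -leviM //; apply/TP.
by exists (A *m D); split; rewrite ?unitmx_mul ?uA //; apply: unitri_mul.
Qed.
Canonical T_group := Group T_group_set.

Definition bv (k : 'I_(n + n)) : 'cV[K]_(n + n) := delta_mx k 0.
Lemma bv_lshift i : bv (lshift n i) = u_ i. Proof. by rewrite /bv delta_mx_ushift. Qed.
Lemma bv_rshift i : bv (rshift n i) = v_ i. Proof. by rewrite /bv delta_mx_dshift. Qed.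
Lemma bvE k l : bv k l 0 = (l == k)%:R. Proof. by rewrite mxE andbT. Qed.
Lemma gact_bvE g k l : gact g (bv l) k 0 = gmx g k l.
Proof. by rewrite gactE /bv -colE mxE. Qed.
Lemma bvZ_inj k c l d : c != 0 -> c *: bv k = d *: bv l -> k = l.
Proof.
move=> c0 /colP/(_ k); rewrite !mxE eqxx andbT mulr1.
by case: eqP => // _; rewrite mulr0 => /eqP; rewrite (negPf c0).
Qed.

(** Stability of M and N is automatic for an element with all u_i and v_j as
    eigenvectors. *)
Lemma HP g : g \in H K m <-> g \in Sp K m /\ forall k, exists c, gact g (bv k) = c *: bv k.
Proof.
split=> [|[Sg gb]].
  rewrite inE => /and3P[/SpMN_Sp Sg /forallP gu /forallP gv]; split=> // k.
  case: (split_ordP k) => i ->; rewrite ?bv_lshift ?bv_rshift.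
    by have /existsP[c /eqP] := gu i; exists c.
  by have /existsP[c /eqP] := gv i; exists c.
have gu i : exists c, gact g (u_ i) = c *: u_ i by rewrite -bv_lshift.
have gv i : exists c, gact g (v_ i) = c *: v_ i by rewrite -bv_rshift.
rewrite inE; apply/and3P; split; last 2 first.
- by apply/forallP=> i; have [c e] := gu i; apply/existsP; exists c; apply/eqP.
- by apply/forallP=> i; have [c e] := gv i; apply/existsP; exists c; apply/eqP.
rewrite inE Sg /=; apply/andP; split; apply/forallP=> z; apply/implyP.
  rewrite memM => /eqP z0; rewrite -[z]vsubmxK z0 -/(mv _) mvE gact_sum.
  apply: memv_suml => i _; rewrite gactZ; have [c ->] := gu i.
  by rewrite !memvZ // memv_span // map_f // mem_enum.
move/nv_dsub <-; rewrite nvE gact_sum.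
apply: memv_suml => i _; rewrite gactZ; have [c ->] := gv i.
by rewrite !memvZ // memv_span // map_f // mem_enum.
Qed.

Lemma H_Sp g : g \in H K m -> g \in Sp K m. Proof. by case/HP. Qed.
Lemma H_SpMN g : g \in H K m -> g \in SpMN K m.
Proof. by rewrite inE => /andP[]. Qed.

Lemma H_group_set : group_set (H K m).
Proof.
apply/group_setP; split.
  apply/HP; split=> [|k]; first exact: Sp_one.
  by exists 1; rewrite gact1 scale1r.
move=> g h /HP[Sg gb] /HP[Sh hb]; apply/HP; split=> [|k].
  exact: Sp_mul.
have [c ec] := hb k; have [d ed] := gb k; exists (c * d).
by rewrite gactM ec gactZ ed scalerA.
Qed.
Canonical H_group := Group H_group_set.

Lemma levi_H A : A \in unitmx ->
  levi A \in H K m <-> forall i, exists c, A *m (delta_mx i 0 : 'cV_n) = c *: (delta_mx i 0 : 'cV_n).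
Proof.
move=> uA; split=> [/HP[_ hb] i | hA].
  have [c] := hb (lshift n i); rewrite bv_lshift gact_levi_mv // /u_ scale_col_mx.
  by case/eq_col_mx=> e _; exists c.
apply/HP; split=> [|k]; first exact: levi_Sp.
case: (split_ordP k) => i ->; rewrite ?bv_lshift ?bv_rshift.
  have [c e] := hA i; exists c; rewrite gact_levi_mv // e.
  by rewrite /mv /u_ scale_col_mx scaler0.
have hd j k' : j != k' -> A j k' = 0.
  have [c] := hA k'; rewrite -colE => /colP/(_ j); rewrite !mxE eqxx andbT.
  by move=> -> /negPf->; rewrite mulr0.
have Ann j : A j j != 0.
  apply/eqP=> A0; have [c] := hA j; rewrite -colE => e.
  have c0 : c = 0 by have /colP/(_ j) := e; rewrite !mxE !eqxx A0 mulr1.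
  move: e; rewrite c0 scale0r colE => /(canRL (mulKmx uA)); rewrite mulmx0.
  by move/colP/(_ j)/eqP; rewrite !mxE !eqxx oner_eq0.
exists (A i i)^-1; rewrite gact_levi_nv // /v_ scale_col_mx scaler0; congr col_mx.
have uAt : A^T \in unitmx by rewrite unitmx_tr.
rewrite trmx_inv; apply: (can_inj (mulKmx uAt)); rewrite mulKVmx // -scalemxAr -colE.
apply/colP=> j; rewrite !mxE andbT; case: eqVneq => [->|nji]; first by rewrite mulVf.
have -> : A i j = 0 by apply: hd; rewrite eq_sym.
by rewrite !mulr0.
Qed.

Lemma upper_tri_factor A : A \in unitmx ->
    (forall i j : 'I_n, (j < i)%N -> A i j = 0) ->
  exists A' D, [/\ A' \in unitmx, unitri A', D \in unitmx, levi D \in H K m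
    & A = A' *m D].
Proof.
move=> uA tA.
have Ann i : A i i != 0.
  have : is_trig_mx A^T by apply/is_trig_mxP => k l kl; rewrite mxE tA.
  move/det_trig; rewrite det_tr => dA; move: uA; rewrite unitmxE unitfE dA.
  by move/prodf_neq0 => /(_ i isT); rewrite mxE.
pose Dg := \matrix_(i, j) (A i i *+ (i == j)) : 'M_n.
have DgE i j : Dg i j = A j j * (i == j)%:R.
  by rewrite mxE mulr_natr; case: eqP => [->|_]; rewrite ?mulr0n.
have uDg : Dg \in unitmx.
  rewrite unitmxE unitfE det_trig; last first.
    by apply/is_trig_mxP => k l kl; rewrite mxE -val_eqE (ltn_eqF kl).
  by apply/prodf_neq0 => i _; rewrite mxE eqxx mulr1n Ann.
have HDg : levi Dg \in H K m.
  apply/(levi_H uDg) => i; exists (A i i); apply/colP=> k.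
  by rewrite -colE mxE DgE !mxE andbT.
exists (A *m invmx Dg), Dg; split=> //; rewrite ?mulmxKV //.
  by rewrite unitmx_mul unitmx_inv uDg uA.
move=> i j ji.
have : A i j = (A *m invmx Dg) i j * A j j.
  rewrite -{1}(mulmxKV uDg A) [LHS]mxE (bigD1 j) //= big1 ?addr0 => [|k /negPf nkj].
    by rewrite DgE eqxx mulr1.
  by rewrite DgE nkj !mulr0.
have [eij|nij] := eqVneq i j.
  by rewrite eij => e; apply: (mulIf (Ann j)); rewrite -e mul1r.
rewrite tA ?ltn_neqAle ?ji ?andbT 1?eq_sym // => /esym/eqP.
by rewrite mulf_eq0 (negPf (Ann j)) orbF => /eqP.
Qed.

Lemma SpMN_norm_SpM : SpMN K m \subset 'N(SpM K m)%g.
Proof.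
apply/subsetP=> g /SpMNP[A uA ->]; rewrite inE; apply/subsetP=> _ /imsetP[y /SpMP[S tS ->] ->].
set S' := invmx A *m S *m (invmx A)^T.
have -> : (unip S ^ levi A = unip S')%g.
  rewrite conjgE; apply: (mulgI (levi A)); rewrite mulKVg levi_unip // /S' !mulmxA.
  by rewrite mulmxV // mul1mx -mulmxA -trmx_mul mulmxV // trmx1 mulmx1.
by apply: unip_SpM; rewrite /S' !trmx_mul trmxK tS mulmxA.
Qed.

Lemma T_SpMN : T K m \subset SpMN K m.
Proof. by apply/subsetP=> g; rewrite inE => /andP[]. Qed.

Lemma T_Sp g : g \in T K m -> g \in Sp K m.
Proof. by move/(subsetP T_SpMN)/SpMN_Sp. Qed.

Lemma SpM_I_SpMN : SpM K m :&: SpMN K m = 1%g.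
Proof.
apply/trivgP/subsetP=> g /setIP[/SpMP[S _ ->] /SpMNP[A uA /(congr1 (@gmx K m))]].
rewrite unipE leviE // => /eq_block_mx[_ -> _ _].
by rewrite unip0 inE.
Qed.

Lemma H_diag A : A \in unitmx -> levi A \in H K m ->
  forall i j, A i j = A j j * (i == j)%:R.
Proof.
move=> uA /(levi_H uA) hA i j; have [c] := hA j; rewrite -colE => e.
have /colP/(_ i) := e; have /colP/(_ j) := e; rewrite !mxE !eqxx !andbT mulr1.
by move=> <-.
Qed.

Lemma H_norm_T : H K m \subset 'N(T K m)%g.
Proof.
apply/subsetP=> g Hg; have [D uD eg] := SpMNP (H_SpMN Hg); rewrite eg in Hg *.
have dD := H_diag uD Hg; rewrite inE.
apply/subsetP=> _ /imsetP[_ /TP[A [uA tA ->]] ->].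
have Dnz i : D i i != 0.
  apply/eqP=> D0; have : D *m (delta_mx i 0 : 'cV_n) = 0.
    by rewrite -colE; apply/colP=> k; rewrite !mxE dD D0 mul0r.
  move/(canRL (mulKmx uD)); rewrite mulmx0 => /colP/(_ i)/eqP.
  by rewrite !mxE !eqxx oner_eq0.
pose X := invmx D *m A *m D.
have uX : X \in unitmx by rewrite !unitmx_mul unitmx_inv uD uA.
have -> : (levi A ^ levi D = levi X)%g.
  by rewrite conjgE leviV // /X !leviM ?unitmx_mul ?unitmx_inv ?uD // mulgA.
apply/TP; exists X; split=> // i j ji.
have : (D *m X) i j = (A *m D) i j by rewrite /X !mulmxA mulmxV // mul1mx.
rewrite mxE (bigD1 i) //= big1 => [|k /negPf nki]; last first.
  by rewrite dD eq_sym nki mulr0 mul0r.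
rewrite addr0 [RHS]mxE (bigD1 j) //= big1 => [|k /negPf nkj]; last first.
  by rewrite dD nkj !mulr0.
rewrite addr0 tA // => e; apply: (mulfI (Dnz i)); rewrite e mulrC.
by case: eqVneq => [->|]; rewrite ?mulr0.
Qed.

Lemma U_group_set : group_set (U K m).
Proof.
apply/(@comm_group_setP _ T_group SpM_group)/normC.
exact: subset_trans T_SpMN SpMN_norm_SpM.
Qed.
Canonical U_group := Group U_group_set.

Lemma H_norm_U : H K m \subset 'N(U K m)%g.
Proof.
rewrite normsM ?H_norm_T //; apply: subset_trans SpMN_norm_SpM.
by apply/subsetP=> g /H_SpMN.
Qed.

Lemma B_group_set : group_set (B K m).
Proof.
by apply/(@comm_group_setP _ U_group H_group)/esym/normC/H_norm_U.
Qed.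
Canonical B_group := Group B_group_set.

(** The order u_1 < ... < u_n < v_n < ... < v_1, for which B is the group of
    upper triangular matrices in Sp. *)
Definition flag_pos (k : 'I_(n + n)) : nat :=
  match split k with inl i => i | inr i => (n + n).-1 - i end.

Lemma flag_posl i : flag_pos (lshift n i) = i.
Proof. by rewrite /flag_pos (unsplitK (inl i)). Qed.
Lemma flag_posr i : flag_pos (rshift n i) = ((n + n).-1 - i)%N.
Proof. by rewrite /flag_pos (unsplitK (inr i)). Qed.
Lemma flag_posr_ge i : (n <= flag_pos (rshift n i))%N.
Proof. by rewrite flag_posr; have := ltn_ord i; lia. Qed.

(** Only the columns of the u_i are constrained: the form then forces the
    columns of the v_j to be triangular for the same order. *)
Definition Btri g := g \in Sp K m /\
  forall (i : 'I_n) k, (i < flag_pos k)%N -> gmx g k (lshift n i) = 0.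

Lemma Btri1 : Btri 1%g.
Proof.
split=> [|i k ik]; first exact: Sp_one.
rewrite gmx1 mxE; case: eqVneq => // ek; by rewrite ek flag_posl ltnn in ik.
Qed.

Lemma Btri_mul g h : Btri g -> Btri h -> Btri (g * h)%g.
Proof.
move=> [Sg tg] [Sh th]; split=> [|i k ik]; first exact: Sp_mul.
rewrite gmxM mxE big1 // => j _; have [ij|ji] := ltnP i (flag_pos j).
  by rewrite th ?mulr0.
case: (split_ordP j) ji => j' -> ji; last first.
  by have := leq_trans (flag_posr_ge j') ji; rewrite leqNgt ltn_ord.
by rewrite tg ?mul0r //; rewrite flag_posl in ji; apply: leq_ltn_trans ji ik.
Qed.

Lemma BP g : g \in B K m <-> Btri g.
Proof.
split=> [/mulsgP[_ h /mulsgP[t s Tt Ms ->] Hh ->] | [Sg tg]].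
  do !apply: Btri_mul.
  - case/TP: Tt => A [uA tA ->]; split=> [|i k]; first exact: levi_Sp.
    rewrite leviE //; case: (split_ordP k) => j ->.
      rewrite flag_posl block_mxEul => ij; rewrite tA 1?ltnW //.
      by have /negPf-> : j != i by rewrite -val_eqE neq_ltn orbC ij.
    by rewrite block_mxEdl mxE.
  - have Ss := SpM_Sp Ms; case/SpMP: Ms Ss => S _ -> Ss; split=> // i k.
    rewrite unipE; case: (split_ordP k) => j ->.
      by rewrite flag_posl block_mxEul mxE -val_eqE => ij; rewrite eqn_leq leqNgt ij.
    by rewrite block_mxEdl mxE.
  have Sh := H_Sp Hh; split=> // i k ik; have [_ hb] := (HP h).1 Hh.
  rewrite -gact_bvE; have [c ->] := hb (lshift n i); rewrite !mxE andbT.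
  by case: eqVneq => [e|]; rewrite ?mulr0 //; rewrite e flag_posl ltnn in ik.
have [A [B' [C [D E]]]] := gblock g.
have C0 : C = 0.
  apply/matrixP=> i j; have := tg j (rshift n i); rewrite E block_mxEdl mxE => -> //.
  exact: leq_trans (ltn_ord j) (flag_posr_ge i).
have tA (i j : 'I_n) : (j < i)%N -> A i j = 0.
  by move=> ji; have := tg j (lshift n i); rewrite E block_mxEul flag_posl => ->.
have uA : A \in unitmx.
  have := Sg; rewrite (Sp_blockE E) => /and3P[_ _ /eqP].
  by rewrite C0 trmx0 mul0mx subr0 => /mulmx1_unit[]; rewrite unitmx_tr.
have [A' [Dg [uA' tA' uDg HDg AE]]] := upper_tri_factor uA tA.
have TA' : levi A' \in T K m by apply/TP; exists A'.
pose s := ((levi A)^-1 * g)%g.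
have Ss : s \in SpM K m.
  have Ss : s \in Sp K m.
    by apply: Sp_mul => //; rewrite groupV; apply: levi_Sp.
  apply: (SpM_block (B := invmx A *m B') (D := A^T *m D) Ss).
  rewrite /s leviV // gmxM leviE ?unitmx_inv // E C0 mulmx_block invmxK.
  by rewrite !(mulmx0, mul0mx, addr0, add0r) mulVmx.
have Es : (levi A * s)%g = g by rewrite mulKVg.
clearbody s.
have -> : g = (levi A' * (levi Dg * s * (levi Dg)^-1) * levi Dg)%g.
  by rewrite !mulgA mulgKV -leviM // -AE.
apply/mem_mulg => //; apply/mem_mulg => //.
have -> : (levi Dg * s * (levi Dg)^-1 = s ^ (levi Dg)^-1)%g by rewrite conjgE invgK mulgA.
by rewrite memJ_norm // groupV (subsetP SpMN_norm_SpM) ?levi_SpMN.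
Qed.

Lemma B_mul g h : g \in B K m -> h \in B K m -> (g * h)%g \in B K m.
Proof. by move=> /BP tg /BP th; apply/BP/Btri_mul. Qed.
Lemma B_inv g : g \in B K m -> g^-1%g \in B K m.
Proof.
move=> Bg; rewrite (invg_expg g); elim: (_.-1) => [|k IHk].
  by rewrite expg0; apply/BP/Btri1.
by rewrite expgS; apply: B_mul.
Qed.

(** The elements of Sp permuting the coordinate lines.  They form a group that
    contains W_2 and normalizes H, and membership is easy to test. *)
Definition mono : {set gT} :=
  [set g in Sp K m | [exists s : {perm 'I_(n + n)}, forall k, forall l,
                       (gmx g k l != 0) == (k == s l)]].

Lemma monoP g : g \in mono <-> g \in Sp K m /\ exists s : {perm 'I_(n + n)},
  forall l, exists2 c, c != 0 & gact g (bv l) = c *: bv (s l).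
Proof.
split=> [|[Sg [s gs]]].
  rewrite inE => /andP[Sg /existsP[s /forallP gs]]; split=> //; exists s => l.
  have nz : gmx g (s l) l != 0 by have /forallP/(_ l)/eqP-> := gs (s l).
  exists (gmx g (s l) l) => //; apply/colP=> k; rewrite gact_bvE mxE bvE.
  have [->|nk] := eqVneq; first by rewrite mulr1.
  by have /forallP/(_ l) := gs k; rewrite (negPf nk) mulr0 => /eqP/negbFE/eqP.
rewrite inE Sg; apply/existsP; exists s; apply/forallP=> k; apply/forallP=> l.
have [c c0 e] := gs l; rewrite -gact_bvE e mxE bvE.
have [_|_] := eqVneq k (s l); first by rewrite mulr1 c0.
by rewrite mulr0 eqxx.
Qed.

Lemma mono_group_set : group_set mono.
Proof.
apply/group_setP; split.
  apply/monoP; split; first exact: Sp_one.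
  by exists 1%g => l; exists 1; rewrite ?oner_eq0 // gact1 perm1 scale1r.
move=> g h /monoP[Sg [s gs]] /monoP[Sh [r hr]]; apply/monoP; split.
  exact: Sp_mul.
exists (r * s)%g => l; have [c c0 ec] := hr l; have [d d0 ed] := gs (r l).
by exists (c * d); rewrite ?mulf_neq0 // gactM ec gactZ ed scalerA permM.
Qed.
Canonical mono_group := Group mono_group_set.

Lemma perm_mono s : perm_gl K s \in mono.
Proof.
have [Sp pu pv] := perm_glP K s; apply/monoP; split=> //.
pose f (k : 'I_(n + n)) : 'I_(n + n) :=
  match split k with inl i => lshift n (s i) | inr i => rshift n (s i) end.
have fl i : f (lshift n i) = lshift n (s i) by rewrite /f (unsplitK (inl i)).
have fr i : f (rshift n i) = rshift n (s i) by rewrite /f (unsplitK (inr i)).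
have f_inj : injective f.
  move=> k l; case: (split_ordP k) => i ->; case: (split_ordP l) => j ->;
    rewrite ?fl ?fr.
  - by move/lshift_inj/perm_inj->.
  - by move/eqP; rewrite eq_lrshift.
  - by move/eqP; rewrite eq_rlshift.
  by move/rshift_inj/perm_inj->.
exists (perm f_inj) => l; exists 1; first exact: oner_neq0.
rewrite permE scale1r.
by case: (split_ordP l) => i ->; rewrite ?fl ?fr ?bv_lshift ?bv_rshift ?pu ?pv.
Qed.

Lemma c_mono (j : 'I_n) : c_ j \in mono.
Proof.
have [Sc cu cv cf] := c_P K j; apply/monoP; split=> //.
exists (tperm (lshift n j) (rshift n j)) => l.
case: (split_ordP l) => i ->; rewrite ?bv_lshift ?bv_rshift.
  have [->|ni] := eqVneq i j.
    by exists 1; rewrite ?oner_neq0 // tpermL bv_rshift cu scale1r.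
  have -> : tperm (lshift n j) (rshift n j) (lshift n i) = lshift n i.
    by apply: tpermD; rewrite ?eq_lshift ?eq_rlshift // eq_sym.
  by exists 1; rewrite ?oner_neq0 // bv_lshift (cf i ni).1 scale1r.
have [->|ni] := eqVneq i j.
  by exists (-1); rewrite ?oppr_eq0 ?oner_neq0 // tpermR bv_lshift cv scaleN1r.
have -> : tperm (lshift n j) (rshift n j) (rshift n i) = rshift n i.
  by apply: tpermD; rewrite ?eq_rshift ?eq_lrshift // eq_sym.
by exists 1; rewrite ?oner_neq0 // bv_rshift (cf i ni).2 scale1r.
Qed.

Lemma W2_mono : W2 K m \subset mono.
Proof.
rewrite gen_subG; apply/subsetP=> g /setUP[/imsetP[i _ ->] | /imsetP[j _ ->]].
  exact: perm_mono.
exact: c_mono.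
Qed.

Lemma W2_Sp : W2 K m \subset Sp K m.
Proof. by apply: subset_trans W2_mono _; apply/subsetP=> g; rewrite inE => /andP[]. Qed.

Lemma mono_norm_H : mono \subset 'N(H K m)%g.
Proof.
apply/subsetP=> g gm; rewrite inE; apply/subsetP=> _ /imsetP[h /HP[Sh hb] ->].
have [Sg [s gs]] := (monoP g).1 gm.
apply/HP; split=> [|k].
  by rewrite conjgE; do !apply: Sp_mul => //; rewrite groupV.
have [c c0 ec] := gs k; have [d ed] := hb (s k); exists d.
rewrite conjgE !gactM ec gactZ ed scalerA mulrC -scalerA -ec -gactZ gactK.
by [].
Qed.

(** An element of B does not move any u_i to a higher position, and a
    permutation with this property fixes every position. *)
Lemma W2_I_B : W2 K m :&: B K m \subset H K m.
Proof.
apply/subsetP=> g /setIP[/(subsetP W2_mono)/monoP[Sg [s gs]] /BP[_ tg]].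
have le_s (i : 'I_n) : (flag_pos (s (lshift n i)) <= i)%N.
  rewrite leqNgt; apply/negP=> /tg; rewrite -gact_bvE; have [c c0 ->] := gs (lshift n i).
  by rewrite mxE bvE eqxx mulr1 => /eqP; rewrite (negPf c0).
have sl (i : 'I_n) : s (lshift n i) = lshift n i.
  have [k] := ubnP (i : nat); elim: k i => // k IHk i lt_ik.
  case: (split_ordP (s (lshift n i))) (le_s i) => j ej; rewrite ej ?flag_posl; last first.
    by move/(leq_trans (flag_posr_ge j)); rewrite leqNgt ltn_ord.
  rewrite leq_eqVlt => /predU1P[/val_inj-> // | ji].
  have := IHk j (leq_trans ji lt_ik); rewrite -ej => /perm_inj e.
  by rewrite ej -e.
apply/HP; split=> // k; case: (split_ordP k) => i ->.
  by have [c _ e] := gs (lshift n i); exists c; rewrite e sl.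
have [c c0 ec] := gs (lshift n i); have [d d0 ed] := gs (rshift n i).
exists d; rewrite ed; congr (_ *: bv _); move: ec; rewrite sl => ec.
have /eqP := (SpP _ Sg) (bv (lshift n i)) (bv (rshift n i)).
rewrite ec ed formZl formZr bv_lshift bv_rshift form_uv eqxx.
case: (split_ordP (s (rshift n i))) => j ->; rewrite ?bv_lshift ?bv_rshift ?form_uu ?form_uv.
  by rewrite !mulr0 eq_sym oner_eq0.
by have [->|_] := eqVneq i j; rewrite // !mulr0 eq_sym oner_eq0.
Qed.
End Borel.

(** * Parity of U and the rank one relation *)
Section RankOne.
Variables (K : finFieldType) (m : nat).
Notation n := m.+1.
Notation gT := {'GL_(n + n)[K]}.
Implicit Types (g h : gT) (A S D : 'M[K]_n) (x y : 'cV[K]_n)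
  (z : 'cV[K]_(n + n)).

(** U has no involution: if g in U has square 1 and block A on M, then
    (A + 1)(A - 1) = 0, where A + 1 is triangular with 2 on the diagonal, hence
    invertible; so A = 1, and then g is in Sp^M, which has no involution
    either. *)
Lemma U_odd : 2%:R != 0 :> K -> odd #|U K m|.
Proof.
move=> two; rewrite -[odd _]negbK -dvdn2; apply/negP=> /(Cauchy (isT : prime 2)).
case=> g0 /= /mulsgP[_ _ /TP[A [uA tA ->]] /SpMP[S _ ->] ->] g2.
set g := (levi A * unip S)%g in g2.
have gg : (g * g = 1)%g by rewrite -(expg_order g) g2 expgS expg1.
have AA : A *m A = 1%:M.
  have Eg : gmx g = block_mx A (A *m S) 0 (invmx A)^T.
    rewrite gmxM leviE // unipE mulmx_block.
    by rewrite !(mulmx0, mul0mx, mulmx1, addr0, add0r).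
  have := congr1 (@gmx K m) gg; rewrite gmxM Eg gmx1 mulmx_block scalar_mx_block.
  by case/eq_block_mx; rewrite mulmx0 addr0.
have uA1 : A + 1%:M \in unitmx.
  rewrite -unitmx_tr unitmxE unitfE det_trig.
    by apply/prodf_neq0 => i _; rewrite !mxE tA // eqxx -(natrD _ 1 1).
  apply/is_trig_mxP => k l kl; rewrite !mxE tA 1?ltnW // -val_eqE gtn_eqF //.
  by rewrite addr0.
have A1 : A = 1%:M.
  apply/eqP; rewrite -subr_eq0 -(mulKmx uA1 (A - 1%:M)) mulmxBr !mulmxDl AA.
  by rewrite !(mulmx1, mul1mx) [1%:M + A]addrC subrr mulmx0.
have g1 : g = 1%g.
  move: gg; rewrite /g A1 levi1 mul1g -unipD -unip0 => /unip_inj.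
  rewrite -mulr2n -scaler_nat => /eqP; rewrite scaler_eq0 (negPf two) /=.
  by move/eqP->.
by move: g2; rewrite g1 order1.
Qed.

(** The elements [xroot i j t] form the root subgroup of Sp_{M,N} at the
    position (i, j), and [swap i j] represents the corresponding reflection. *)
Definition xroot_mx (i j : 'I_n) (t : K) : 'M[K]_n := 1%:M + t *: delta_mx i j.
Definition xroot i j t : gT := levi (xroot_mx i j t).
Definition swap (i j : 'I_n) : gT := perm_gl K (tperm i j).

Lemma xroot_mxD i j s t : i != j -> xroot_mx i j (s + t) = xroot_mx i j s *m xroot_mx i j t.
Proof.
move=> nij; rewrite /xroot_mx mulmxDl !mulmxDr !mulmx1 mul1mx -scalemxAl -scalemxAr.
rewrite mul_delta_mx_cond eq_sym (negPf nij) mulr0n !scaler0 addr0 scalerDl.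
by rewrite addrA addrAC.
Qed.
Lemma xroot_mx0 i j : xroot_mx i j 0 = 1%:M.
Proof. by rewrite /xroot_mx scale0r addr0. Qed.
Lemma xroot_mx_unit i j t : i != j -> xroot_mx i j t \in unitmx.
Proof.
move=> nij; apply: (proj1 (mulmx1_unit (B := xroot_mx i j (- t)) _)).
by rewrite -xroot_mxD // subrr xroot_mx0.
Qed.
Lemma xrootD i j s t : i != j -> xroot i j (s + t) = (xroot i j s * xroot i j t)%g.
Proof. by move=> nij; rewrite /xroot xroot_mxD // leviM ?xroot_mx_unit. Qed.
Lemma xroot0 i j : xroot i j 0 = 1%g. Proof. by rewrite /xroot xroot_mx0 levi1. Qed.
Lemma xrootN i j t : i != j -> xroot i j (- t) = (xroot i j t)^-1%g.
Proof. by move=> nij; apply/esym/eqP; rewrite eq_invg_mul -xrootD // subrr xroot0. Qed.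

Lemma swap_levi i j : swap i j = levi (perm_mx (tperm i j)).
Proof. by rewrite /swap perm_levi tpermV. Qed.
Lemma swapK i j : (swap i j * swap i j)%g = 1%g.
Proof.
by rewrite swap_levi -leviM ?unitmx_perm // -perm_mxM tperm2 perm_mx1 levi1.
Qed.

Lemma xroot_mx_bv i j t k :
  xroot_mx i j t *m (delta_mx k 0 : 'cV_n) = delta_mx k 0 + (t *+ (j == k)) *: delta_mx i 0.
Proof.
by rewrite mulmxDl mul1mx -scalemxAl mul_delta_mx_cond -scalerMnr scalerMnl.
Qed.

Lemma perm_bv (s : 'S_n) k :
  perm_mx s *m (delta_mx (s k) 0 : 'cV[K]_n) = delta_mx k 0.
Proof. by apply/colP=> l; rewrite -colE !mxE (inj_eq perm_inj) andbT. Qed.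

(** The relation of SL_2 that writes the lower unipotent with entry t as
    x(1/t) h w x(1/t), with h in the torus. *)
Lemma swap_xroot_swap i j t : i != j -> t != 0 -> exists2 h, h \in H K m &
  (swap i j * xroot i j t * swap i j)%g = (xroot i j t^-1%R * h * swap i j * xroot i j t^-1%R)%g.
Proof.
move=> nij t0; set x' := xroot i j t^-1; set w := swap i j.
pose P : 'M[K]_n := perm_mx (tperm i j).
have uP : P \in unitmx by apply: unitmx_perm.
pose Q := xroot_mx i j (- t^-1) *m P *m xroot_mx i j t *m P *m xroot_mx i j (- t^-1) *m P.
have uQ : Q \in unitmx by rewrite !unitmx_mul uP !xroot_mx_unit.
have eQ : (x'^-1 * w * xroot i j t * w * x'^-1 * w)%g = levi Q.
  by rewrite /Q !leviM ?unitmx_mul ?uP ?xroot_mx_unit // /x' -xrootN // /w swap_levi.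
exists (levi Q); last first.
  have alg (a b c : gT) : (b * b = 1 -> b * c * b
      = a * (a^-1 * b * c * b * a^-1 * b) * b * a)%g.
    by move=> bb; rewrite !mulgA mulgV mul1g -(mulgA _ b b) bb mulg1 mulgKV.
  rewrite -eQ; exact: (alg x' w (xroot i j t) (swapK i j)).
have Pi : P *m (delta_mx i 0 : 'cV_n) = delta_mx j 0.
  by rewrite -[i in delta_mx i](tpermR i j) perm_bv.
have Pj : P *m (delta_mx j 0 : 'cV_n) = delta_mx i 0.
  by rewrite -[j in delta_mx j](tpermL i j) perm_bv.
have nji : (j == i) = false by rewrite eq_sym (negPf nij).
have Pk k : k != i -> k != j -> P *m (delta_mx k 0 : 'cV_n) = delta_mx k 0.
  move=> nki nkj; rewrite -[k in delta_mx k](@tpermD _ i j k) 1?eq_sym //.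
  by rewrite perm_bv tpermD // eq_sym.
apply/(levi_H uQ) => k; rewrite /Q -!mulmxA.
clear eQ uQ; move: P Pi Pj Pk uP @Q => P Pi Pj Pk uP _.
have [->|nki] := eqVneq k i.
  exists (- t^-1); rewrite Pi xroot_mx_bv eqxx mulr1n mulmxDr -scalemxAr Pi Pj.
  rewrite mulmxDr -scalemxAr !xroot_mx_bv eqxx nji mulr1n mulr0n scale0r addr0.
  rewrite scalerDr scalerA mulNr mulVf // scaleN1r addrCA subrr addr0.
  by rewrite -!scalemxAr Pj xroot_mx_bv nji mulr0n scale0r addr0.
have [->|nkj] := eqVneq k j.
  exists t; rewrite Pj !xroot_mx_bv nji mulr0n scale0r addr0 Pi xroot_mx_bv eqxx mulr1n.
  rewrite mulmxDr -scalemxAr Pi Pj mulmxDr -scalemxAr !xroot_mx_bv nji eqxx.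
  rewrite mulr0n scale0r addr0 mulr1n scalerDr scalerA mulrN mulfV // scaleN1r.
  by rewrite addrCA subrr addr0.
have xk s : xroot_mx i j s *m (delta_mx k 0 : 'cV_n) = delta_mx k 0.
  by rewrite xroot_mx_bv eq_sym (negPf nkj) mulr0n scale0r addr0.
by exists 1; rewrite scale1r !(Pk, xk).
Qed.
End RankOne.

(** * Positive roots and monomial elements *)
Section Positive.
Variables (K : finFieldType) (m : nat).
Notation n := m.+1.
Notation gT := {'GL_(n + n)[K]}.
Implicit Types (g h : gT) (A S D : 'M[K]_n) (x y : 'cV[K]_n)
  (z : 'cV[K]_(n + n)) (k l : 'I_(n + n)).

Definition permutes_lines g (s : {perm 'I_(n + n)}) :=
  forall l, exists2 c, c != 0 & gact g (bv K l) = c *: bv K (s l).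

Lemma permutes_linesM g h s r : permutes_lines g s -> permutes_lines h r ->
  permutes_lines (g * h)%g (r * s)%g.
Proof.
move=> gs hr l; have [c c0 ec] := hr l; have [d d0 ed] := gs (r l).
by exists (c * d); rewrite ?mulf_neq0 // gactM ec gactZ ed scalerA permM.
Qed.

Lemma permutes_linesV g s : permutes_lines g s -> permutes_lines g^-1%g s^-1%g.
Proof.
move=> gs l; have [c c0 ec] := gs (s^-1%g l); exists c^-1; rewrite ?invr_eq0 //.
rewrite permKV in ec; apply: (can_inj (gactK g)); rewrite gactKV gactZ ec scalerA.
by rewrite mulVf // scale1r.
Qed.

Lemma mono_permutes g : g \in mono K m -> exists s, permutes_lines g s.
Proof. by case/monoP. Qed.

Lemma H_permutes h : h \in H K m -> permutes_lines h 1%g.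
Proof.
move=> /HP[_ hb] l; have [c e] := hb l; exists c; rewrite ?perm1 //.
apply/eqP=> c0; move: e; rewrite c0 scale0r => /(congr1 (gact h^-1%g)).
rewrite gactK gact0 => /colP/(_ l)/eqP.
by rewrite bvE eqxx mxE oner_eq0.
Qed.

(** The index of the basis vector paired with the k-th one by the form. *)
Definition opp_ix (k : 'I_(n + n)) : 'I_(n + n) :=
  match split k with inl i => rshift n i | inr i => lshift n i end.
Lemma opp_ixl i : opp_ix (lshift n i) = rshift n i.
Proof. by rewrite /opp_ix (unsplitK (inl i)). Qed.
Lemma opp_ixr i : opp_ix (rshift n i) = lshift n i.
Proof. by rewrite /opp_ix (unsplitK (inr i)). Qed.
Lemma flag_pos_opp k : flag_pos (opp_ix k) = ((n + n).-1 - flag_pos k)%N.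
Proof.
case: (split_ordP k) => i ->; rewrite ?opp_ixl ?opp_ixr flag_posl flag_posr //.
by have := ltn_ord i; lia.
Qed.
Lemma flag_pos_lt k : (flag_pos k < n + n)%N.
Proof. by case: (split_ordP k) => i ->; rewrite ?flag_posl ?flag_posr; have := ltn_ord i; lia. Qed.

Lemma form_bv k l : (form (bv K k) (bv K l) != 0) = (l == opp_ix k).
Proof.
case: (split_ordP k) => i ->; case: (split_ordP l) => j ->;
  rewrite ?opp_ixl ?opp_ixr ?bv_lshift ?bv_rshift.
- by rewrite form_uu eqxx eq_lrshift.
- by rewrite form_uv eq_rshift (eq_sym j); have [_|_] := eqVneq i j; rewrite ?oner_neq0 ?eqxx.
- rewrite form_sym oppr_eq0 form_uv eq_lshift.
  by have [_|_] := eqVneq j i; rewrite ?oner_neq0 ?eqxx.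
by rewrite form_vv eqxx eq_rlshift.
Qed.

Lemma permutes_opp g s k : g \in Sp K m -> permutes_lines g s ->
  s (opp_ix k) = opp_ix (s k).
Proof.
move=> /SpP Sg gs; have [c c0 ec] := gs k; have [d d0 ed] := gs (opp_ix k).
apply/eqP; rewrite -form_bv; have := Sg (bv K k) (bv K (opp_ix k)).
rewrite ec ed formZl formZr => /esym e.
have : form (bv K k) (bv K (opp_ix k)) != 0 by rewrite form_bv.
by rewrite e !mulf_eq0 !negb_or => /and3P[].
Qed.

(** Says that the inverse of g moves the i-th basis vector of M to an earlier
    flag position than the j-th one, i.e., that g^-1 makes the root at (i, j)
    positive.  It is phrased by matrix entries so as not to depend on a choice
    of the permutation of g. *)
Definition pos (i j : 'I_n) g : bool :=
  [forall k, forall l, (gmx g (lshift n i) k != 0) ==>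
     (gmx g (lshift n j) l != 0) ==> (flag_pos k < flag_pos l)%N].

Lemma posE i j g s : permutes_lines g s ->
  pos i j g = (flag_pos (s^-1%g (lshift n i)) < flag_pos (s^-1%g (lshift n j)))%N.
Proof.
move=> gs; have E k l : (gmx g k l != 0) = (k == s l).
  have [c c0 e] := gs l; rewrite -gact_bvE e mxE bvE.
  by have [_|_] := eqVneq k (s l); rewrite ?mulr1 ?c0 // mulr0 eqxx.
apply/forallP/idP => [h | h k].
  have /forallP/(_ (s^-1%g (lshift n j))) := h (s^-1%g (lshift n i)).
  by rewrite !E !permKV !eqxx.
apply/forallP=> l; rewrite !E; apply/implyP=> /eqP ek; apply/implyP=> /eqP el.
by move: h; rewrite ek el !permK.
Qed.

Lemma flag_pos_inj : injective (@flag_pos m).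
Proof.
move=> k l; case: (split_ordP k) => i ->; case: (split_ordP l) => j ->;
  rewrite ?flag_posl ?flag_posr; have := ltn_ord i; have := ltn_ord j.
- by move=> _ _ /val_inj->.
- by lia.
- by lia.
by move=> hi hj e; congr rshift; apply: val_inj => /=; move: hi hj e; lia.
Qed.

Lemma swap_permutes i j : exists2 s : {perm 'I_(n + n)}, permutes_lines (swap K i j) s
  & s (lshift n i) = lshift n j /\ s (lshift n j) = lshift n i.
Proof.
have [s ws] := mono_permutes (perm_mono K (tperm i j)); exists s => //.
have [_ pu _] := perm_glP K (tperm i j); split.
  have [c c0] := ws (lshift n i); rewrite bv_lshift pu tpermL -bv_lshift -[LHS]scale1r.
  by move/bvZ_inj->; rewrite ?oner_neq0.
have [c c0] := ws (lshift n j); rewrite bv_lshift pu tpermR -bv_lshift -[LHS]scale1r.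
by move/bvZ_inj->; rewrite ?oner_neq0.
Qed.

(** For g monomial, exactly one of g and (swap i j) g is positive: this is what
    lets the Weyl group be split into pairs in [swap_weyl_sum]. *)
Lemma pos_swap i j g : i != j -> g \in mono K m -> pos i j (swap K i j * g)%g = ~~ pos i j g.
Proof.
move=> nij /mono_permutes[s gs]; have [r swap_r [ri rj]] := swap_permutes i j.
rewrite (posE _ _ (permutes_linesM swap_r gs)) (posE _ _ gs) invMg !permM.
rewrite -[in r^-1%g (lshift n i)]rj -[in r^-1%g (lshift n j)]ri !permK -leqNgt.
rewrite [RHS]leq_eqVlt (inj_eq flag_pos_inj) (inj_eq perm_inj) eq_lshift eq_sym.
by rewrite (negPf nij).
Qed.

Lemma pos_H i j g h : g \in mono K m -> h \in H K m -> pos i j (g * h)%g = pos i j g.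
Proof.
move=> /mono_permutes[s gs] /H_permutes h1.
by rewrite (posE _ _ (permutes_linesM gs h1)) (posE _ _ gs) mul1g.
Qed.

Lemma xroot_bv i j t k : i != j -> gact (xroot i j t) (bv K k) = bv K k
  + (t *+ (k == lshift n j)) *: bv K (lshift n i)
  - (t *+ (k == rshift n i)) *: bv K (rshift n j).
Proof.
move=> nij; have uX := xroot_mx_unit t nij.
case: (split_ordP k) => l ->; rewrite ?bv_lshift ?bv_rshift ?eq_lshift ?eq_rshift ?eq_lrshift ?eq_rlshift mulr0n scale0r.
  rewrite subr0 gact_levi_mv // xroot_mx_bv eq_sym /mv.
  by rewrite /u_ scale_col_mx scaler0 add_col_mx addr0.
rewrite addr0 gact_levi_nv // /nv.
have -> : invmx (xroot_mx i j t) = xroot_mx i j (- t).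
  by apply: (can_inj (mulKmx uX)); rewrite mulmxV // -xroot_mxD // subrr xroot_mx0.
rewrite /xroot_mx raddfD /= trmx1 linearZ /= trmx_delta mulmxDl mul1mx -scalemxAl.
rewrite mul_delta_mx_cond -scalerMnr scalerMnl mulNrn eq_sym scaleNr.
by rewrite /v_ scale_col_mx scaler0 opp_col_mx oppr0 add_col_mx addr0.
Qed.

(** The conjugate adds to a basis vector a multiple of an earlier one.  There
    are two vectors to consider, since the root element moves both u_j and v_i;
    the second one is dealt with by the symmetry of flag positions under the
    form. *)
Lemma pos_conj_B i j g t : i != j -> g \in mono K m -> pos i j g ->
  (g^-1 * xroot i j t * g)%g \in B K m.
Proof.
move=> nij gm; have [Sg _] := (monoP g).1 gm.
have [s gs] := mono_permutes gm; rewrite (posE _ _ gs) => lt_ij.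
apply/BP; split=> [|l k lk].
  do !apply: Sp_mul => //; first by rewrite groupV.
  by apply: levi_Sp; apply: xroot_mx_unit.
have ne : k != lshift n l by apply: contraTneq lk => ->; rewrite flag_posl ltnn.
have [c c0 ec] := gs (lshift n l).
rewrite -gact_bvE !gactM ec gactZ xroot_bv // scalerBr scalerDr -ec.
rewrite !(gactD, gactN, gactZ) gactK.
have sV := permutes_linesV gs.
have [d d0 ->] := sV (lshift n i); have [d' d0' ->] := sV (rshift n j).
rewrite !mxE !andbT (negPf ne) add0r.
have z1 : t *+ (s (lshift n l) == lshift n j) * (d * (k == s^-1%g (lshift n i))%:R) = 0.
  case: eqP => [el|_]; last by rewrite mul0r.
  case: eqP => [ek|_]; last by rewrite !mulr0.
  by move: lt_ij; rewrite -ek -el permK flag_posl ltnNge ltnW.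
have z2 : t *+ (s (lshift n l) == rshift n i) * (d' * (k == s^-1%g (rshift n j))%:R) = 0.
  case: eqP => [el|_]; last by rewrite mul0r.
  case: eqP => [ek|_]; last by rewrite !mulr0.
  have oV r : s^-1%g (opp_ix r) = opp_ix (s^-1%g r) by apply: permutes_opp sV; rewrite ?groupV.
  have := lk; rewrite -(flag_posl l) -(permK s (lshift n l)) el ek -!opp_ixl !oV !flag_pos_opp.
  by move: lt_ij (flag_pos_lt (s^-1%g (lshift n j))) (flag_pos_lt (s^-1%g (lshift n i))); lia.
by rewrite z1 z2 !mulr0 subr0.
Qed.

End Positive.

(** * Generation of the Levi subgroup and splitting of T *)
Section Generation.
Variables (K : finFieldType) (m : nat).
Notation n := m.+1.
Notation gT := {'GL_(n + n)[K]}.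
Implicit Types (g h : gT) (A S D : 'M[K]_n) (x y : 'cV[K]_n)
  (z : 'cV[K]_(n + n)).

(** By LUP decomposition; the lower triangular factor is conjugate to an upper
    triangular one under the permutation reversing the order, and permutations
    are products of adjacent transpositions. *)
Lemma GL_ind (Q : 'M[K]_n -> Prop) :
    (forall A, A \in unitmx -> unitri A -> Q A) ->
    (forall A, A \in unitmx -> levi A \in H K m -> Q A) ->
    (forall i j : 'I_n, j = i.+1 :> nat -> Q (perm_mx (tperm i j))) ->
    (forall A D, A \in unitmx -> D \in unitmx -> Q A -> Q D -> Q (A *m D)) ->
  forall A, A \in unitmx -> Q A.
Proof.
move=> QT QH Qp QX.
have Q1 : Q 1%:M by apply: QT; [apply: unitmx1 | apply: unitri1].
have QpX (s t : 'S_n) : Q (perm_mx s) -> Q (perm_mx t) -> Q (perm_mx (s * t)%g).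
  by move=> Qs Qt; rewrite perm_mxM; apply: QX; rewrite ?unitmx_perm.
have Qt d (i j : 'I_n) : (j = i + d.+1 :> nat)%N -> Q (perm_mx (tperm i j)).
  elim: d i j => [|d IHd] i j ej; first by apply: Qp; rewrite ej addn1.
  have lt_k : (i + d.+1 < n)%N by rewrite (leq_trans _ (ltn_ord j)) // ej; lia.
  pose k := Ordinal lt_k.
  have -> : tperm i j = (tperm k j * tperm i k * tperm k j)%g.
    rewrite -{1}[tperm k j]tpermV -mulgA -conjgE tpermJ tpermL.
    by rewrite tpermD // -val_eqE /= ?ej; lia.
  have Qkj : Q (perm_mx (tperm k j)) by apply: Qp; rewrite /= ej; lia.
  by do 2?[apply: (QpX)] => //; apply: IHd.
have Qt' (i j : 'I_n) : Q (perm_mx (tperm i j)).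
  have [lt_ij|lt_ji|/val_inj->] := ltngtP i j.
  - by apply: (Qt (j - i).-1); lia.
  - by rewrite tpermC; apply: (Qt (i - j).-1); lia.
  by rewrite tperm1 perm_mx1.
have Qs s : Q (perm_mx s).
  have [ts -> _] := prod_tpermP s; elim: ts => [|t ts IHts].
    by rewrite big_nil perm_mx1.
  by rewrite big_cons; apply: QpX.
have Qtri A : A \in unitmx -> (forall i j : 'I_n, (j < i)%N -> A i j = 0) -> Q A.
  move=> uA tA.
  have [A' [D [uA' tA' uD HD ->]]] := upper_tri_factor uA tA.
  by apply: (QX) => //; [apply: QT | apply: QH].
move=> A uA; have := cormen_lup_correct A.
case E: (cormen_lup A) => [[P L] R] /= PA.
have pP : is_perm_mx P by have := cormen_lup_perm A; rewrite E.
have dL : \det L = 1 by have := cormen_lup_detL A; rewrite E.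
have tL (i j : 'I_n) : (i <= j)%N -> L i j = (i == j)%:R.
  by have := @cormen_lup_lower _ _ A i j; rewrite E.
have tR (i j : 'I_n) : (j < i)%N -> R i j = 0.
  by have := @cormen_lup_upper _ _ A i j; rewrite E.
have uL : L \in unitmx by rewrite unitmxE dL unitr1.
have [s eP] := is_perm_mxP P pP.
have uP : P \in unitmx by rewrite eP unitmx_perm.
have uR : R \in unitmx.
  have : L *m R \in unitmx by rewrite -[L *m R]PA [_ * _](_ : _ = P *m A) // unitmx_mul uP.
  by rewrite unitmx_mul uL.
have -> : A = perm_mx s^-1 *m (L *m R).
  rewrite -[L *m R]PA eP [_ * A](_ : _ = perm_mx s *m A) // mulmxA -perm_mxM.
  by rewrite mulVg perm_mx1 mul1mx.
pose r : 'S_n := perm (@rev_ord_inj n).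
have ur : perm_mx r \in unitmx := unitmx_perm K r.
have rr : (r * r = 1)%g by apply/permP=> i; rewrite permM perm1 !permE rev_ordK.
pose L' := perm_mx r *m L *m perm_mx r.
have eL : L = perm_mx r *m L' *m perm_mx r.
  by rewrite /L' !mulmxA -perm_mxM rr perm_mx1 mul1mx -mulmxA -perm_mxM rr perm_mx1 mulmx1.
have uL' : L' \in unitmx by rewrite !unitmx_mul unitmx_perm uL.
have QL' : Q L'.
  apply: QT => // i j ji.
  have rV : (r^-1 = r)%g by apply/eqP; rewrite eq_invg_mul rr.
  rewrite /L' -row_permE -[r in _ *m perm_mx r]rV -col_permE !mxE !permE tL /=; last lia.
  by rewrite (inj_eq rev_ord_inj).
have QL : Q L.
  clearbody L'; have urL : perm_mx r *m L' \in unitmx by rewrite unitmx_mul ur.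
  by rewrite eL; apply: (QX _ _ urL ur _ (Qs r)); apply: (QX _ _ ur uL' (Qs r) QL').
apply: (QX _ _ _ _ (Qs _)); rewrite ?unitmx_perm // ?unitmx_mul ?uL //.
by apply: (QX) => //; apply: Qtri.
Qed.

(** For consecutive i and j this is a complement in T of the root subgroup at
    (i, j), and it is normalized by [swap i j]. *)
Definition Tij (i j : 'I_n) : {set gT} :=
  [set g in T K m | gmx g (lshift n i) (lshift n j) == 0].

Lemma TijE i j g : (g \in Tij i j)
  = (g \in T K m) && (gmx g (lshift n i) (lshift n j) == 0).
Proof. by rewrite [LHS]inE. Qed.

Lemma xroot_T (i j : 'I_n) t : (i < j)%N -> xroot i j t \in T K m.
Proof.
move=> ij; have nij : i != j by rewrite -val_eqE neq_ltn ij.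
apply/TP; exists (xroot_mx i j t); split; rewrite ?xroot_mx_unit // => k l lk.
rewrite !mxE; case: (eqVneq k i) => [ek|_]; last by rewrite mulr0 addr0.
have /negPf-> : l != j by rewrite -val_eqE neq_ltn (leq_ltn_trans lk) // ek.
by rewrite mulr0 addr0.
Qed.

Lemma sum_T_split (R : zmodType) (f : gT -> R) (i j : 'I_n) : (i < j)%N ->
  \sum_(g in T K m) f g = \sum_(g in Tij i j) \sum_(t : K) f (g * xroot i j t)%g.
Proof.
move=> ij; have nij : i != j by rewrite -val_eqE neq_ltn ij.
rewrite pair_big_dep /=.
pose F (p : gT * K) := (p.1 * xroot i j p.2)%g.
pose e (g : gT) := gmx g (lshift n i) (lshift n j).
have eX g t : g \in T K m -> e (g * xroot i j t)%g = e g + t.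
  case/TP=> A [uA tA ->]; rewrite /e /xroot -leviM ?xroot_mx_unit // !leviE ?unitmx_mul ?uA ?xroot_mx_unit //.
  rewrite !block_mxEul mulmxDr mulmx1 -scalemxAr mxE; congr (_ + _).
  rewrite mxE mxE (bigD1 i) //= big1 => [|k nki]; last first.
    by rewrite mxE (negPf nki) mulr0.
  by rewrite mxE !eqxx tA // eqxx mulr1 addr0 mulr1.
pose G (g : gT) : gT * K := ((g * xroot i j (- e g))%g, e g).
rewrite (reindex_onto F G) /=; last first.
  by move=> g _; rewrite /F /G /= -mulgA -xrootD // addNr xroot0 mulg1.
apply: eq_bigl => [[g t]]; rewrite /F /G /= TijE andbT.
have -> : (g * xroot i j t)%g \in T K m = (g \in T K m).
  exact: (@groupMr _ (T_group K m) _ _ (xroot_T t ij)).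
case Tg: (g \in T K m) => //=.
rewrite eX // -/(e g); apply/eqP/eqP => [[_ h]|eg].
  by apply: (addIr t); rewrite h add0r.
by rewrite eg add0r xrootN // mulgK.
Qed.

Lemma Tij_conj (i j : 'I_n) g : j = i.+1 :> nat -> g \in Tij i j ->
  (swap K i j * g * swap K i j)%g \in Tij i j.
Proof.
move=> ej; rewrite !TijE => /andP[/TP[A [uA tA ->]] A0].
pose P : 'M[K]_n := perm_mx (tperm i j).
have uP : P \in unitmx by apply: unitmx_perm.
have nij : i != j by rewrite -val_eqE /= ej neq_ltn ltnSn.
have Aij : A i j = 0 by apply/eqP; move: A0; rewrite leviE // block_mxEul.
have E k l : (P *m A *m P) k l = A (tperm i j k) (tperm i j l).
  have -> : P *m A *m P = col_perm (tperm i j) (row_perm (tperm i j) A).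
    by rewrite col_permE row_permE tpermV.
  by rewrite !mxE.
rewrite swap_levi -!leviM ?unitmx_mul ?uP ?uA //; apply/andP; split; last first.
  rewrite leviE ?unitmx_mul ?uP ?uA // block_mxEul E tpermL tpermR tA; last by rewrite ej.
  by rewrite (eq_sym j) (negPf nij).
apply/TP; exists (P *m A *m P); split; rewrite ?unitmx_mul ?uP ?uA // => k l lk.
rewrite E -(inj_eq (@perm_inj _ (tperm i j))).
have [le|lt] := leqP (tperm i j l) (tperm i j k); first exact: tA.
have [ki lj] : tperm i j k = i /\ tperm i j l = j.
  have [ck|ck] := boolP ((tperm i j k == i) && (tperm i j l == j)).
    by case/andP: ck => /eqP-> /eqP->.
  exfalso; move: lk lt ck; rewrite -!val_eqE.
  case: (tpermP i j k) => [->|->|/eqP + /eqP +]; case: (tpermP i j l) => [->|->|/eqP + /eqP +];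
   rewrite -?val_eqE /= ?ej; lia.
by rewrite ki lj Aij (negPf nij).
Qed.

End Generation.

(** * The Weyl group sum and its translates by T *)
Section SteinbergVector.
Variables (K : finFieldType) (m : nat) (F : fieldType).
Notation n := m.+1.
Notation gT := {'GL_(n + n)[K]}.
Implicit Types (g h : gT).
Variable nw : coset_of (H K m) -> gT.
Hypothesis two : 2%:R != 0 :> K.
Hypothesis char2 : 2%N \in [pchar F].
Hypothesis lift : weyl_lift nw.

(* In the application V is the group algebra and b0 the sum of the elements
   of B; an abstract module keeps matrices of size |Sp| out of the
   computations. *)
Variables (V : lmodType F) (act : gT -> {linear V -> V}) (b0 : V).
Implicit Types (x y : V).
Hypothesis actM : {in Sp K m &, forall g h x, act (g * h)%g x = act g (act h x)}.
Hypothesis act1 : forall x, act 1%g x = x.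
Hypothesis act_b0 : forall b, b \in B K m -> act b b0 = b0.

Lemma char2_add x : x + x = 0.
Proof. by rewrite -mulr2n -scaler_nat (pcharf0 char2) scale0r. Qed.
Lemma char2_opp x : - x = x.
Proof. by apply/eqP; rewrite eq_sym -addr_eq0 char2_add. Qed.

Lemma odd_char2 k : odd k -> k%:R = 1 :> F.
Proof.
move=> ok; rewrite -(odd_double_half k) ok natrD -muln2 natrM (pcharf0 char2).
by rewrite mulr0 addr0.
Qed.

Lemma card_K : #|K|%:R = 1 :> F.
Proof.
apply: odd_char2; rewrite -[odd _]negbK -dvdn2 -cardsT; apply/negP.
move/(Cauchy (G := [set: K]%G) (isT : prime 2)) => [x _ x2].
have : (x ^+ 2)%g = 1%g by rewrite -x2 expg_order.
rewrite FinRing.zmodXgE => /eqP; rewrite -mulr_natr mulf_eq0 (negPf two) orbF.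
by move=> /eqP x0; move: x2; rewrite x0 order1.
Qed.

Lemma B_Sp : {subset B K m <= Sp K m}. Proof. by move=> g /BP[]. Qed.
Lemma H_sub_B : {subset H K m <= B K m}.
Proof. by move=> h Hh; rewrite -[h]mul1g mem_mulg // (@group1 _ (U_group K m)). Qed.
Lemma U_sub_B : {subset U K m <= B K m}.
Proof. by move=> h Hh; rewrite -[h]mulg1 mem_mulg // (@group1 _ (H_group K m)). Qed.

Lemma act_mulB g b : g \in Sp K m -> b \in B K m -> act (g * b)%g b0 = act g b0.
Proof. by move=> Sg Bb; rewrite actM ?(B_Sp Bb) // act_b0. Qed.

Lemma act_fix g (y : gT) : g \in Sp K m -> y \in Sp K m -> (g^-1 * y * g)%g \in B K m ->
  act y (act g b0) = act g b0.
Proof.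
move=> Sg Sy By; rewrite -actM // -(act_mulB Sg By).
by rewrite !mulgA mulgV mul1g.
Qed.

Lemma H_conj g h : g \in mono K m -> h \in H K m -> (g^-1 * h * g)%g \in H K m.
Proof.
move=> gm Hh; have gN := subsetP (mono_norm_H K m) g gm.
by rewrite -mulgA -conjgE (memJ_norm h gN).
Qed.

(** The element e, without its signs: F has characteristic 2. *)
Definition weyl_sum : V := \sum_(w in W K m) act (nw w) b0.
Notation e := weyl_sum.

Lemma W2S g : g \in W2 K m -> g \in Sp K m. Proof. exact: (subsetP (W2_Sp K m)). Qed.
Lemma W2N g : g \in W2 K m -> g \in 'N(H K m)%g.
Proof. by move/(subsetP (W2_mono K m)); apply: (subsetP (mono_norm_H K m)). Qed.
Lemma nw_W2 w : w \in W K m -> nw w \in W2 K m. Proof. by case/lift. Qed.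

Lemma nw_coset g : g \in W2 K m -> exists2 h, h \in H K m & nw (coset (H K m) g) = (g * h)%g.
Proof.
move=> Wg; have Ng := W2N Wg; have [_] := lift (mem_quotient (H K m) Wg).
rewrite (@val_coset _ (H_group K m)) // => /setP/(_ g).
rewrite rcoset_refl => /lcosetP[h Hh eg]; exists h^-1%g; first by rewrite groupV.
by rewrite [in RHS]eg mulgK.
Qed.

Lemma coset_nw w : w \in W K m -> coset (H K m) (nw w) = w.
Proof.
move=> Ww; have [Wn ew] := lift Ww; apply: val_inj => /=.
rewrite (@val_coset _ (H_group K m)) ?W2N // -ew.
by apply: (@norm_rlcoset _ (H_group K m)); apply: W2N.
Qed.

Lemma act_nw_coset g : g \in W2 K m -> act (nw (coset (H K m) g)) b0 = act g b0.
Proof.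
by move=> Wg; have [h Hh ->] := nw_coset Wg; rewrite act_mulB ?W2S ?H_sub_B.
Qed.

Lemma H_weyl_sum h : h \in H K m -> act h e = e.
Proof.
move=> Hh; rewrite /weyl_sum linear_sum; apply: eq_bigr => w /nw_W2 Ww.
apply: act_fix; [exact: W2S | exact: H_Sp | apply: H_sub_B].
by apply: H_conj => //; apply: (subsetP (W2_mono K m)).
Qed.

Definition T_sum := \sum_(t in T K m) act t e.

Definition Xsum (i j : 'I_n) x := \sum_(a : K) act (xroot i j a) x.

Lemma xroot_Sp i j a : i != j -> xroot i j a \in Sp K m.
Proof. by move=> nij; apply: levi_Sp; apply: xroot_mx_unit. Qed.
Lemma swap_Sp i j : swap K i j \in Sp K m.
Proof. by case: (perm_glP K (tperm i j)). Qed.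

Lemma XsumD i j x y : Xsum i j (x + y) = Xsum i j x + Xsum i j y.
Proof. by rewrite -big_split; apply: eq_bigr => a _; rewrite linearD. Qed.

(** With D the B-fixed vector moved by g, positivity makes D invariant under
    the root subgroup X and under H.  The sum of x (D + w D) over x in X is
    therefore q D + sum of x w D, where q = 1 in F; these q + 1 vectors are
    permuted by w, because w x w D = x' w D with x' in X for x nontrivial. *)
Lemma swap_rank_one i j g : i != j -> g \in mono K m -> pos i j g ->
  let y := act g b0 + act (swap K i j) (act g b0) in
  act (swap K i j) (Xsum i j y) = Xsum i j y.
Proof.
move=> nij gm pg; have [Sg _] := (monoP g).1 gm.
rewrite /=; set D := act g b0.
have xD a : act (xroot i j a) D = D by apply: act_fix => //; [apply: xroot_Sp | apply: pos_conj_B].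
have hD h : h \in H K m -> act h D = D.
  move=> Hh; apply: act_fix => //; [exact: H_Sp | apply: H_sub_B].
  exact: H_conj.
have Sw := swap_Sp i j; have Xx (a : K) := xroot_Sp a nij.
have ww x : act (swap K i j) (act (swap K i j) x) = x by rewrite -actM // swapK act1.
have XD : Xsum i j D = D.
  rewrite /Xsum (eq_bigr (fun _ => D)) => [|a _]; last exact: xD.
  by rewrite sumr_const -scaler_nat card_K scale1r.
pose D' := act (swap K i j) D.
have hw h : h \in H K m -> act h D' = D'.
  move=> Hh; have Hhw : ((swap K i j)^-1 * h * swap K i j)%g \in H K m.
    exact: H_conj (perm_mono K (tperm i j)) Hh.
  have Sh := H_Sp Hh; rewrite /D' -[in RHS](hD _ Hhw) -!actM ?Sp_mul ?Sp_inv //.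
  by rewrite !mulgA mulgV mul1g.
have XwD : Xsum i j D' = D' + \sum_(a | a != 0) act (xroot i j a) D'.
  by rewrite /Xsum (bigD1 0) //= xroot0 act1.
have wX : act (swap K i j) (\sum_(a | a != 0) act (xroot i j a) D')
    = \sum_(a | a != 0) act (xroot i j a) D'.
  rewrite linear_sum [RHS](reindex_inj invr_inj) /=.
  apply: eq_big => [a|a a0]; first by rewrite invr_eq0.
  have [h Hh E] := swap_xroot_swap nij a0.
  have Sh := H_Sp Hh.
  have -> : act (swap K i j) (act (xroot i j a) D')
      = act (swap K i j * xroot i j a * swap K i j)%g D by rewrite !actM ?Sp_mul.
  by rewrite E !actM ?Sp_mul // xD -/D' hw.
by rewrite XsumD XD -/D' XwD !linearD wX ww -/D' addrCA addrA.
Qed.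

Lemma mono_nw w : w \in W K m -> nw w \in mono K m.
Proof. by move/nw_W2/(subsetP (W2_mono K m)). Qed.

Lemma swap_W2 (i j : 'I_n) : j = i.+1 :> nat -> swap K i j \in W2 K m.
Proof.
move=> ej; have lt_im : (i < m)%N by rewrite -ltnS -ej.
have -> : swap K i j = w_ i.
  have ei : inord i = i := inord_val i.
  have ej' : inord i.+1 = j by rewrite -ej; apply: inord_val.
  by rewrite /w_ ei ej'.
by rewrite mem_gen // inE; apply/orP; left; apply/imsetP; exists (Ordinal lt_im).
Qed.

(** e is the sum of n_w b0 + w_i n_w b0 over the positive w. *)
Lemma swap_weyl_sum (i j : 'I_n) : j = i.+1 :> nat ->
  act (swap K i j) (Xsum i j e) = Xsum i j e.
Proof.
move=> ej; have nij : i != j by rewrite -val_eqE /= ej neq_ltn ltnSn.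
have Ww := swap_W2 ej; pose cw := coset (H K m) (swap K i j).
have Wcw : cw \in W K m by apply: mem_quotient.
have cwM w : w \in W K m -> (cw * w)%g = coset (H K m) (swap K i j * nw w)%g.
  by move=> Hw; rewrite coset_morphM ?W2N ?nw_W2 // coset_nw.
have posw w : w \in W K m -> pos i j (nw (cw * w)%g) = ~~ pos i j (nw w).
  move=> Hw; rewrite cwM //; have [|h Hh ->] := @nw_coset (swap K i j * nw w)%g.
    by rewrite groupM ?nw_W2.
  rewrite pos_H //; last by rewrite groupM ?perm_mono ?mono_nw.
  by rewrite pos_swap ?mono_nw.
have eE : e = \sum_(w in W K m | pos i j (nw w))
    (act (nw w) b0 + act (swap K i j) (act (nw w) b0)).
  rewrite /weyl_sum (bigID (fun w => pos i j (nw w))) /= [RHS]big_split /=; congr (_ + _).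
  rewrite (reindex_inj (mulgI cw)) /=; apply: eq_big => [w|w /andP[Hw _]].
    rewrite groupMl //; case Hw : (w \in W K m) => //=; by rewrite posw ?negbK.
  have Hw' : w \in W K m by rewrite groupMl in Hw.
  by rewrite cwM // act_nw_coset ?groupM ?nw_W2 // actM ?swap_Sp // W2S // nw_W2.
have XE : Xsum i j e = \sum_(w in W K m | pos i j (nw w))
    Xsum i j (act (nw w) b0 + act (swap K i j) (act (nw w) b0)).
  rewrite {1}eE /Xsum exchange_big /=; apply: eq_bigr => a _; exact: linear_sum.
rewrite XE linear_sum; apply: eq_bigr => w /andP[Hw pw].
by apply: swap_rank_one; rewrite ?mono_nw.
Qed.

Lemma swap_T_sum (i j : 'I_n) : j = i.+1 :> nat -> act (swap K i j) T_sum = T_sum.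
Proof.
move=> ej; have ij : (i < j)%N by rewrite ej.
have nij : i != j by rewrite -val_eqE /= ej neq_ltn ltnSn.
have T_sumE : T_sum = \sum_(t in Tij K i j) act t (Xsum i j e).
  rewrite /T_sum (sum_T_split _ ij); apply: eq_bigr => t; rewrite TijE => /andP[Tt _].
  by rewrite linear_sum; apply: eq_bigr => a _; rewrite actM ?(T_Sp Tt) ?xroot_Sp.
rewrite T_sumE linear_sum; pose c t := (swap K i j * t * swap K i j)%g.
have cK : involutive c.
  by move=> t; rewrite /c !mulgA swapK mul1g -mulgA swapK mulg1.
rewrite [RHS](reindex_inj (inv_inj cK)) /=.
apply: eq_big => [t | t]; last rewrite TijE => /andP[Tt _].
  by apply/idP/idP => /(Tij_conj ej) //; rewrite -/(c t) -/(c _) cK.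
have St := T_Sp Tt; have Sw := swap_Sp i j.
by rewrite /c !actM ?Sp_mul // swap_weyl_sum.
Qed.

(** T permutes the terms, H normalizes T and fixes e, and for a simple
    reflection the sum over T factors through the sum over one root subgroup,
    to which [swap_weyl_sum] applies. *)
Lemma SpMN_T_sum g : g \in SpMN K m -> act g T_sum = T_sum.
Proof.
case/SpMNP=> A uA ->; elim/GL_ind: A / uA => [A uA tA | A uA hA | i j ej | A D uA uD hA hD].
- have TA : levi A \in T K m by apply/TP; exists A.
  rewrite /T_sum linear_sum [RHS](reindex_inj (mulgI (levi A))) /=.
  apply: eq_big => [t|t Tt]; first by rewrite (@groupMl _ (T_group K m)).
  by rewrite actM ?(T_Sp TA) ?(T_Sp Tt).
- rewrite /T_sum linear_sum [RHS](reindex_inj (conjg_inj (levi A)^-1%g)) /=.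
  have NA : (levi A)^-1%g \in 'N(T K m)%g.
    by rewrite groupV (subsetP (H_norm_T K m)).
  apply: eq_big => [t|t Tt]; first by rewrite memJ_norm.
  have St := T_Sp Tt; have SA := H_Sp hA.
  rewrite conjgE invgK !actM ?Sp_mul ?Sp_inv //.
  by rewrite [act (levi A)^-1%g e]H_weyl_sum // groupV.
- by rewrite -swap_levi swap_T_sum.
by rewrite leviM // actM ?levi_Sp // hD.
Qed.
End SteinbergVector.

(** * Sums over pairs of opposite elements and additive characters *)
(** The ranks of x and i x select one element of each pair. *)
Lemma sum_involution_char2 (V : zmodType) (I : finType) (P : pred I)
    (f : I -> V) (i : I -> I) :
    (forall x : V, x + x = 0) -> involutive i ->
    (forall x, P (i x) = P x) -> (forall x, P x -> i x != x) ->
    (forall x, f (i x) = f x) ->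
  \sum_(x | P x) f x = 0.
Proof.
move=> dbl iK Pi ni fi.
rewrite (bigID (fun x => enum_rank x < enum_rank (i x))%N) /=.
rewrite [X in _ + X](reindex_inj (inv_inj iK)) /=.
rewrite [X in _ + X](eq_bigl (fun x => P x && (enum_rank x < enum_rank (i x))%N)).
  by rewrite [X in _ + X](eq_bigr f) ?dbl // => x _; rewrite fi.
move=> x; rewrite Pi iK -leqNgt; case Px: (P x) => //=.
rewrite leq_eqVlt; case: eqVneq => // /val_inj/enum_rank_inj e.
by have := ni x Px; rewrite -e eqxx.
Qed.

Lemma opp_neq (K : fieldType) (V : lmodType K) (v : V) :
  2%:R != 0 :> K -> v != 0 -> - v != v.
Proof.
move=> two v0.
by rewrite eq_sym -addr_eq0 -mulr2n -scaler_nat scaler_eq0 negb_or two.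
Qed.

Lemma pm_transversalN (K : finFieldType) (Tq : {set K}) :
  2%:R != 0 :> K -> pm_transversal Tq ->
  forall a, a != 0 -> (- a \in Tq) = (a \notin Tq).
Proof.
move=> two /and3P[_ _ /forall_inP T1].
have nN (a : K) : a != 0 -> - a != a := @opp_neq K K^o a two.
move=> a a0; have /T1/cards1P[b Tb] : [set a; - a] \in [set [set a; - a] | a in [set~ 0]].
  by apply/imsetP; exists a; rewrite ?inE.
have mem c : (c \in Tq) && ((c == a) || (c == - a)) = (c == b).
  by have /setP/(_ c) := Tb; rewrite !inE.
have := mem a; have := mem (- a); rewrite !eqxx orbT !andbT => -> ->.
have := mem b; rewrite eqxx => /andP[_ /orP[/eqP->|/eqP->]]; rewrite eqxx.
  by rewrite (negPf (nN _ a0)).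
by rewrite eq_sym nN.
Qed.

Lemma sum_pm_transversal (K : finFieldType) (V : zmodType) (Tq : {set K}) (f : K -> V) :
  2%:R != 0 :> K -> pm_transversal Tq ->
  \sum_(a | a != 0) f a = \sum_(a in Tq) (f a + f (- a)).
Proof.
move=> two TqP.
have TN := pm_transversalN two TqP; case/and3P: TqP => _ /subsetP T0 _.
rewrite big_split /= (bigID (mem Tq)) /=; congr (_ + _).
  apply: eq_bigl => a; case Ta: (a \in Tq); rewrite ?andbF // andbT.
  by have := T0 a Ta; rewrite !inE.
rewrite (reindex_inj oppr_inj) /=; apply: eq_bigl => a; rewrite oppr_eq0.
have [->|a0] := eqVneq a 0; last by rewrite TN // negbK.
by apply/esym/negbTE/negP => /T0; rewrite !inE eqxx.
Qed.

Section Characters.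
Variables (K : finFieldType) (F : fieldType) (lam : K -> F).
Hypothesis lam_char : additive_char lam.
Hypothesis lam_nontriv : exists a, lam a != 1.

Lemma lam0 : lam 0 = 1. Proof. by case: lam_char. Qed.
Lemma lamD a b : lam (a + b) = lam a * lam b. Proof. by case: lam_char. Qed.
Lemma lam_neq0 a : lam a != 0.
Proof.
apply/eqP=> a0; have := lamD a (- a); rewrite subrr lam0 a0 mul0r => /eqP.
by rewrite oner_eq0.
Qed.
Lemma lamN a : lam (- a) = (lam a)^-1.
Proof.
by apply: (mulfI (lam_neq0 a)); rewrite -lamD subrr lam0 mulfV ?lam_neq0.
Qed.

Lemma lam_nontrivZ k : k != 0 -> exists b, lam (k * b) != 1.
Proof.
by case: lam_nontriv => a la k0; exists (k^-1 * a); rewrite mulrA mulfV // mul1r.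
Qed.

Lemma sum_lam k : k != 0 -> \sum_(b : K) lam (k * b) = 0.
Proof.
move=> k0; have [c lc] := lam_nontrivZ k0; set s := LHS.
have : lam (k * c) * s = s.
  rewrite /s mulr_sumr [RHS](reindex_inj (addrI c)) /=.
  by apply: eq_bigr => b _; rewrite mulrDr lamD.
move/eqP; rewrite -subr_eq0 -{2}[s]mul1r -mulrBl mulf_eq0 subr_eq0 (negPf lc).
by move/eqP.
Qed.
End Characters.

(** * Weight vectors of Sp^M and the action of c_n *)
(** Transitivity of GL_n on nonzero vectors.  The last clause lets D be chosen
    in GL_{n-1} when the last coordinate of x vanishes, so that the
    corresponding element of Sp_{M,N} commutes with c_n. *)
Lemma exists_unitmx_basis (K : fieldType) n (x : 'cV[K]_n) (j : 'I_n) : x != 0 ->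
  exists D : 'M[K]_n, [/\ D \in unitmx, D *m (delta_mx j 0 : 'cV_n) = x
    & forall k, k != j -> x k 0 = 0 ->
        D *m (delta_mx k 0 : 'cV_n) = delta_mx k 0
        /\ D^T *m (delta_mx k 0 : 'cV_n) = delta_mx k 0].
Proof.
pose dl k : 'cV[K]_n := delta_mx k 0.
have rank1 (z : 'cV[K]_n) i k c : (1%:M + z *m (c *: (dl i)^T)) *m dl k
    = dl k + (c *+ (i == k)) *: z.
  rewrite mulmxDl mul1mx -scalemxAr -scalemxAl -mulmxA trmx_delta.
  rewrite mul_delta_mx_cond; case: eqP => _; last by rewrite !mulr0n mulmx0 scaler0 scale0r.
  by rewrite mulr1n [delta_mx 0 0](_ : _ = 1%:M) ?mulmx1 //; apply/matrixP=> a b; rewrite !mxE !ord1.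
have rank1T (z : 'cV[K]_n) i k c : (1%:M + z *m (c *: (dl i)^T))^T *m dl k
    = dl k + (c * z k 0) *: dl i.
  rewrite raddfD /= trmx1 trmx_mul linearZ /= trmxK mulmxDl mul1mx -scalemxAl -scalemxAl -mulmxA.
  rewrite -colE -scalerA; congr (_ + _ *: _).
  by apply/colP=> a; rewrite !mxE big_ord1 !mxE mulrC.
have main (y : 'cV[K]_n) : y j 0 != 0 -> exists D : 'M[K]_n, [/\ D \in unitmx, D *m dl j = y
    & forall k, k != j -> y k 0 = 0 -> D *m dl k = dl k /\ D^T *m dl k = dl k].
  move=> yj; exists (1%:M + (y - dl j) *m (1 *: (dl j)^T)); split.
  - apply: unitmx_rank1; rewrite scale1r trmx_delta -rowE !mxE !eqxx.
    by rewrite addrCA subrr addr0.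
  - by rewrite rank1 eqxx mulr1n scale1r addrC subrK.
  move=> k nkj yk; rewrite rank1 rank1T eq_sym (negPf nkj) mulr0n scale0r addr0.
  by split=> //; rewrite !mxE yk (negPf nkj) subrr mulr0 scale0r addr0.
move=> x0; have [xj|] := eqVneq (x j 0) 0; last exact: main.
have /existsP[i xi] : [exists i, x i 0 != 0].
  by apply: contraNT x0 => /existsPn h; apply/eqP/colP=> i; rewrite mxE; apply/eqP/negPn/h.
have nij : i != j by apply: contraNneq xi => ->; rewrite xj.
have [|D [uD Dj Dk]] := main (x + dl j).
  by rewrite !mxE xj !eqxx add0r oner_neq0.
(* x has a zero at j: first reach x + e_j, then remove e_j by a transvection. *)
exists ((1%:M + dl j *m ((- (x i 0)^-1) *: (dl i)^T)) *m D); split.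
- rewrite unitmx_mul uD andbT; apply: unitmx_rank1.
  by rewrite -scalemxAl trmx_delta -rowE !mxE (negPf nij) mulr0 addr0 oner_neq0.
- rewrite -mulmxA Dj mulmxDl mul1mx -mulmxA -scalemxAl trmx_delta -rowE.
  have -> : row i (x + dl j) = (x i 0)%:M.
    by apply/matrixP=> a b; rewrite !ord1 !mxE (negPf nij) addr0 mulr1n.
  rewrite scale_scalar_mx mulNr mulVf // mul_mx_scalar scaleN1r.
  by rewrite addrK.
move=> k nkj xk; have [|Dk1 Dk2] := Dk k nkj.
  by rewrite !mxE xk (negPf nkj) addr0.
have nki : k != i by apply: contraNneq xi => <-; rewrite xk.
rewrite -mulmxA Dk1 rank1 eq_sym (negPf nki) mulr0n scale0r addr0; split=> //.
by rewrite trmx_mul -mulmxA rank1T mxE (negPf nkj) mulr0 scale0r addr0.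
Qed.

Section WeightVectors.
Variables (K : finFieldType) (m : nat) (F : fieldType).
Notation n := m.+1.
Notation gT := {'GL_(n + n)[K]}.
Notation "'vn'" := (v_ ord_max : 'cV[K]_(n + n)).
Implicit Types (g h s : gT) (v w : 'cV[K]_(n + n)).
Variables (V : lmodType F) (act : gT -> {linear V -> V}) (f : V).
Hypothesis two : 2%:R != 0 :> K.
Hypothesis char2 : 2%N \in [pchar F].
Hypothesis actM : {in Sp K m &, forall g h x, act (g * h)%g x = act g (act h x)}.
Hypothesis act1 : forall x, act 1%g x = x.
Hypothesis f_fix : forall a, a \in SpMN K m -> act a f = f.
Variable lam : K -> F.
Hypothesis lam_char : additive_char lam.
Hypothesis lam_nontriv : exists a, lam a != 1.

Notation chi := (chi lam).

Lemma chi_unipE (S : 'M[K]_n) (x : 'cV[K]_n) :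
  chi (nv x) (unip S) = lam (((S *m x)^T *m x) 0 0).
Proof. by rewrite /Defs.chi gact_unip_nv form_col mulmx0 [X in _ - X]mxE subr0. Qed.

Lemma chi_neq0 v g : chi v g != 0. Proof. exact: lam_neq0. Qed.

Lemma chiM v : v \in N K m -> {in SpM K m &, {morph chi v : s h / (s * h)%g >-> s * h}}.
Proof.
move=> /nv_dsub <- _ _ /SpMP[S _ ->] /SpMP[S' _ ->]; rewrite -unipD !chi_unipE -lamD //.
by rewrite mulmxDl raddfD /= mulmxDl mxE.
Qed.

Lemma chi_conj v s (a : gT) : a \in Sp K m -> chi v (a^-1 * s * a)%g = chi (gact a v) s.
Proof.
move=> /SpP Sa; rewrite /Defs.chi -[form _ v]Sa !gactM gactKV.
by [].
Qed.

(** Up to the factor |Sp^M|, which is 1 in F, the projection of f to the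
    weight space of chi_v.  In the application f is the sum of the t e over T. *)
Definition weight_vec v : V := \sum_(s in SpM K m) (chi v s)^-1 *: act s f.

Lemma SpMN_N (a : gT) v : a \in SpMN K m -> v \in N K m -> gact a v \in N K m.
Proof. by move=> /SpMNP[A uA ->] /nv_dsub <-; rewrite gact_levi_nv // nvN. Qed.

Lemma vn_N i : v_ i \in N K m. Proof. by rewrite memN col_mxKu. Qed.

Lemma act_SpM_weight_vec s v : s \in SpM K m -> v \in N K m -> act s (weight_vec v) = chi v s *: weight_vec v.
Proof.
move=> Ms Nv; have Ss := SpM_Sp Ms.
rewrite /weight_vec linear_sum scaler_sumr [RHS](reindex_inj (mulgI s)) /=.
apply: eq_big => [h|h Mh]; first by rewrite (@groupMl _ (SpM_group K m)).
have Sh := SpM_Sp Mh.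
rewrite linearZ /= -actM // scalerA chiM // invfM mulrA mulfV ?chi_neq0 // mul1r.
by [].
Qed.

Lemma SpMN_V (a : gT) : a \in SpMN K m -> a^-1%g \in SpMN K m.
Proof. by move=> /SpMNP[A uA ->]; rewrite leviV // levi_SpMN ?unitmx_inv. Qed.

Lemma act_SpMN_weight_vec (a : gT) v : a \in SpMN K m -> act a (weight_vec v) = weight_vec (gact a v).
Proof.
move=> Ma; have Sa := SpMN_Sp Ma.
rewrite /weight_vec linear_sum [RHS](reindex_inj (conjg_inj a^-1%g)) /=.
have Na : a^-1%g \in 'N(SpM K m)%g.
  by apply: (subsetP (SpMN_norm_SpM K m)); apply: SpMN_V.
apply: eq_big => [s|s Ms]; first by rewrite (memJ_norm s Na).
have Ss := SpM_Sp Ms; rewrite linearZ /= -chi_conj //.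
have -> : (a^-1 * s ^ a^-1 * a)%g = s by rewrite conjgE invgK !mulgA mulgKV mulVg mul1g.
congr (_ *: _); rewrite conjgE invgK !actM ?Sp_mul ?Sp_inv // [act a^-1%g f]f_fix //.
exact: SpMN_V.
Qed.

Lemma weight_vecN v : weight_vec (- v) = weight_vec v.
Proof.
apply: eq_bigr => s _; congr (_^-1 *: _).
by rewrite /Defs.chi gactN formNl formNr opprK.
Qed.

Lemma weight_vec0 : weight_vec 0 = \sum_(s in SpM K m) act s f.
Proof.
apply: eq_bigr => s _.
by rewrite /Defs.chi gact0 -[0](scale0r 0) formZl mul0r lam0 // invr1 scale1r.
Qed.

(** The terms at b and -b cancel, which leaves b = 0. *)
Lemma sum_weight_vec_line v : \sum_(b : K) weight_vec (b *: v) = weight_vec 0.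
Proof.
rewrite (bigD1 0) //= scale0r (sum_involution_char2 (i := fun b => - b)) ?addr0 //.
- exact: (char2_add char2).
- exact: opprK.
- by move=> b; rewrite oppr_eq0.
- by move=> b; apply: (@opp_neq K K^o).
by move=> b; rewrite scaleNr weight_vecN.
Qed.

Notation c := (c_ ord_max : gT).

Lemma gact_c z : gact c z = z + form z vn *: (vn - u_ ord_max)
                              + form z (u_ ord_max) *: (vn + u_ ord_max).
Proof.
have [_ cu cv cf] := c_P K (ord_max : 'I_n).
move: z; apply: basis_ext => [a x y|a x y|i|i].
- by rewrite gactD gactZ.
- rewrite !(formDl, formZl) 2!scalerDl 2!(scalerDr a) -!scalerA.
  by rewrite [X in X + _ = _]addrACA [LHS]addrACA.
- have [->|ni] := eqVneq i ord_max.
    rewrite cu form_uv form_uu eqxx scale1r scale0r addr0.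
    by rewrite addrCA subrr addr0.
  by rewrite (cf i ni).1 form_uv form_uu (negPf ni) !scale0r !addr0.
have [->|ni] := eqVneq i ord_max.
  rewrite cv form_vv form_sym form_uv eqxx scale0r addr0 scaleN1r.
  by rewrite opprD addrA subrr add0r.
by rewrite (cf i ni).2 form_vv form_sym form_uv eq_sym (negPf ni) oppr0 !scale0r !addr0.
Qed.

Lemma c_commute g : g \in Sp K m -> gact g vn = vn ->
  gact g (u_ ord_max) = u_ ord_max -> (c * g = g * c)%g.
Proof.
move=> /SpP Sg gv gu; apply: gl_ext => i; rewrite !gactM !gact_c;
rewrite !(gactD, gactZ, gactN) gv gu; do !congr (_ + _ *: _);
by rewrite -[RHS]Sg ?gv ?gu.
Qed.

Lemma xroot_SpMN (i j : 'I_n) t : i != j -> xroot i j t \in SpMN K m.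
Proof. by move=> nij; apply: levi_SpMN; apply: xroot_mx_unit. Qed.

Definition coordn v : K := v (rshift n ord_max) 0.

(** [htor a] is the element of H that multiplies v_n by a and u_n by 1/a; as
    its block on M is inverse to that on N, it is built from [htor_mx a^-1]. *)
Definition htor_mx (a : K) : 'M[K]_n := 1%:M + (a - 1) *: delta_mx ord_max ord_max.

Lemma htor_mxM (a b : K) : htor_mx a *m htor_mx b = htor_mx (a * b).
Proof.
rewrite /htor_mx mulmxDl !mulmxDr !mulmx1 mul1mx -scalemxAl -scalemxAr mul_delta_mx.
rewrite scalerA -addrA -!scalerDl; congr (_ + _ *: _); ring.
Qed.
Lemma htor_mx1 : htor_mx 1 = 1%:M. Proof. by rewrite /htor_mx subrr scale0r addr0. Qed.
Lemma htor_mx_unit (a : K) : a != 0 -> htor_mx a \in unitmx.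
Proof.
by move=> a0; have [] := @mulmx1_unit _ _ (htor_mx a) (htor_mx a^-1); rewrite ?htor_mxM ?mulfV ?htor_mx1.
Qed.
Lemma htor_mxV (a : K) : a != 0 -> invmx (htor_mx a) = htor_mx a^-1.
Proof.
move=> a0; apply: (can_inj (mulKmx (htor_mx_unit a0))).
by rewrite mulmxV ?htor_mx_unit // htor_mxM mulfV // htor_mx1.
Qed.
Lemma htor_mx_bv (a : K) k : htor_mx a *m (delta_mx k 0 : 'cV_n)
  = (if k == ord_max then a else 1) *: (delta_mx k 0 : 'cV_n).
Proof.
rewrite mulmxDl mul1mx -scalemxAl mul_delta_mx_cond eq_sym.
case: eqP => [->|_]; last by rewrite mulr0n scaler0 addr0 scale1r.
by rewrite mulr1n -{1}[delta_mx _ _]scale1r -scalerDl addrCA subrr addr0.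
Qed.
Definition htor (a : K) : gT := levi (htor_mx a^-1%R).
Lemma htor_SpMN (a : K) : a != 0 -> htor a \in SpMN K m.
Proof. by move=> a0; apply: levi_SpMN; rewrite htor_mx_unit ?invr_eq0. Qed.
Lemma htor_u (a : K) k : a != 0 ->
  gact (htor a) (u_ k) = (if k == ord_max then a^-1 else 1) *: u_ k.
Proof.
move=> a0; rewrite gact_levi_mv ?htor_mx_unit ?invr_eq0 // htor_mx_bv.
by rewrite /mv /u_ scale_col_mx scaler0.
Qed.
Lemma htor_v (a : K) k : a != 0 ->
  gact (htor a) (v_ k) = (if k == ord_max then a else 1) *: v_ k.
Proof.
move=> a0; rewrite gact_levi_nv ?htor_mx_unit ?invr_eq0 // htor_mxV ?invr_eq0 // invrK.
rewrite /htor_mx raddfD /= trmx1 linearZ /= trmx_delta -/(htor_mx a) htor_mx_bv.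
by rewrite /nv /v_ scale_col_mx scaler0.
Qed.

Lemma c_htor (a : K) : a != 0 -> (c * htor a = htor a^-1%R * c)%g.
Proof.
move=> a0; have a0' : a^-1 != 0 by rewrite invr_eq0.
have [_ cu cv cf] := c_P K (ord_max : 'I_n).
apply: gl_ext => i; rewrite !gactM ?htor_u ?htor_v // gactZ.
  have [->|ni] := eqVneq i ord_max; first by rewrite cu htor_v // eqxx.
  by rewrite (cf i ni).1 htor_u // (negPf ni).
have [->|ni] := eqVneq i ord_max.
  by rewrite cv gactN htor_u // eqxx invrK scalerN.
by rewrite (cf i ni).2 htor_v // (negPf ni).
Qed.

Lemma cc_htor : (c * c)%g = htor (-1).
Proof.
have [_ cu cv cf] := c_P K (ord_max : 'I_n).
have n1 : -1 != 0 :> K by rewrite oppr_eq0 oner_neq0.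
apply: gl_ext => i; rewrite !gactM ?htor_u ?htor_v //.
  have [->|ni] := eqVneq i ord_max; first by rewrite cu cv invrN1 scaleN1r.
  by rewrite !(cf i ni).1 scale1r.
have [->|ni] := eqVneq i ord_max; first by rewrite cv gactN cu scaleN1r.
by rewrite !(cf i ni).2 scale1r.
Qed.

(** Conjugation by c_n moves this root subgroup of Sp_{M,N} into Sp^M.  It
    reduces [act_c_weight_vec] to vectors v whose coordinate at v_n is 0. *)
Lemma c_xroot (i : 'I_n) t : i != ord_max ->
  (c * xroot i ord_max t = unip (t *: (delta_mx ord_max i + delta_mx i ord_max)) * c)%g.
Proof.
move=> ni; have [_ cu cv cf] := c_P K (ord_max : 'I_n).
have sgv (S : 'M[K]_n) j : gact (unip S) (v_ j) = v_ j + mv (col j S).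
  by rewrite [LHS]gact_unip_nv /v_ /mv add_col_mx addr0 add0r colE.
have sgu (S : 'M[K]_n) j : gact (unip S) (u_ j) = u_ j by rewrite [LHS]gact_unip_mv.
have colS j : mv (col j (t *: (delta_mx ord_max i + delta_mx i ord_max)))
    = (t *+ (i == j)) *: u_ ord_max + (t *+ (ord_max == j)) *: u_ i :> 'cV[K]_(n + n).
  rewrite colE -scalemxAl mulmxDl !mul_delta_mx_cond /mv /u_ !scale_col_mx add_col_mx.
  by rewrite !scaler0 addr0 scalerDr -!scalerMnr !scalerMnl.
apply: gl_ext => j; rewrite !gactM.
  rewrite -bv_lshift xroot_bv // bv_lshift eq_lshift eq_lrshift mulr0n scale0r subr0 gactD gactZ bv_lshift.
  rewrite (cf i ni).1; have [->|nj] := eqVneq j ord_max.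
    by rewrite cu sgv colS eqxx (negPf ni) mulr0n scale0r add0r.
  by rewrite mulr0n scale0r addr0 (cf j nj).1 sgu.
rewrite -bv_rshift xroot_bv // bv_rshift eq_rlshift mulr0n scale0r addr0 gactD gactN gactZ bv_rshift.
rewrite eq_rshift cv; have [->|nj] := eqVneq j ord_max.
  by rewrite eq_sym (negPf ni) mulr0n scale0r subr0 cv gactN sgu.
by rewrite (cf j nj).2 sgv colS [ord_max == j]eq_sym (negPf nj) mulr0n scale0r addr0
  [i == j]eq_sym scalerN opprK.
Qed.

Variable Tq : {set K}.
Hypothesis TqP : pm_transversal Tq.
Hypothesis hyp1 : act c (weight_vec vn)
  = weight_vec 0 + \sum_(a in Tq) (lam (- (2 * a)) + lam (2 * a)) *: weight_vec (a *: vn).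
Hypothesis hyp2 : (0 < m)%N -> act (c_ ord_pen) (weight_vec vn)
  = \sum_(a : K) act (w_ m.-1 * x_ (- a) * w_ m.-1)%g (weight_vec vn).

Lemma c_Sp : c \in Sp K m. Proof. by case: (c_P K (ord_max : 'I_n)). Qed.

Lemma act_c_vn : act c (weight_vec vn) = \sum_(b : K) lam (- (2 * b)) *: weight_vec (b *: vn).
Proof.
rewrite hyp1 [RHS](bigD1 0) //= mulr0 oppr0 lam0 // scale1r scale0r; congr (_ + _).
rewrite (sum_pm_transversal _ two TqP); apply: eq_bigr => a _.
by rewrite scaleNr weight_vecN mulrN opprK scalerDl.
Qed.

Lemma act_c_Zvn (a : K) : a != 0 ->
  act c (weight_vec (a *: vn)) = \sum_(b : K) lam (- (2 * (a * b))) *: weight_vec (b *: vn).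
Proof.
move=> a0; have a0' : a^-1 != 0 by rewrite invr_eq0.
have -> : a *: vn = gact (htor a) vn by rewrite htor_v // eqxx.
have Sh := SpMN_Sp (htor_SpMN a0); have Sh' := SpMN_Sp (htor_SpMN a0').
rewrite -act_SpMN_weight_vec ?htor_SpMN // -actM ?c_Sp // c_htor // actM ?c_Sp // act_c_vn.
rewrite linear_sum [RHS](reindex_inj (mulfI a0')) /=; apply: eq_bigr => b _.
rewrite linearZ /= act_SpMN_weight_vec ?htor_SpMN // gactZ htor_v // eqxx scalerA mulVKf //.
by rewrite [b * _]mulrC.
Qed.

(** Apply c_n to both sides of [act_c_vn].  The left side becomes the vector at
    -v_n, which is the vector at v_n; on the right all terms but the image of
    the vector at 0 are known, and they are summed by orthogonality of
    characters. *)
Lemma act_c_0 : act c (weight_vec 0) = weight_vec 0.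
Proof.
have n1 : -1 != 0 :> K by rewrite oppr_eq0 oner_neq0.
have cc : act c (act c (weight_vec vn)) = weight_vec vn.
  by rewrite -actM ?c_Sp // cc_htor act_SpMN_weight_vec ?htor_SpMN // htor_v // eqxx scaleN1r weight_vecN.
have dbl := char2_add char2.
pose k d : F := \sum_(b | b != 0) lam (- (2 * b)) * lam (- (2 * (b * d))).
have : act c (act c (weight_vec vn)) = act c (weight_vec 0) + \sum_d k d *: weight_vec (d *: vn).
  rewrite {1}act_c_vn linear_sum (bigD1 0) //= mulr0 oppr0 lam0 // scale1r scale0r.
  congr (_ + _); rewrite (eq_bigr (fun b => \sum_d (lam (- (2 * b)) * lam (- (2 * (b * d)))) *: weight_vec (d *: vn))).
    by rewrite exchange_big /=; apply: eq_bigr => d _; rewrite scaler_suml.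
  move=> b b0; rewrite linearZ /= act_c_Zvn // scaler_sumr.
  by apply: eq_bigr => d _; rewrite scalerA.
have kE d : k d = (d != -1)%:R.
  have kE' : k d = 1 + \sum_b lam ((- (2 * (1 + d))) * b).
    rewrite [in RHS](bigD1 0) //= mulr0 lam0 // addrA -mulr2n (pcharf0 char2) add0r.
    apply: eq_bigr => b _; rewrite -lamD //; congr lam; ring.
  rewrite kE'; have [->|nd] := eqVneq d (-1).
    rewrite subrr mulr0 oppr0 (eq_bigr (fun _ => 1)) => [|b _]; last by rewrite mul0r lam0.
    by rewrite sumr_const card_K // -mulr2n (pcharf0 char2).
  by rewrite sum_lam // ?addr0 // oppr_eq0 mulf_neq0 // addrC addr_eq0.
rewrite cc => h; have : act c (weight_vec 0) = weight_vec vn + \sum_d k d *: weight_vec (d *: vn).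
  by rewrite {1}h -addrA dbl addr0.
rewrite (bigD1 (-1)) //= kE eqxx scale0r add0r => ->.
rewrite -(sum_weight_vec_line vn) [RHS](bigD1 (-1)) //= scaleN1r weight_vecN; congr (_ + _).
by apply: eq_bigr => d nd; rewrite kE nd scale1r.
Qed.

Lemma x_xroot (a : K) : (0 < m)%N -> x_ a = xroot ord_pen (ord_max : 'I_n) a.
Proof.
move=> m0; have [_ xu xv xuf xvf] := x_P a m0.
have np : ord_pen != ord_max :> 'I_n.
  by rewrite -val_eqE /= inordK ?ltnS ?leq_pred // ltn_eqF // ltn_predL.
apply: gl_ext => i.
  rewrite -bv_lshift xroot_bv // bv_lshift eq_lshift eq_lrshift mulr0n scale0r subr0.
  have [->|ni] := eqVneq i ord_max; first by rewrite bv_lshift xu.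
  by rewrite mulr0n scale0r addr0 xuf.
rewrite -bv_rshift xroot_bv // bv_rshift eq_rlshift eq_rshift mulr0n scale0r addr0.
have [->|ni] := eqVneq i ord_pen; first by rewrite bv_rshift xv.
by rewrite mulr0n scale0r subr0 xvf.
Qed.

Lemma w_swap : (0 < m)%N -> w_ m.-1 = swap K ord_pen (ord_max : 'I_n).
Proof.
move=> m0; rewrite /w_ /swap prednK //; congr (perm_gl K (tperm _ _)).
by apply: val_inj; rewrite /= inordK.
Qed.

Lemma xroot_nv (i j : 'I_n) t (x : 'cV[K]_n) : i != j ->
  gact (xroot i j t) (nv x) = nv x - (t * x i 0) *: v_ j.
Proof.
move=> nij; rewrite {1}nvE gact_sum.
rewrite (eq_bigr (fun k => x k 0 *: v_ k - (x k 0 * (t *+ (k == i))) *: v_ j)).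
  rewrite sumrB -nvE (bigD1 i) //= big1 ?addr0; first by rewrite eqxx mulrC.
  by move=> k /negPf->; rewrite mulr0n mulr0 scale0r.
move=> k _; rewrite gactZ -bv_rshift xroot_bv // bv_rshift eq_rlshift eq_rshift mulr0n scale0r.
by rewrite addr0 bv_rshift scalerBr scalerA.
Qed.

(** The second identity, conjugated by the permutation exchanging n-1 and n. *)
Lemma act_c_vpen : (0 < m)%N ->
  act c (weight_vec (v_ ord_pen)) = \sum_(b : K) weight_vec (v_ ord_pen + b *: vn).
Proof.
move=> m0; pose p := swap K ord_pen (ord_max : 'I_n).
have np : ord_pen != ord_max :> 'I_n.
  by rewrite -val_eqE /= inordK ?ltnS ?leq_pred // ltn_eqF // ltn_predL.
have [Sp _ pv] := perm_glP K (tperm ord_pen (ord_max : 'I_n)).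
have Mp : p \in SpMN K m := perm_SpMN K _.
have pn : gact p vn = v_ ord_pen by rewrite pv tpermR.
have pp : gact p (v_ ord_pen) = vn by rewrite pv tpermL.
have := hyp2 m0; rewrite c_conj -/(swap K ord_pen ord_max) -/p w_swap // -/p.
rewrite actM ?Sp_mul ?c_Sp // actM ?c_Sp // act_SpMN_weight_vec // pn => /(congr1 (act p)).
rewrite -actM // /p swapK act1 -/p => ->; rewrite linear_sum.
apply: eq_bigr => b _; rewrite x_xroot // -actM //; last first.
  by rewrite !Sp_mul //; apply: SpMN_Sp; apply: xroot_SpMN.
have -> : (p * (p * xroot ord_pen ord_max (- b) * p) = xroot ord_pen ord_max (- b) * p)%g.
  by rewrite !mulgA /p swapK mul1g.
have Mx := xroot_SpMN (- b) np.
rewrite actM ?(SpMN_Sp Mx) // !act_SpMN_weight_vec // pn /v_ -/(nv _) xroot_nv // mxE !eqxx.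
by rewrite mulr1 scaleNr opprK.
Qed.

Lemma quad_sym (t : K) (i j : 'I_n) (y : 'cV[K]_n) :
  (((t *: (delta_mx i j + delta_mx j i)) *m y)^T *m y) 0 0
  = t * (2 * (y i 0 * y j 0)).
Proof.
have dmul k l : (delta_mx k l : 'M[K]_n) *m y = y l 0 *: delta_mx k 0.
  rewrite -(mul_delta_mx (0 : 'I_1)) -mulmxA -rowE.
  have -> : row l y = (y l 0)%:M by apply/matrixP=> q r; rewrite !ord1 !mxE mulr1n.
  by rewrite mul_mx_scalar.
have -> : (t *: (delta_mx i j + delta_mx j i)) *m y
    = t *: (y j 0 *: delta_mx i 0 + y i 0 *: delta_mx j 0).
  by rewrite -scalemxAl mulmxDl !dmul.
rewrite linearZ /= raddfD /= !linearZ /= !trmx_delta -scalemxAl mulmxDl -!scalemxAl -!rowE.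
rewrite !mxE; ring.
Qed.

Lemma coordn_nv (x : 'cV[K]_n) : coordn (nv x) = x ord_max 0.
Proof. by rewrite /coordn col_mxEd. Qed.

(** Some element of Sp_{M,N} fixes u_n and v_n, hence commutes with c_n, and
    moves v_{n-1} to w. *)
Lemma act_c_coord0 w : w \in N K m -> w != 0 -> coordn w = 0 ->
  act c (weight_vec w) = \sum_(b : K) weight_vec (w + b *: vn).
Proof.
move=> /nv_dsub <-; set x := dsubmx w; rewrite coordn_nv => w0 xn.
have x0 : x != 0 by apply: contraNneq w0 => ->; rewrite /nv col_mx0 eqxx.
have m0 : (0 < m)%N.
  rewrite lt0n; apply: contraNneq x0 => m0; apply/eqP/colP=> i; rewrite [RHS]mxE.
  have -> : i = ord_max; last exact: xn.
  by apply: val_inj => /=; have := ltn_ord i; lia.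
have [D [uD Dp Dk]] := exists_unitmx_basis ord_pen x0.
have np : ord_max != ord_pen :> 'I_n.
  by rewrite eq_sym -val_eqE /= inordK ?ltnS ?leq_pred // ltn_eqF // ltn_predL.
have [Dn Dtn] := Dk _ np xn.
pose g := levi (invmx D)^T; have uA : (invmx D)^T \in unitmx by rewrite unitmx_tr unitmx_inv.
have Mg : g \in SpMN K m := levi_SpMN uA.
have gnv y : gact g (nv y) = nv (D *m y).
  by rewrite gact_levi_nv // -trmx_inv invmxK trmxK.
have gp : gact g (v_ ord_pen) = nv x by rewrite [LHS]gnv Dp.
have gn : gact g vn = vn by rewrite [LHS]gnv Dn.
have gu : gact g (u_ ord_max) = u_ ord_max.
  rewrite [LHS]gact_levi_mv // /u_ /mv; congr col_mx.
  rewrite -{1}Dtn mulmxA -trmx_mul mulmxV // trmx1 mul1mx.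
  by [].
have Sg := SpMN_Sp Mg.
rewrite -gp -act_SpMN_weight_vec // -actM ?c_Sp // c_commute // actM ?c_Sp //.
rewrite act_c_vpen // linear_sum; apply: eq_bigr => b _.
by rewrite act_SpMN_weight_vec // gactD gactZ gn.
Qed.

(** Write v = w + x v_n with w free of v_n.  For w = 0 this is
    [act_c_0] or [act_c_Zvn].  Otherwise a root element takes w to v, and
    passing it through c_n turns it into an element of Sp^M, whose weights on
    the vectors w + b v_n are the factors lambda(-2xb). *)
Lemma act_c_weight_vec v : v \in N K m -> act c (weight_vec v)
  = \sum_(b : K) lam (- (2 * (coordn v * b))) *: weight_vec (v + (b - coordn v) *: vn).
Proof.
move=> Nv; set a := coordn v; pose w := v - a *: vn.
have vE : v = w + a *: vn by rewrite subrK.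
have Nw : w \in N K m by rewrite rpredB ?rpredZ // vn_N.
have cw : coordn w = 0.
  have cvn : coordn vn = 1 by rewrite [LHS]coordn_nv mxE !eqxx.
  by rewrite /coordn; do 3!rewrite mxE; rewrite -/(coordn v) -/(coordn vn) cvn mulr1 subrr.
have [w0|w0] := eqVneq w 0.
  have -> : v = a *: vn by rewrite vE w0 add0r.
  have [a0|a0] := eqVneq a 0.
    rewrite a0 scale0r act_c_0 -[LHS](sum_weight_vec_line vn); apply: eq_bigr => b _.
    by rewrite mul0r mulr0 oppr0 lam0 // scale1r add0r addr0.
  rewrite act_c_Zvn //; apply: eq_bigr => b _.
  by rewrite -scalerDl [a + _]addrC subrK.
pose x := dsubmx w; have wx : nv x = w by apply: nv_dsub.
have xn : x ord_max 0 = 0 by rewrite -coordn_nv wx.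
have /existsP[i xi] : [exists i, x i 0 != 0].
  apply: contraNT w0 => /existsPn h; rewrite -wx; apply/eqP.
  have -> : x = 0 by apply/colP=> j; rewrite [RHS]mxE; apply/eqP/negPn/h.
  by rewrite /nv col_mx0.
have ni : i != ord_max by apply: contraNneq xi => ->; rewrite xn.
clearbody x.
pose t := - (a / x i 0); have Mg := xroot_SpMN t ni.
have gw (b : K) : gact (xroot i ord_max t) w = v.
  by rewrite -wx xroot_nv // wx /t mulNr divfK // scaleNr opprK vE.
pose S : 'M[K]_n := t *: (delta_mx ord_max i + delta_mx i ord_max).
have MS : unip S \in SpM K m.
  by apply: unip_SpM; rewrite /S linearZ /= raddfD /= !trmx_delta addrC.
rewrite -{1}(gw 0) -act_SpMN_weight_vec // -actM ?(SpMN_Sp Mg) ?c_Sp // c_xroot // -/S.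
rewrite actM ?c_Sp ?(SpM_Sp MS) // act_c_coord0 // linear_sum.
apply: eq_bigr => b _; rewrite act_SpM_weight_vec //; last by rewrite rpredD ?rpredZ // vn_N.
have -> : v + (b - a) *: vn = w + b *: vn.
  by rewrite /w scalerBl addrCA addrC.
congr (_ *: _).
have wb : w + b *: vn = nv (x + b *: (delta_mx ord_max 0)) by rewrite nvD wx nvZ.
rewrite wb chi_unipE; congr lam; set y := x + _.
have yn : y ord_max 0 = b by rewrite !mxE xn !eqxx mulr1 add0r.
have yi : y i 0 = x i 0 by rewrite !mxE (negPf ni) mulr0 addr0.
clearbody y.
rewrite quad_sym yn yi /t.
by field.
Qed.
End WeightVectors.

(** * The Weil module and the intertwining criterion *)
Section WeilModule.
Variables (K : finFieldType) (m : nat) (F : fieldType) (lam : K -> F).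
Notation n := m.+1.
Notation gT := {'GL_(n + n)[K]}.
Notation "'vn'" := (v_ ord_max : 'cV[K]_(n + n)).
Notation Y := (Ymod K m F).
Notation eps := (@eps K m F).
Notation c := (c_ ord_max : gT).
Implicit Types (g h s : gT) (v w : 'cV[K]_(n + n)).
Hypothesis lam_char : additive_char lam.

Lemma Y_eps (x : Y) : x = \sum_(w : Nelt K m) (x w : F) *: eps (val w).
Proof.
apply/ffunP=> w; rewrite sum_ffunE (bigD1 w) //= !ffunE eqxx [X in X + _]mulr1.
rewrite big1 ?addr0 // => u nu; rewrite !ffunE.
by rewrite (inj_eq val_inj) eq_sym (negPf nu) [LHS]mulr0.
Qed.

Lemma Y_ext (V : lmodType F) (f h : {linear Y -> V}) :
  {in N K m, forall v, f (eps v) = h (eps v)} -> f =1 h.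
Proof.
move=> fh x; rewrite (Y_eps x) !linear_sum; apply: eq_bigr => w _.
by rewrite !linearZ /= fh // (valP w).
Qed.

Definition Ylin (V : lmodType F) (e : 'cV[K]_(n + n) -> V) (x : Y) : V :=
  \sum_(w : Nelt K m) (x w : F) *: e (val w).

Lemma Ylin_is_linear (V : lmodType F) (e : 'cV[K]_(n + n) -> V) : linear (Ylin e).
Proof.
move=> a x y; rewrite /Ylin scaler_sumr -big_split; apply: eq_bigr => w _ /=.
by rewrite !ffunE scalerDl scalerA.
Qed.
HB.instance Definition _ (V : lmodType F) (e : 'cV[K]_(n + n) -> V) :=
  GRing.isSemilinear.Build F Y V _ (Ylin e) (GRing.semilinear_linear (Ylin_is_linear e)).

Lemma Ylin_eps (V : lmodType F) (e : 'cV[K]_(n + n) -> V) v :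
  v \in N K m -> Ylin e (eps v) = e v.
Proof.
move=> Nv; rewrite /Ylin (bigD1 (Sub v Nv)) //= !ffunE /= eqxx scale1r.
rewrite big1 ?addr0 // => w nw; rewrite !ffunE; case: eqP => [ew|_]; last by rewrite scale0r.
by case/eqP: nw; apply: val_inj.
Qed.

Variable P : gT -> 'End(Y).
Hypothesis weilP : weil_rep lam P.

Lemma form_NN v w : v \in N K m -> w \in N K m -> form v w = 0.
Proof.
by move=> /nv_dsub <- /nv_dsub <-; rewrite form_col trmx0 mul0mx mulmx0 !mxE subr0.
Qed.

Lemma weil_SpM s v : s \in SpM K m -> v \in N K m -> P s (eps v) = chi lam v s *: eps v.
Proof.
move=> Ms Nv; case: weilP => _ _ h _.
have M1 : 1%g \in SpMN K m by apply: (@group1 _ (SpMN_group K m)).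
by have := h s 1%g Ms M1 v Nv; rewrite mulg1 gact1.
Qed.

Lemma weil_SpMN (a : gT) v : a \in SpMN K m -> v \in N K m ->
  P a (eps v) = eps (gact a v).
Proof.
move=> Ma Nv; case: weilP => _ _ h _.
have M1 : 1%g \in SpM K m by rewrite -(unip0 K m) unip_SpM ?trmx0.
have := h 1%g a M1 Ma v Nv; rewrite mul1g => ->.
by rewrite form_NN ?SpMN_N // lam0 // scale1r.
Qed.

Lemma weil_mul g h x : g \in Sp K m -> h \in Sp K m -> P (g * h)%g x = P g (P h x).
Proof. by move=> Sg Sh; case: weilP => _ hM _ _; rewrite hM // comp_lfunE. Qed.

(** In SL_2 this is the factorization of the Weyl element as s rho s, with s the
    upper unipotent of entry -1. *)
Lemma c_rho : c = (unip (- delta_mx ord_max ord_max) * rho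
                   * unip (- delta_mx ord_max ord_max))%g.
Proof.
have [_ cu cv cf] := c_P K (ord_max : 'I_n); have [_ rE] := rhoP K m.
have sgu (S : 'M[K]_n) j : gact (unip S) (u_ j) = u_ j by rewrite [LHS]gact_unip_mv.
have sgv j : gact (unip (- delta_mx ord_max ord_max)) (v_ j)
    = v_ j - (j == ord_max)%:R *: u_ ord_max.
  rewrite [LHS]gact_unip_nv mulNmx mul_delta_mx_cond eq_sym.
  rewrite /v_ /u_ -scaleNr scale_col_mx scaler0 add_col_mx add0r addr0 scaleNr.
  by case: eqP; rewrite ?scale1r ?scale0r.
apply: gl_ext => j; rewrite !gactM.
  rewrite sgu rE gactD gactN gactZ sgu sgv form_sym form_uv eqxx scale1r.
  have [->|nj] := eqVneq j ord_max.
    by rewrite cu scaleNr opprK scale1r addrCA subrr addr0.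
  by rewrite oppr0 scale0r subr0 (cf j nj).1.
rewrite sgv; have [->|nj] := eqVneq j ord_max.
  rewrite scale1r cv rE formDr formNr form_vv form_sym form_uv eqxx opprK add0r scale1r.
  rewrite addrAC subrr add0r gactN sgu.
  by [].
by rewrite scale0r subr0 rE form_vv scale0r subr0 sgv (negPf nj) scale0r subr0 (cf j nj).2.
Qed.

Lemma chi_corner v t : v \in N K m ->
  chi lam v (unip (t *: delta_mx ord_max ord_max)) = lam (t * coordn v ^+ 2).
Proof.
move=> /nv_dsub <-; set x := dsubmx v; rewrite chi_unipE coordn_nv; congr lam.
clearbody x; rewrite -(mul_delta_mx (0 : 'I_1)) -scalemxAl -mulmxA -rowE.
have -> : row ord_max x = (x ord_max 0)%:M.
  by apply/matrixP=> q r; rewrite !ord1 !mxE mulr1n.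
rewrite mul_mx_scalar scalerA linearZ /= trmx_delta -scalemxAl -rowE !mxE.
by rewrite expr2 mulrA.
Qed.

(** The factors lambda at the two occurrences of s turn lambda(b^2) into
    lambda(b^2 - x^2 - (x + b)^2) = lambda(-2x(x + b)), where x is the
    coordinate of v at v_n. *)
Lemma weil_c v : v \in N K m -> P c (eps v)
  = \sum_(b : K) lam (- (2 * (coordn v * b))) *: eps (v + (b - coordn v) *: vn).
Proof.
move=> Nv; pose s := unip (- delta_mx ord_max ord_max : 'M[K]_n).
have Ms : s \in SpM K m by apply: unip_SpM; rewrite linearN /= trmx_delta.
have Ss := SpM_Sp Ms; have [Sr _] := rhoP K m.
have chis w : w \in N K m -> chi lam w s = lam (- coordn w ^+ 2).
  by move=> Nw; rewrite /s -scaleN1r chi_corner // mulN1r.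
have NZ (b : K) : v + b *: vn \in N K m by rewrite rpredD ?rpredZ // vn_N.
have cn (b : K) : coordn (v + b *: vn) = coordn v + b.
  rewrite /coordn; do 2!rewrite mxE; congr (_ + _); rewrite -[RHS]mulr1; congr (_ * _).
  by rewrite -/(coordn vn) [LHS]coordn_nv mxE !eqxx.
case: (weilP) => _ _ _ hr.
rewrite c_rho -/s !weil_mul ?Sp_mul // weil_SpM // !linearZ /= hr //.
rewrite linear_sum scaler_sumr [RHS](reindex_inj (addrI (coordn v))) /=.
apply: eq_bigr => b _; rewrite linearZ /= weil_SpM // !scalerA !chis // cn -!lamD //.
rewrite [coordn v + b - _]addrAC subrr add0r; congr (lam _ *: _); ring.
Qed.

(** The three hypotheses on the family e are the formulas that hold for the
    eps_v, so that by [Sp_ind] the map eps_v -> e v commutes with Sp. *)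
Lemma Ylin_intertwines (V : lmodType F) (act : gT -> V -> V)
    (act_lin : forall g, linear (act g)) (e : 'cV[K]_(n + n) -> V) :
    {in Sp K m &, forall g h x, act (g * h)%g x = act g (act h x)} ->
    {in SpM K m & N K m, forall s v, act s (e v) = chi lam v s *: e v} ->
    {in SpMN K m & N K m, forall a v, act a (e v) = e (gact a v)} ->
    {in N K m, forall v, act c (e v)
       = \sum_(b : K) lam (- (2 * (coordn v * b))) *: e (v + (b - coordn v) *: vn)} ->
  {in Sp K m, forall g x, Ylin e (P g x) = act g (Ylin e x)}.
Proof.
move=> actM es ea ec.
pose actL g : {linear V -> V} := HB.pack (act g)
  (GRing.isLinear.Build F V V _ (act g) (act_lin g)).
have base g : {in N K m, forall v, Ylin e (P g (eps v)) = act g (e v)} ->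
    forall x, Ylin e (P g x) = act g (Ylin e x).
  move=> gv x; apply: (Y_ext (f := [the {linear Y -> V} of Ylin e \o P g])
     (h := [the {linear Y -> V} of actL g \o Ylin e])) => v Nv /=.
  by rewrite gv // Ylin_eps.
apply: Sp_ind => [s Ms | a Ma | | g h Sg Sh IHg IHh x].
- apply: base => v Nv; rewrite weil_SpM // linearZ /= Ylin_eps //.
  by rewrite es.
- by apply: base => v Nv; rewrite weil_SpMN // Ylin_eps ?SpMN_N // ea.
- apply: base => v Nv; rewrite weil_c // linear_sum ec //.
  apply: eq_bigr => b _; rewrite linearZ /= Ylin_eps //.
  by rewrite rpredD ?rpredZ // vn_N.
by rewrite weil_mul // IHg IHh actM.
Qed.
End WeilModule.

(** * Modules with the same kernel, characters of Sp^M *)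
(** The isomorphism is h composed with any linear section of f. *)
Lemma gisom_of_same_kernel (F : fieldType) (gT : finGroupType) (G : {set gT})
    (Y Q Z : vectType F) (pG : gT -> Y -> Y) (qG : gT -> Q -> Q) (zG : gT -> Z -> Z)
    (f : 'Hom(Y, Q)) (h : 'Hom(Y, Z)) :
    (forall x, (f x == 0) = (h x == 0)) ->
    {in G, forall g x, f (pG g x) = qG g (f x)} ->
    {in G, forall g x, h (pG g x) = zG g (h x)} ->
  gisom G qG (limg f) zG (limg h).
Proof.
move=> fh fG hG; pose i : 'Hom(Q, Z) := (h \o f^-1)%VF.
have iE x : i (f x) = h x.
  rewrite comp_lfunE /=; apply/eqP; rewrite -subr_eq0 -linearB -fh linearB /=.
  by rewrite limg_lfunVK ?memv_img ?memvf // subrr.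
have fP y : y \in limg f -> exists x, y = f x by case/memv_imgP=> x _ ->; exists x.
exists i; split.
- apply/vspaceP=> z; apply/memv_imgP/memv_imgP => [[y /fP[x ->] ->] | [x _ ->]].
    by exists x; rewrite ?memvf ?iE.
  by exists (f x); rewrite ?memv_img ?memvf ?iE.
- apply/eqP; rewrite -subv0; apply/subvP=> y; rewrite memv_cap memv_ker memv0.
  by case/andP=> iy /fP[x ey]; rewrite ey iE in iy *; rewrite fh.
by move=> g Gg y /fP[x ->]; rewrite -fG // !iE hG.
Qed.

Lemma sum_mulg (gT : finGroupType) (V : zmodType) (G H : {group gT}) (f : gT -> V) :
  (G :&: H = 1)%g ->
  \sum_(g in (G * H)%g) f g = \sum_(x in G) \sum_(y in H) f (x * y)%g.
Proof.
move=> GH; pose mul (p : gT * gT) := (p.1 * p.2)%g.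
have -> : (G * H)%g = [set mul p | p in setX G H].
  apply/setP=> g; apply/mulsgP/imsetP => [[x y Gx Hy ->] | [[x y]]].
    by exists (x, y); rewrite // inE /= Gx.
  by rewrite inE => /andP[Gx Hy] ->; exists x y.
rewrite big_imset /=.
  rewrite pair_big_dep /=; apply: eq_bigl => [[x y]]; by rewrite inE.
move=> [x y] [x' y']; rewrite !inE /mul /= => /andP[Gx Hy] /andP[Gx' Hy'] e.
have e2 : (x'^-1 * x = y' * y^-1)%g.
  by apply: (mulgI x'); rewrite mulKVg mulgA -e mulgK.
have : (x'^-1 * x)%g \in G :&: H.
  by rewrite inE groupM ?groupV //= e2 groupM ?groupV.
rewrite GH inE => /eqP e1; move: e2; rewrite e1 => /esym/eqP.
rewrite -eq_mulgV1 => /eqP ->; congr (_, _); apply/eqP.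
by rewrite eq_mulVg1 -eq_invg_mul ?invgK; move/eqP: e1; rewrite -eq_invg_mul => /eqP <-; rewrite invgK.
Qed.

Section Weights.
Variables (K : finFieldType) (m : nat) (F : fieldType) (lam : K -> F).
Notation n := m.+1.
Notation gT := {'GL_(n + n)[K]}.
Implicit Types (g h s : gT) (v w : 'cV[K]_(n + n)) (x y : 'cV[K]_n).
Hypothesis two : 2%:R != 0 :> K.
Hypothesis lam_char : additive_char lam.
Hypothesis lam_nontriv : exists a, lam a != 1.

Lemma quad_eq_pm x y : (forall i j, x i 0 * x j 0 = y i 0 * y j 0) -> y = x \/ y = - x.
Proof.
move=> xy; have [/forallP x0|/forallPn[i xi]] := boolP [forall i, x i 0 == 0].
  left; apply/colP=> i; have := xy i i; rewrite (eqP (x0 i)) mul0r => /esym/eqP.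
  by rewrite mulf_eq0 orbb => /eqP.
have : (y i 0 - x i 0) * (y i 0 + x i 0) = 0.
  by rewrite -subr_sqr !expr2 xy subrr.
move/eqP; rewrite mulf_eq0 subr_eq0 addr_eq0 => /orP[] /eqP yi; [left | right].
  by apply/colP=> j; apply: (mulfI xi); rewrite xy yi.
by apply/colP=> j; apply: (mulfI xi); rewrite mxE mulrN xy yi mulNr opprK.
Qed.

(** The values of chi_v on Sp^M determine the quadratic form S -> x^T S x, hence
    all products of two coordinates of v, hence v up to sign; the symmetric
    matrices E_ij + E_ji suffice because 2 is invertible. *)
Lemma chi_separates v w : v \in N K m -> w \in N K m -> v != w -> v != - w ->
  exists2 s, s \in SpM K m & chi lam w s != chi lam v s.
Proof.
move=> Nv Nw nvw nvNw; set x := dsubmx v; set y := dsubmx w.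
have ev : v = nv x by rewrite nv_dsub.
have ew : w = nv y by rewrite nv_dsub.
have [/forallP xy|] := boolP [forall i, forall j, y i 0 * y j 0 == x i 0 * x j 0].
  have [|e|e] := @quad_eq_pm y x.
  - by move=> i j; have /forallP/(_ j)/eqP := xy i.
  - by case/eqP: nvw; rewrite ev ew e.
  by case/eqP: nvNw; rewrite ev ew e /nv opp_col_mx oppr0.
case/forallPn=> i /forallPn[j nij].
have k0 : 2 * (y i 0 * y j 0 - x i 0 * x j 0) != 0 by rewrite mulf_neq0 // subr_eq0.
have [b lb] := lam_nontrivZ lam_nontriv k0.
pose S : 'M[K]_n := b *: (delta_mx i j + delta_mx j i).
exists (unip S); first by apply: unip_SpM; rewrite /S linearZ /= raddfD /= !trmx_delta addrC.
rewrite {1}ew {1}ev !chi_unipE !quad_sym; apply: contraNneq lb => e.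
rewrite -subr_eq0.
have -> : 2 * (y i 0 * y j 0 - x i 0 * x j 0) * b
   = b * (2 * (y i 0 * y j 0)) + - (b * (2 * (x i 0 * x j 0))) by ring.
by rewrite lamD // lamN // e mulfV ?subrr // lam_neq0.
Qed.

Hypothesis char2 : 2%N \in [pchar F].

Lemma SpM_odd : odd #|SpM K m|.
Proof.
have oU := U_odd m two.
have sub : SpM K m \subset U K m.
  by apply/subsetP=> g Mg; rewrite -[g]mul1g mem_mulg // (@group1 _ (T_group K m)).
exact: dvdn_odd (@cardSg _ (U_group K m) (SpM_group K m) sub) oU.
Qed.

Lemma sum_chi v w : v \in N K m -> w \in N K m ->
  \sum_(s in SpM K m) (chi lam w s)^-1 * chi lam v s = ((v == w) || (v == - w))%:R.
Proof.
move=> Nv Nw; have chiN u s : chi lam (- u) s = chi lam u s.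
  by rewrite /chi gactN formNl formNr opprK.
have eq1 : (v == w) || (v == - w) ->
    \sum_(s in SpM K m) (chi lam w s)^-1 * chi lam v s = 1.
  move=> vw; rewrite (eq_bigr (fun _ => 1)) => [|s _].
    by rewrite sumr_const odd_char2 // SpM_odd.
  have -> : chi lam v s = chi lam w s by case/orP: vw => /eqP->.
  by rewrite mulVf // lam_neq0.
case vw : ((v == w) || (v == - w)); first exact: eq1.
move/negbT: vw; rewrite negb_or => /andP[n1 n2].
have [s0 Ms0 ns] := chi_separates Nv Nw n1 n2.
set S := LHS; have : ((chi lam w s0)^-1 * chi lam v s0) * S = S.
  rewrite /S mulr_sumr [RHS](reindex_inj (mulgI s0)) /=.
  apply: eq_big => [h|h Mh]; first by rewrite (@groupMl _ (SpM_group K m)).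
  by rewrite !chiM // invfM mulrACA.
move/eqP; rewrite -subr_eq0 -{2}[S]mul1r -mulrBl mulf_eq0 subr_eq0 => /orP[|/eqP//].
rewrite -(inj_eq (mulfI (lam_neq0 lam_char (form (gact s0 w) w)))) mulr1 mulrA mulfV ?lam_neq0 //.
by rewrite mul1r => /eqP e; case/eqP: ns; rewrite e.
Qed.

(** Transposition and inversion turn T into lower unitriangular matrices on N,
    for which the i-th column is arbitrary below the diagonal. *)
Lemma exists_unitri_col x (i : 'I_n) : x i 0 = 1 ->
    (forall j : 'I_n, (j < i)%N -> x j 0 = 0) ->
  exists t, [/\ t \in T K m & gact t (v_ i) = nv x].
Proof.
move=> xi xj; pose e : 'cV[K]_n := delta_mx i 0; pose z := x - e.
have zi : z i 0 = 0 by rewrite !mxE xi !eqxx subrr.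
have zj (j : 'I_n) : (j < i)%N -> z j 0 = 0.
  by move=> ji; rewrite !mxE xj // -val_eqE /= (ltn_eqF ji) subr0.
have zze : (z^T *m e) = 0.
  by apply/matrixP=> a b; rewrite !ord1 /e -colE !mxE xi !eqxx subrr.
pose X : 'M[K]_n := e *m z^T.
have XX : X *m X = 0 by rewrite /X mulmxA -(mulmxA e) zze mulmx0 mul0mx.
have AA : (1%:M - X) *m (1%:M + X) = 1%:M.
  by rewrite mulmxDr mulmx1 mulmxBl mul1mx XX subr0 subrK.
have [uA _] := mulmx1_unit AA.
have iA : invmx (1%:M - X) = 1%:M + X.
  by apply: (can_inj (mulKmx uA)); rewrite mulmxV.
exists (levi (1%:M - X)); split; last first.
  rewrite [LHS]gact_levi_nv // iA; congr nv.
  rewrite raddfD /= trmx1 trmx_mul trmxK mulmxDl mul1mx -mulmxA.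
  have -> : e^T *m delta_mx i 0 = 1%:M.
    by apply/matrixP=> a b; rewrite !ord1 trmx_delta -rowE !mxE !eqxx.
  by rewrite mulmx1 addrC subrK.
apply/TP; exists (1%:M - X); split=> // k l lk.
rewrite mxE [1%:M _ _]mxE [(- X) _ _]mxE.
have -> : X k l = (k == i)%:R * z l 0 by rewrite /X /e mxE big_ord1 !mxE andbT.
have [ek|_] := eqVneq k i; last by rewrite mul0r subr0.
move: lk; rewrite ek leq_eqVlt => /predU1P[/val_inj->|/zj->].
  by rewrite zi mulr0 subr0.
by rewrite mulr0 subr0.
Qed.
End Weights.

(** * The regular representation and e_1 *)
Section Regular.
Variables (K : finFieldType) (m : nat) (F : fieldType).
Notation n := m.+1.
Notation gT := {'GL_(n + n)[K]}.
Notation FSp := 'M[F]_#|Sp K m|.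
Notation SpG := (Sp_group K m).
Implicit Types (g h s t : gT) (x : FSp) (v w : 'cV[K]_(n + n)).

Definition reg_act g : {linear FSp -> FSp} := [the {linear FSp -> FSp} of mulmx (rg F g)].

Lemma reg_actE g x : reg_act g x = rg F g *m x. Proof. by []. Qed.

Lemma rgM g h : g \in Sp K m -> h \in Sp K m -> rg F (g * h)%g = reg_act g (rg F h).
Proof. by move=> Sg Sh; apply: (@repr_mxM _ _ SpG). Qed.

Lemma reg_actM : {in Sp K m &, forall g h x, reg_act (g * h)%g x = reg_act g (reg_act h x)}.
Proof. by move=> g h Sg Sh x; rewrite !reg_actE rgM //; apply/esym/mulmxA. Qed.

Lemma reg_act1 x : reg_act 1%g x = x.
Proof. by rewrite reg_actE /rg (@repr_mx1 _ _ SpG) mul1mx. Qed.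

Definition Bsum : FSp := \sum_(b in B K m) rg F b.

Lemma reg_act_Bsum b : b \in B K m -> reg_act b Bsum = Bsum.
Proof.
move=> Bb; rewrite /Bsum linear_sum [RHS](reindex_inj (mulgI b)) /=.
apply: eq_big => [g|g Bg]; first by rewrite (@groupMl _ (B_group K m)).
by rewrite -rgM // B_Sp.
Qed.

Definition coef1 x : F := x (gring_index SpG 1) (gring_index SpG 1).

Lemma coef1_rg g : g \in Sp K m -> coef1 (rg F g) = (g == 1%g)%:R.
Proof.
move=> Sg; rewrite /coef1 [rg F g _ _]mxE gring_indexK ?group1 // mul1g mxE /=.
congr (nat_of_bool _)%:R; rewrite eq_sym.
apply/eqP/eqP => [|-> //]; move/(congr1 enum_val).
by rewrite !gring_indexK ?group1.
Qed.

Lemma coef1_sum I (r : seq I) (Q : pred I) (f : I -> FSp) :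
  coef1 (\sum_(i <- r | Q i) f i) = \sum_(i <- r | Q i) coef1 (f i).
Proof. exact: summxE. Qed.

Variable nw : coset_of (H K m) -> gT.
Hypothesis two : 2%:R != 0 :> K.
Hypothesis char2 : 2%N \in [pchar F].
Hypothesis lift : weyl_lift nw.

Notation e := (weyl_sum nw reg_act Bsum).
Notation f := (T_sum nw reg_act Bsum).

Lemma st_eE : st_e F nw = e.
Proof.
rewrite /st_e [LHS]mulmx_suml; apply: eq_bigr => w _.
by rewrite (oppr_pchar2 char2) expr1n scale1r.
Qed.

Lemma reg_act_T_sum a : a \in SpMN K m -> reg_act a f = f.
Proof. by apply: SpMN_T_sum => //; [apply: reg_actM | apply: reg_act1 | apply: reg_act_Bsum]. Qed.

Lemma U_eq : U K m = (SpM K m * T K m)%g.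
Proof. exact: (normC (subset_trans (T_SpMN K m) (SpMN_norm_SpM K m))). Qed.

Lemma SpM_I_T : (SpM K m :&: T K m = 1)%g.
Proof.
apply/trivgP; rewrite -(SpM_I_SpMN K m); exact: setIS (T_SpMN K m).
Qed.

(** Every element of U is uniquely s t with s in Sp^M and t in T. *)
Lemma sum_U (k : gT -> F) :
    {in SpM K m & T K m, forall s t, k (s * t)%g = k s} ->
  \sum_(g in U K m) k g *: (rg F g *m st_e F nw) = \sum_(s in SpM K m) k s *: reg_act s f.
Proof.
move=> kst; rewrite U_eq (@sum_mulg _ _ (SpM_group K m) (T_group K m)); last exact: SpM_I_T.
apply: eq_bigr => s Ms; rewrite /T_sum linear_sum scaler_sumr; apply: eq_bigr => t Tt.
by rewrite kst // st_eE -reg_actE reg_actM ?(SpM_Sp Ms) ?(T_Sp Tt).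
Qed.

(** This is why chi_{a v_n} is trivial on T, so that e_{chi_{a v_n}} is a weight
    vector. *)
Lemma T_vn t : t \in T K m -> gact t (v_ ord_max) = v_ ord_max.
Proof.
case/TP=> A [uA tA ->]; rewrite [LHS]gact_levi_nv //; congr nv.
have uAt : A^T \in unitmx by rewrite unitmx_tr.
rewrite trmx_inv; apply: (can_inj (mulKmx uAt)); rewrite mulKVmx //.
rewrite -colE; apply/colP=> k; rewrite !mxE tA ?andbT 1?eq_sym //.
by rewrite -ltnS ltn_ord.
Qed.

Variable lam : K -> F.
Hypothesis lam_char : additive_char lam.

Notation weight_vec := (weight_vec reg_act f lam).

Lemma e_of_weight_vec a : e_of nw (chi lam (a *: v_ ord_max)) = weight_vec (a *: v_ ord_max).
Proof.
rewrite /e_of (sum_U (k := fun g => (chi lam (a *: v_ ord_max) g)^-1)) // => s t Ms Tt.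
by rewrite /chi gactM !gactZ T_vn.
Qed.

Lemma e1_weight_vec : e1 F nw = weight_vec 0.
Proof.
rewrite weight_vec0 // /e1 -(eq_bigr _ (fun g _ => scale1r _)) (sum_U (k := fun=> 1)) //.
by apply: eq_bigr => s _; rewrite scale1r.
Qed.

(** The coefficient of e_1 at 1 counts the triples (u, w, b) with u n_w b = 1.
    In such a triple n_w lies in B, which meets W_2 in the torus only; so
    w = 1, and u determines b.  The count is thus |U|, which is odd. *)
Lemma e1_neq0 : e1 F nw != 0.
Proof.
have W1 : (1 : coset_of (H K m))%g \in W K m by apply: group1.
have H1 : nw 1%g \in H K m.
  have [h Hh] := @nw_coset _ _ nw lift 1%g (group1 _).
  by rewrite mul1g coset_id ?group1 // => ->.
suff e1c : coef1 (e1 F nw) = 1.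
  by apply/eqP=> e10; move: e1c; rewrite e10 /coef1 mxE => /eqP; rewrite eq_sym oner_eq0.
have W_Sp (w : coset_of (H K m)) : w \in W K m -> nw w \in Sp K m by move=> Ww; apply/W2S/nw_W2.
rewrite /e1 coef1_sum (eq_bigr (fun _ => 1)) => [|g Ug].
  by rewrite sumr_const odd_char2 // U_odd.
have Bg := U_sub_B Ug; have Sg := B_Sp Bg.
have key (h b : gT) : h \in Sp K m -> b \in Sp K m ->
    coef1 (reg_act g (reg_act h (rg F b))) = (g * h * b == 1)%g%:R.
  by move=> Sh Sb; rewrite -!rgM ?Sp_mul // coef1_rg ?Sp_mul // mulgA.
have expand (h : gT) : coef1 (reg_act g (reg_act h Bsum))
    = \sum_(b in B K m) coef1 (reg_act g (reg_act h (rg F b))).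
  by rewrite /Bsum linear_sum linear_sum coef1_sum.
rewrite st_eE -reg_actE linear_sum coef1_sum (bigD1 1%g) //= big1 ?addr0 => [|w /andP[Ww nw1]].
  rewrite expand (bigD1 (g * nw 1)^-1%g) /=; last first.
    exact: B_inv (B_mul Bg (H_sub_B H1)).
  rewrite key ?Sp_inv ?Sp_mul ?W_Sp // mulgV eqxx big1 ?addr0 // => b /andP[Bb nb].
  rewrite key ?W_Sp ?(B_Sp Bb) // -eq_invg_mul eq_sym (negPf nb).
  by [].
rewrite expand big1 // => b Bb; have Sw := W_Sp w Ww.
rewrite key ?(B_Sp Bb) //; case: eqP => // gwb.
case/eqP: nw1; rewrite -(coset_nw lift Ww); apply: coset_id.
apply: (subsetP (W2_I_B K m)); rewrite inE nw_W2 //=.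
have -> : nw w = (g^-1 * b^-1)%g.
  by apply: (mulgI g); apply: (mulIg b); rewrite gwb mulKVg mulVg.
exact: B_mul (B_inv Bg) (B_inv Bb).
Qed.
End Regular.

(** * The isomorphism *)
Section Assembly.
Variables (K : finFieldType) (m : nat) (F : fieldType).
Notation n := m.+1.
Notation gT := {'GL_(n + n)[K]}.
Notation FSp := 'M[F]_#|Sp K m|.
Notation Y := (Ymod K m F).
Notation eps := (@eps K m F).
Notation c := (c_ ord_max : gT).
Notation "'vn'" := (v_ ord_max : 'cV[K]_(n + n)).
Implicit Types (g h s t : gT) (v w : 'cV[K]_(n + n)).
Variables (nw : coset_of (H K m) -> gT) (lam : K -> F) (Tq : {set K}).
Variable P : gT -> 'End(Y).
Hypothesis two : 2%:R != 0 :> K.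
Hypothesis char2 : 2%N \in [pchar F].
Hypothesis lift : weyl_lift nw.
Hypothesis lam_char : additive_char lam.
Hypothesis lam_nontriv : exists a, lam a != 1.
Hypothesis TqP : pm_transversal Tq.
Hypothesis weilP : weil_rep lam P.

Notation f := (T_sum nw (@reg_act K m F) (Bsum K m F)).
Notation weight_vec := (weight_vec (@reg_act K m F) f lam).
Notation e1 := (e1 F nw).
Notation S := (Smod F nw).
Notation act g := (@reg_act K m F g).

Hypothesis hyp1 : act c (weight_vec vn)
  = weight_vec 0 + \sum_(a in Tq) (lam (- (2 * a)) + lam (2 * a)) *: weight_vec (a *: vn).
Hypothesis hyp2 : (0 < m)%N -> act (c_ ord_pen) (weight_vec vn)
  = \sum_(a : K) act (w_ m.-1 * x_ (- a) * w_ m.-1)%g (weight_vec vn).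

Let actM := @reg_actM K m F.
Let act1 := @reg_act1 K m F.
Let f_fix := reg_act_T_sum two char2 lift.

(** If one of these vectors vanishes, so do all, by transitivity of Sp_{M,N};
    then [act_c_vn] reads 0 = e_1. *)
Lemma weight_vec_neq0 v : v \in N K m -> v != 0 -> weight_vec v != 0.
Proof.
move=> Nv v0; apply: contraNneq (e1_neq0 two char2 lift) => Ev.
have Evn : weight_vec vn = 0.
  have x0 : dsubmx v != 0 by apply: contraNneq v0 => x0; rewrite -(nv_dsub Nv) x0 /nv col_mx0.
  have [D [uD Dn _]] := exists_unitmx_basis ord_max x0.
  have uA : (invmx D)^T \in unitmx by rewrite unitmx_tr unitmx_inv.
  have Ma := levi_SpMN uA; have Sa := SpMN_Sp Ma.
  have av : gact (levi (invmx D)^T) vn = v.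
    by rewrite [LHS]gact_levi_nv // -trmx_inv invmxK trmxK Dn nv_dsub.
  have : act (levi (invmx D)^T) (weight_vec vn) = 0 by rewrite act_SpMN_weight_vec // av.
  move/(congr1 (act (levi (invmx D)^T)^-1%g)).
  by rewrite -actM ?Sp_inv // mulVg act1 linear0.
have := act_c_vn two lam_char TqP hyp1; rewrite Evn linear0 (bigD1 0) //=.
rewrite mulr0 oppr0 lam0 // scale1r scale0r big1 ?addr0 => [E0|b b0].
  by rewrite (e1_weight_vec nw char2 lam_char) -E0.
have -> : b *: vn = gact (htor m b) vn by rewrite htor_v // eqxx.
by rewrite -act_SpMN_weight_vec ?htor_SpMN // Evn linear0 scaler0.
Qed.

Definition weil_to_st : {linear Y -> FSp} := [the {linear Y -> FSp} of Ylin weight_vec].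

Lemma weil_to_st_P : {in Sp K m, forall g x, weil_to_st (P g x) = act g (weil_to_st x)}.
Proof.
apply: (Ylin_intertwines lam_char weilP (act := fun g => act g)) => //.
- by move=> g a x y; rewrite linearP.
- by move=> s v Ms Nv; apply: act_SpM_weight_vec.
- by move=> a v Ma Nv; apply: act_SpMN_weight_vec.
by move=> v Nv; apply: (act_c_weight_vec two char2 actM act1 f_fix lam_char lam_nontriv TqP hyp1 hyp2).
Qed.

Lemma act_e1 g : g \in Sp K m -> act g e1 = e1.
Proof.
rewrite (e1_weight_vec nw char2 lam_char); move: g; apply: Sp_ind => [s Ms | a Ma | | g h Sg Sh IHg IHh].
- rewrite act_SpM_weight_vec //; last by rewrite mem0v.
  by rewrite /chi gact0 -[0](scale0r 0) formZl mul0r lam0 // scale1r.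
- by rewrite act_SpMN_weight_vec // gact0.
- exact: (act_c_0 two char2 actM f_fix lam_char lam_nontriv TqP hyp1).
by rewrite actM // IHh.
Qed.

Lemma act_S g x : g \in Sp K m -> x \in S -> act g x = x.
Proof. by move=> Sg /vlineP[k ->]; rewrite linearZ /= act_e1. Qed.

Lemma quot_actE g x : g \in Sp K m -> quot_act (nw := nw) g (vpi S x) = vpi S (act g x).
Proof.
move=> Sg; apply: (vquot_mapE (phi := act g)) => w Sw.
by rewrite act_S.
Qed.

Definition sym v : Y := eps v + eps (- v).
Definition Sym : {linear Y -> Y} := [the {linear Y -> Y} of Ylin sym].

Lemma chiN v s : chi lam (- v) s = chi lam v s.
Proof. by rewrite /chi gactN formNl formNr opprK. Qed.

Lemma NN v : v \in N K m -> - v \in N K m. Proof. by rewrite rpredN. Qed.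

Lemma Sym_P : {in Sp K m, forall g x, Sym (P g x) = P g (Sym x)}.
Proof.
apply: (Ylin_intertwines lam_char weilP (act := fun g => P g)).
- by move=> g a x y; rewrite linearP.
- by move=> g h Sg Sh x; apply: (weil_mul weilP).
- move=> s v Ms Nv; rewrite linearD /= !(weil_SpM weilP) ?NN // chiN.
  by rewrite -scalerDr.
- by move=> a v Ma Nv; rewrite linearD /= !(weil_SpMN lam_char weilP) ?NN // gactN.
move=> v Nv; rewrite linearD /= !(weil_c lam_char weilP) ?NN //.
rewrite [X in _ + X](reindex_inj oppr_inj) -big_split /=; apply: eq_bigr => b _.
have -> : coordn (- v) = - coordn v by rewrite /coordn mxE.
rewrite mulrNN -scalerDr; congr (_ *: (_ + eps _)).
by rewrite opprK opprD -scaleNr opprB [- b + _]addrC.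
Qed.

Lemma Sym_eps v : v \in N K m -> Sym (eps v) = sym v.
Proof. exact: Ylin_eps. Qed.

Definition Nopp (w : Nelt K m) : Nelt K m := Sub (- val w) (NN (valP w)).

Lemma Sym_val (x : Y) (w : Nelt K m) : Sym x w = x w + x (Nopp w).
Proof.
rewrite [LHS]sum_ffunE /sym (eq_bigr (fun u : Nelt K m => x u * (u == w)%:R + x u * (u == Nopp w)%:R)).
  rewrite big_split /=; congr (_ + _).
    by rewrite (bigD1 w) //= eqxx mulr1 big1 ?addr0 // => u /negPf->; rewrite mulr0.
  by rewrite (bigD1 (Nopp w)) //= eqxx mulr1 big1 ?addr0 // => u /negPf->; rewrite mulr0.
move=> u _; rewrite !ffunE [LHS]mulrDr; congr (x u * _%:R + x u * (nat_of_bool _)%:R).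
  by rewrite eq_sym -val_eqE.
by rewrite -[in RHS]val_eqE /= -eqr_oppLR eq_sym.
Qed.

(** An element of the second kernel has equal coefficients at v and -v, and its
    image in I is a multiple of e_1 because opposite terms cancel.  Conversely,
    if the image lies in S, it is fixed by Sp^M, so its projection to the
    weight chi_w is 0 for w nonzero; that projection is weight_vec w times the
    sum of the coefficients at w and -w. *)
Lemma weil_to_quot_Sym_ker x : (vpi S (weil_to_st x) == 0) = (Sym x == 0).
Proof.
have dbl := char2_add char2.
have dblF (k : F) : k + k = 0 := dbl F^o k.
rewrite -[0 in LHS](linear0 (vpi S)) vpi_eq subr0; apply/idP/eqP => [Sx|x0].
  apply/ffunP=> w; rewrite ffunE Sym_val; have [w0|w0] := eqVneq (val w) 0.
    by have -> : Nopp w = w by apply: val_inj; rewrite /= w0 oppr0.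
  pose pw z : FSp := \sum_(s in SpM K m) (chi lam (val w) s)^-1 *: act s z.
  have pw0 : pw (weil_to_st x) = 0.
    rewrite /pw (eq_bigr (fun s => (chi lam (val w) s)^-1 *: weil_to_st x)).
      rewrite -scaler_suml.
      have := sum_chi two lam_char lam_nontriv char2 (mem0v (N K m)) (valP w).
      rewrite eq_sym (negPf w0) eq_sym oppr_eq0 (negPf w0) /= => h.
      rewrite (eq_bigr (fun s => (chi lam (val w) s)^-1 * chi lam 0 s)) ?h ?scale0r // => s _.
      by rewrite /chi gact0 -[X in form X X](scale0r 0) formZl mul0r lam0 // mulr1.
    by move=> s Ms; rewrite act_S ?(SpM_Sp Ms).
  have pwx : pw (weil_to_st x) = (x w + x (Nopp w)) *: weight_vec (val w).
    rewrite /pw.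
    have -> : \sum_(s in SpM K m) (chi lam (val w) s)^-1 *: act s (weil_to_st x)
       = \sum_(u : Nelt K m) ((x u : F) * ((u == w) || (u == Nopp w))%:R) *: weight_vec (val u).
      rewrite (eq_bigr (fun s => \sum_(u : Nelt K m)
          ((x u : F) * ((chi lam (val w) s)^-1 * chi lam (val u) s)) *: weight_vec (val u))).
        rewrite exchange_big /=; apply: eq_bigr => u _; rewrite -scaler_suml -mulr_sumr.
        by rewrite (sum_chi two lam_char lam_nontriv char2 (valP u) (valP w)).
      move=> s Ms; rewrite [weil_to_st x]/(Ylin weight_vec x) /Ylin linear_sum scaler_sumr.
      apply: eq_bigr => u _; rewrite linearZ /= act_SpM_weight_vec ?(valP u) // !scalerA.
      by congr (_ *: _); ring.
    have nw' : Nopp w != w by apply: opp_neq two w0.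
    rewrite (bigD1 w) //= eqxx mulr1 (bigD1 (Nopp w)) //= eqxx orbT mulr1.
    rewrite big1 ?addr0 => [|u /andP[/negPf-> /negPf->]]; last by rewrite mulr0 scale0r.
    by rewrite weight_vecN // scalerDl.
  move: pwx; rewrite pw0 => /esym/eqP; rewrite scaler_eq0 (negPf (weight_vec_neq0 (valP w) w0)) orbF.
  by move/eqP.
have xN (w : Nelt K m) : x (Nopp w) = x w.
  have := Sym_val x w; rewrite x0 ffunE => /esym/eqP; rewrite addr_eq0 => /eqP->.
  by apply/esym/(char2_opp char2).
have z0 : (0 : 'cV[K]_(n + n)) \in N K m by rewrite mem0v.
rewrite [weil_to_st x]/(Ylin weight_vec x) /Ylin (bigD1 (Sub 0 z0)) //=.
rewrite (sum_involution_char2 (i := Nopp)) ?addr0.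
- by rewrite -(e1_weight_vec nw char2 lam_char) rpredZ // memv_line.
- exact: dbl.
- by move=> w; apply: val_inj; rewrite /= opprK.
- have e0 (w : Nelt K m) : (w == Sub 0 z0) = (val w == 0) by [].
  by move=> w; rewrite !e0 /= oppr_eq0.
- have e0 (w : Nelt K m) : (w == Sub 0 z0) = (val w == 0) by [].
  by move=> w; rewrite e0; apply: opp_neq two.
by move=> w; rewrite xN /= weight_vecN.
Qed.

Lemma Sym_img : limg (linfun Sym) = Yplus K m F.
Proof.
apply/vspaceP=> y; apply/idP/idP.
  case/memv_imgP=> x _ ->; rewrite lfunE /= /Ylin; apply: memv_suml => w _; apply: memvZ.
  have [w0|w0] := eqVneq (val w) 0.
    by rewrite /sym w0 oppr0 (char2_add char2) mem0v.
  by apply: memv_span; apply/mapP; exists (val w); rewrite // mem_enum inE (valP w).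
suff /subvP sub : (Yplus K m F <= limg (linfun Sym))%VS by apply: sub.
apply/span_subvP => _ /mapP[v + ->]; rewrite mem_enum inE => /andP[Nv _].
by rewrite -/(sym v) -Sym_eps // -(lfunE Sym) memv_img ?memvf.
Qed.

Notation Lm := (Lmod nw lam Tq).

Lemma mem_left_span (A : {set gT}) (x : FSp) g : g \in A -> act g x \in left_span A x.
Proof. by move=> Ag; apply: memv_span; apply/mapP; exists g; rewrite ?mem_enum. Qed.

Lemma weight_vec_limg v : v \in N K m -> weight_vec v \in limg (linfun weil_to_st).
Proof.
by move=> Nv; rewrite -(Ylin_eps weight_vec Nv) -[Ylin weight_vec _](lfunE weil_to_st) memv_img ?memvf.
Qed.

Lemma w'_vn (i : 'I_n) : gact (w' i) vn = v_ i.
Proof. by have [_ _ ->] := perm_glP K (lift_perm ord_max i 1%g); rewrite lift_perm_id. Qed.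

Lemma act_w'_weight_vec (i : 'I_n) (a : K) :
  act (w' i) (e_of nw (chi lam (a *: vn))) = weight_vec (a *: v_ i).
Proof. by rewrite e_of_weight_vec // act_SpMN_weight_vec ?perm_SpMN // gactZ w'_vn. Qed.

Lemma Lmod_sub : (Lm <= limg (linfun weil_to_st))%VS.
Proof.
apply/subv_sumP=> i _; apply/subv_sumP=> a _; apply/span_subvP=> _ /mapP[g + ->].
rewrite mem_enum => /mulsgP[t s Tt Ms ->].
have Nv : a *: v_ i \in N K m by rewrite rpredZ ?vn_N.
have Mt := subsetP (T_SpMN K m) t Tt.
rewrite -!reg_actE act_w'_weight_vec actM ?(SpMN_Sp Mt) ?(SpM_Sp Ms) // act_SpM_weight_vec // linearZ /=.
by rewrite act_SpMN_weight_vec // rpredZ // weight_vec_limg // SpMN_N.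
Qed.

(** L is spanned by the vectors whose index has its first nonzero coordinate in
    the transversal: T moves a v_i to any vector with leading term a v_i. *)
Lemma weight_vec_Lmod_pivot v (i : 'I_n) : v \in N K m -> dsubmx v i 0 \in Tq ->
  (forall j : 'I_n, (j < i)%N -> dsubmx v j 0 = 0) -> weight_vec v \in Lm.
Proof.
move=> Nv Ta xj; set a := dsubmx v i 0 in Ta.
have a0 : a != 0.
  by case/and3P: TqP => _ /subsetP T0 _; have := T0 a Ta; rewrite !inE.
have [||t [Tt tv]] := @exists_unitri_col K m (a^-1 *: dsubmx v) i.
- by rewrite mxE mulVf.
- by move=> j ji; rewrite mxE xj // mulr0.
have -> : weight_vec v = act t (act (w' i) (e_of nw (chi lam (a *: vn)))).
  rewrite act_w'_weight_vec act_SpMN_weight_vec ?(subsetP (T_SpMN K m)) // gactZ tv -nvZ scalerA.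
  by rewrite mulfV // scale1r nv_dsub.
have Ut : t \in U K m by rewrite -[t]mulg1 mem_mulg // group1.
apply: (subvP (sumv_sup i _ (subvv _)) _ _) => //.
apply: (subvP (sumv_sup a Ta (subvv _))) => //.
exact: mem_left_span.
Qed.

Lemma weight_vec_Lmod v : v \in N K m -> v != 0 -> weight_vec v \in Lm.
Proof.
move=> Nv v0; pose x := dsubmx v.
have /existsP[i0 xi0] : [exists i, x i 0 != 0].
  apply: contraNT v0 => /existsPn h; rewrite -(nv_dsub Nv) -/x.
  have -> : x = 0 by apply/colP=> j; rewrite [RHS]mxE; apply/eqP/negPn/h.
  by rewrite /nv col_mx0.
have [i xi min_i] := arg_minnP (P := fun i => x i 0 != 0) (@nat_of_ord n) xi0.
have xj (j : 'I_n) : (j < i)%N -> x j 0 = 0.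
  by apply: contraTeq => /min_i; rewrite -leqNgt.
have [Ta|] := boolP (x i 0 \in Tq); first exact: weight_vec_Lmod_pivot Nv Ta xj.
rewrite -(pm_transversalN two TqP xi) -weight_vecN => Ta.
have xN j : dsubmx (- v) j 0 = - x j 0 by rewrite /x linearN mxE.
apply: (@weight_vec_Lmod_pivot _ i); rewrite ?NN ?xN // => j /xj.
by rewrite xN => ->; rewrite oppr0.
Qed.

Definition weil_to_quot : 'Hom(Y, vquot S) := linfun [the {linear Y -> vquot S} of vpi S \o weil_to_st].

Lemma weil_to_quotE x : weil_to_quot x = vpi S (weil_to_st x). Proof. by rewrite lfunE. Qed.

Lemma Lmod_img : vquot_img S Lm = limg weil_to_quot.
Proof.
apply/vspaceP=> y; apply/idP/idP.
  case/memv_imgP=> z /(subvP Lmod_sub)/memv_imgP[x _ ->] ->.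
  by rewrite !lfunE /= -weil_to_quotE memv_img ?memvf.
case/memv_imgP=> x _ ->; rewrite weil_to_quotE [weil_to_st x]/(Ylin weight_vec x) /Ylin linear_sum.
apply: memv_suml => w _; rewrite linearZ memvZ //=.
have [w0|w0] := eqVneq (val w) 0.
  rewrite w0 -(e1_weight_vec nw char2 lam_char).
  have -> : vpi S e1 = 0 by apply/eqP; rewrite -[0](linear0 (vpi S)) vpi_eq subr0 memv_line.
  exact: mem0v.
by rewrite -(lfunE (vpi S)) memv_img // weight_vec_Lmod // (valP w).
Qed.

Lemma limg_weil_to_st_Imod : (limg (linfun weil_to_st) <= Imod F nw)%VS.
Proof.
apply/subvP=> _ /memv_imgP[x _ ->]; rewrite lfunE /= /Ylin.
apply: memv_suml => w _; apply: memvZ; apply: memv_suml => s Ms; apply: memvZ.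
rewrite /T_sum linear_sum; apply: memv_suml => t Tt.
rewrite -actM ?(SpM_Sp Ms) ?(T_Sp Tt) // -st_eE //; apply: mem_left_span.
by rewrite Sp_mul ?(SpM_Sp Ms) ?(T_Sp Tt).
Qed.

Lemma quot_act_weil_to_quot : {in Sp K m, forall g x, weil_to_quot (P g x) = quot_act (nw := nw) g (weil_to_quot x)}.
Proof. by move=> g Sg x; rewrite !weil_to_quotE weil_to_st_P // quot_actE. Qed.

Lemma quotient_isom_Yplus :
  [/\ (vquot_img S Lm <= vquot_img S (Imod F nw))%VS,
      gstable (Sp K m) (@quot_act K m F nw) (vquot_img S Lm)
    & gisom (Sp K m) (@quot_act K m F nw) (vquot_img S Lm) P (Yplus K m F)].
Proof.
split.
- by apply: limgS; apply: subv_trans Lmod_sub limg_weil_to_st_Imod.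
- move=> g Sg; rewrite Lmod_img => _ /memv_imgP[x _ ->].
  by rewrite -quot_act_weil_to_quot // memv_img ?memvf.
rewrite Lmod_img -Sym_img.
apply: (gisom_of_same_kernel (pG := fun g => P g)).
- by move=> x; rewrite weil_to_quotE lfunE weil_to_quot_Sym_ker.
- exact: quot_act_weil_to_quot.
by move=> g Sg x; rewrite !lfunE /= -[Ylin sym _]/(Sym _) Sym_P.
Qed.
End Assembly.

Theorem theorem6p1 (K : finFieldType) (p : nat) (F : fieldType) (m : nat)
    (lam : K -> F) (nw : coset_of (H K m) -> {'GL_(m.+1 + m.+1)[K]})
    (Tq : {set K}) (P : {'GL_(m.+1 + m.+1)[K]} -> 'End(Ymod K m F)) :
  p \in [pchar K] -> odd p ->
  2%N \in [pchar F] -> (exists z : F, p.-primitive_root z) ->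
  additive_char lam -> (exists a, lam a != 1) ->
  weyl_lift nw -> pm_transversal Tq -> weil_rep lam P ->
  let e_chi a := e_of nw (chi lam (a *: v_ ord_max)) in
  rg F (c_ ord_max) *m e_of nw (chi lam (v_ ord_max))
    = e1 F nw + \sum_(a in Tq) (lam (- (2 * a)) + lam (2 * a)) *: e_chi a ->
  ((0 < m)%N ->
   rg F (c_ ord_pen) *m e_of nw (chi lam (v_ ord_max))
     = \sum_(a : K)
         rg F (w_ m.-1) *m rg F (x_ (- a)) *m rg F (w_ m.-1) *m e_of nw (chi lam (v_ ord_max))) ->
  let Ltilde := vquot_img (Smod F nw) (Lmod nw lam Tq) in
  [/\ (Ltilde <= vquot_img (Smod F nw) (Imod F nw))%VS,
      gstable (Sp K m) (@quot_act K m F nw) Ltilde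
    & gisom (Sp K m) (@quot_act K m F nw) Ltilde P (Yplus K m F)].
Proof.
move=> pK odd_p char2 _ lam_char lam_nontriv lift TqP weilP e_chi h1 h2 Ltilde.
have two : 2%:R != 0 :> K.
  rewrite -(dvdn_pcharf pK) dvdn_prime2 ?(pcharf_prime pK) //.
  by apply: contraTneq odd_p => ->.
have vn1 : v_ ord_max = 1 *: v_ ord_max :> 'cV[K]_(m.+1 + m.+1) by rewrite scale1r.
have evn : e_of nw (chi lam (v_ ord_max)) = weight_vec (@reg_act K m F) (T_sum nw (@reg_act K m F) (Bsum K m F)) lam (v_ ord_max).
  by rewrite vn1 e_of_weight_vec.
apply: quotient_isom_Yplus => //.
- rewrite -evn reg_actE h1 (e1_weight_vec nw char2 lam_char); congr (_ + _); apply: eq_bigr => a _.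
  by rewrite /e_chi e_of_weight_vec.
move=> m0; rewrite -evn reg_actE h2 //; apply: eq_bigr => a _.
have [Sw _ _] := perm_glP K (tperm (inord m.-1) (inord m.-1.+1) : 'S_(m.+1)).
have [Sx _ _ _ _] := x_P (- a) m0.
rewrite reg_actM ?Sp_mul // reg_actM //.
by rewrite -[LHS]mulmxA -[LHS]mulmxA.
Qed.
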